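(* Let $(M,g)$ be a $6$-dimensional oriented Riemannian spin manifold and let $\varphi$ be a unit spinor field on $M$, with associated $SU(3)$-structure, intrinsic torsion $\xi$, endomorphism $S\in\mathrm{End}(TM)$ and one-form $\eta$ determined by $\nabla^g_X\varphi=S(X)\cdot\varphi+\eta(X)\,j\cdot\varphi$. Then the $SU(3)$-structure induced by $\varphi$ is harmonic if and only if $$\chi^S\cdot\varphi-\frac12\,\xi_{\eta^\sharp}\cdot j\cdot\varphi+(\mathrm{div}\,S)\cdot\varphi+\mathrm{div}(\eta^\sharp)\,j\cdot\varphi+j\cdot S(\eta^\sharp)\cdot\varphi-|\eta|^2\varphi=0 .$$ If $\eta=0$, then harmonicity is equivalent to $\mathrm{div}\,S=0$. In particular, if $\xi$ belongs to the class $\mathcal W_1^+\oplus\mathcal W_1^-$ or to the pure class $\mathcal W_3$, then the $SU(3)$-structure is harmonic.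
   Context: Spinors: $\Delta=\mathbb R^8$ is the real spin representation of $\mathrm{Spin}(6)$ (the irreducible real Clifford module with $X\cdot X=-|X|^2$, with an inner product for which unit vectors act orthogonally). $S(M)$ is the associated real spinor bundle of a fixed spin structure, and $\nabla^g$ is the Levi-Civita connection and the connection it induces on $S(M)$. Differential forms act by Clifford multiplication ($e_a\wedge e_b$ acts as $e_a\cdot e_b$ for $a\ne b$). The element $j=e_1\cdot e_2\cdots e_6$ (oriented orthonormal frame) acts on spinors with $j^2=-1$, is parallel, and anticommutes with Clifford multiplication by vectors. For a unit spinor $\varphi$ there is an orthogonal decomposition $\Delta=\mathrm{span}\{\varphi\}\oplus\mathrm{span}\{j\cdot\varphi\}\oplus\{X\cdot\varphi\mid X\in\mathbb R^6\}$. Hence for a unit spinor field $\varphi$ there are a unique $S\in\mathrm{End}(TM)$ and a unique one-form $\eta$ with $\nabla^g_X\varphi=S(X)\cdot\varphi+\eta(X)j\cdot\varphi$. The almost complex structure $J_\varphi$ is defined by $J_\varphi(X)\cdot\varphi=j\cdot X\cdot\varphi$. $SU(3)$-structure and intrinsic torsion: the stabilizer of a unit spinor in $\mathrm{Spin}(6)$ maps isomorphically onto a subgroup $SU(3)\subset SO(6)$, so $\varphi$ defines a reduction $P\subset SO(M)$ to $G=SU(3)$. With $\mathfrak{so}(6)=\mathfrak{g}\oplus\mathfrak m$ ($\mathfrak g=\mathfrak{su}(3)$, $\mathfrak m=\mathfrak g^\perp$), the $\mathfrak g$-component of the Levi-Civita connection form restricted to $P$ defines a connection $\nabla^G$, and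 the intrinsic torsion is $\xi_XY=\nabla^G_XY-\nabla^g_XY$. A skew endomorphism $A$ is identified with the 2-form $\omega_A(Y,Z)=g(Y,AZ)$ when acting on spinors. With these conventions $\nabla^g_X\varphi=\frac12\xi_X\cdot\varphi$, and $X\cdot\omega_A-\omega_A\cdot X=2A(X)$ as Clifford elements. The structure is called harmonic if $L:=\sum_i(\nabla^g_{e_i}\xi)_{e_i}=0$ for local orthonormal frames $(e_i)$ (also when $M$ is non-compact). Notation: $\chi^S=\sum_i\xi_{e_i}S(e_i)$ (a vector field); $\mathrm{div}\,S=\sum_i(\nabla^g_{e_i}S)(e_i)$ (a vector field); $\mathrm{div}(\eta^\sharp)=\sum_i(\nabla^g_{e_i}\eta)(e_i)$; $\eta^\sharp$ is the vector field dual to $\eta$. Classes: $\xi\in\mathcal W_1^+\oplus\mathcal W_1^-$ means $\eta=0$ and $S=\lambda J_\varphi+\mu\,\mathrm{Id}$ with constants $\lambda,\mu$. $\xi\in\mathcal W_3$ means $\eta=0$, $S$ is symmetric and traceless, and $SJ_\varphi=-J_\varphi S$. *)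

(* Defs.v *)
From HB Require Import structures.
From mathcomp Require Import all_boot all_order all_algebra.
From mathcomp Require Import all_classical all_reals all_analysis.

Set Implicit Arguments.
Unset Strict Implicit.
Unset Printing Implicit Defensive.

Import Order.TTheory GRing.Theory Num.Theory.
Import numFieldNormedType.Exports.

Local Open Scope classical_set_scope.
Local Open Scope ring_scope.

(* MathComp-Analysis has no manifolds, bundles or connections; they are set up
   here in dimension 6 over an arbitrary realType. *)

Notation vec6 R := 'rV[R]_6.
Notation spinor8 R := 'cV[R]_8.
Notation basis6 a := (delta_mx 0 a).

Section SmoothFunctions.
Context {R : realType}.

Fixpoint iter_partial (s : seq 'I_6) (f : vec6 R -> R) : vec6 R -> R :=
  if s is i :: s' then fun x => 'D_(basis6 i) (iter_partial s' f) x else f.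

(* C^infinity on U: all iterated partial derivatives exist and are continuous *)
Definition smooth_on (U : set (vec6 R)) (f : vec6 R -> R) : Prop :=
  forall s x, U x ->
    {for x, continuous (iter_partial s f)} /\
    forall i, derivable (iter_partial s f) x (basis6 i).

End SmoothFunctions.

(* An oriented smooth 6-manifold. The atlas is presented by one chart around
   each point (overlapping charts are smoothly and positively compatible), so
   that a tangent vector at p can be represented by its components in the
   chart chosen at p. Hence the type of tangent vectors at p is vec6 R, and a
   vector field is a function M -> vec6 R. *)
Record oriented_manifold6 (R : realType) := OrientedManifold6 {
  carrier :> topologicalType;
  mfd_hausdorff : hausdorff_space carrier;
  mfd_second_countable : @second_countable carrier;
  chart_dom : carrier -> set carrier;
  chart : carrier -> carrier -> vec6 R;
  chart_inv : carrier -> vec6 R -> carrier;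
  chart_dom_open : forall p, open (chart_dom p);
  chart_dom_center : forall p, chart_dom p p;
  chart_img_open : forall p, open (chart p @` chart_dom p);
  chartK : forall p q, chart_dom p q -> chart_inv p (chart p q) = q;
  chart_continuous : forall p q, chart_dom p q ->
    {for q, continuous (chart p)};
  chart_inv_continuous : forall p x, (chart p @` chart_dom p) x ->
    {for x, continuous (chart_inv p)};
  chart_smooth : forall p q j,
    smooth_on (chart p @` (chart_dom p `&` chart_dom q))
              (fun x => chart q (chart_inv p x) 0 j);
  chart_oriented : forall p q x,
    (chart p @` (chart_dom p `&` chart_dom q)) x ->
    0 < \det (\matrix_(i < 6, j < 6)
                'D_(basis6 i) (fun y => chart q (chart_inv p y) 0 j) x) }.

Section Manifold.
Context {R : realType} {M : oriented_manifold6 R}.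

Definition smooth_fun (W : set M) (f : M -> R) : Prop :=
  forall q, smooth_on (chart q @` (W `&` chart_dom q)) (f \o chart_inv q).

(* The derivative v(f) of f along the tangent vector v at p. *)
Definition dir (p : M) (v : vec6 R) (f : M -> R) : R :=
  \sum_(i < 6) v 0 i * 'D_(basis6 i) (f \o chart_inv p) (chart p p).

Definition smooth_vf (W : set M) (X : M -> vec6 R) : Prop :=
  forall (W' : set M) f, open W' -> W' `<=` W -> smooth_fun W' f ->
    smooth_fun W' (fun p => dir p (X p) f).

(* Connections on TM: D p v Y is the covariant derivative at p, in the
   direction v, of a vector field Y smooth near p (and is unconstrained for
   other Y). *)
Definition is_connection (D : M -> vec6 R -> (M -> vec6 R) -> vec6 R) : Prop :=
  forall (W : set M) (Y : M -> vec6 R), open W -> smooth_vf W Y ->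
  [/\ forall p a v w, W p -> D p (a *: v + w) Y = a *: D p v Y + D p w Y,
      forall p v Z, W p -> smooth_vf W Z ->
        D p v (fun q => Y q + Z q) = D p v Y + D p v Z,
      forall p v f, W p -> smooth_fun W f ->
        D p v (fun q => f q *: Y q) = dir p v f *: Y p + f p *: D p v Y,
      forall p v Z, W p -> (forall q, W q -> Z q = Y q) -> D p v Z = D p v Y
    & forall X, smooth_vf W X -> smooth_vf W (fun p => D p (X p) Y)].

End Manifold.

Section Metric.
Context {R : realType}.

Definition bilin (G : 'M[R]_6) (v w : vec6 R) : R := (v *m G *m w^T) 0 0.

Record riemannian_metric (M : oriented_manifold6 R) := RiemannianMetric {
  gram :> M -> 'M[R]_6;
  gram_sym : forall p, (gram p)^T = gram p;
  gram_pos : forall p v, v != 0 -> 0 < bilin (gram p) v v;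
  gram_smooth : forall (W : set M) X Y, open W -> smooth_vf W X ->
    smooth_vf W Y -> smooth_fun W (fun p => bilin (gram p) (X p) (Y p)) }.

Context {M : oriented_manifold6 R} (g : riemannian_metric M).

Definition inner (p : M) (v w : vec6 R) : R := bilin (g p) v w.

(* Torsion-freeness, D_X Y - D_Y X = [X, Y], is tested on functions. *)
Definition levi_civita (D : M -> vec6 R -> (M -> vec6 R) -> vec6 R) : Prop :=
  [/\ is_connection D,
      forall (W : set M) Y Z p v, open W -> W p ->
        smooth_vf W Y -> smooth_vf W Z ->
        dir p v (fun q => inner q (Y q) (Z q)) =
        inner p (D p v Y) (Z p) + inner p (Y p) (D p v Z)
    & forall (W : set M) X Y f p, open W -> W p ->
        smooth_vf W X -> smooth_vf W Y -> smooth_fun W f ->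
        dir p (D p (X p) Y - D p (Y p) X) f =
        dir p (X p) (fun q => dir q (Y q) f) -
        dir p (Y p) (fun q => dir q (X q) f)].

Definition orthonormal (p : M) (e : 'I_6 -> vec6 R) : Prop :=
  forall a b, inner p (e a) (e b) = (a == b)%:R.

Definition oriented (e : 'I_6 -> vec6 R) : Prop :=
  0 < \det (\matrix_(a < 6, i < 6) e a 0 i).

Definition orthonormal_frame (W : set M) (e : 'I_6 -> M -> vec6 R) : Prop :=
  [/\ open W, forall a, smooth_vf W (e a)
    & forall p, W p -> orthonormal p (e ^~ p)].

Definition oriented_orthonormal_frame (W : set M) (e : 'I_6 -> M -> vec6 R) :=
  orthonormal_frame W e /\ forall p, W p -> oriented (e ^~ p).

(* The connection form of D along a frame e: D_v e_b = \sum_a omega_ab(v) e_a *)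
Definition conn_form (D : M -> vec6 R -> (M -> vec6 R) -> vec6 R)
    (e : 'I_6 -> M -> vec6 R) (p : M) (v : vec6 R) : 'M[R]_6 :=
  \matrix_(a < 6, b < 6) inner p (D p v (e b)) (e a p).

End Metric.

Section TensorFields.
Context {R : realType} {M : oriented_manifold6 R} (g : riemannian_metric M).
Local Notation tangent_conn := (M -> vec6 R -> (M -> vec6 R) -> vec6 R).
Local Notation torsion_field := (M -> vec6 R -> vec6 R -> vec6 R).

Definition intrinsic_torsion (D DG : tangent_conn)
    (xi : torsion_field) : Prop :=
  forall (W : set M) Y p X, open W -> W p -> smooth_vf W Y ->
    xi p X (Y p) = DG p X Y - D p X Y.

(* \sum_i (nabla_(e_i) xi)_(e_i) Z at p *)
Definition torsion_div (D : tangent_conn) (xi : torsion_field)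
    (e : 'I_6 -> M -> vec6 R) (p : M) (Z : M -> vec6 R) : vec6 R :=
  \sum_(i < 6)
    (D p (e i p) (fun q => xi q (e i q) (Z q))
     - xi p (D p (e i p) (e i)) (Z p)
     - xi p (e i p) (D p (e i p) Z)).

Definition harmonic_structure (D : tangent_conn) (xi : torsion_field) :=
  forall (W : set M) e Z p, orthonormal_frame g W e -> smooth_vf W Z -> W p ->
    torsion_div D xi e p Z = 0.

Definition chiS (xi : torsion_field)
    (S : M -> {linear vec6 R -> vec6 R}) (e : 'I_6 -> M -> vec6 R) (p : M) :=
  \sum_(i < 6) xi p (e i p) (S p (e i p)).

Definition div_endo (D : tangent_conn) (S : M -> {linear vec6 R -> vec6 R})
    (e : 'I_6 -> M -> vec6 R) (p : M) : vec6 R :=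
  \sum_(i < 6) (D p (e i p) (fun q => S q (e i q)) - S p (D p (e i p) (e i))).

Definition div_form (D : tangent_conn) (eta : M -> {scalar vec6 R})
    (e : 'I_6 -> M -> vec6 R) (p : M) : R :=
  \sum_(i < 6) (dir p (e i p) (fun q => eta q (e i q))
                - eta p (D p (e i p) (e i))).

Definition dual_field (eta : M -> {scalar vec6 R}) (V : M -> vec6 R) : Prop :=
  forall p X, inner g p (V p) X = eta p X.

Definition class_W1 (J : M -> vec6 R -> vec6 R)
    (S : M -> {linear vec6 R -> vec6 R}) (eta : M -> {scalar vec6 R}) : Prop :=
  (forall p X, eta p X = 0) /\
  exists lambda mu : R, forall p X, S p X = lambda *: J p X + mu *: X.

Definition class_W3 (J : M -> vec6 R -> vec6 R)
    (S : M -> {linear vec6 R -> vec6 R}) (eta : M -> {scalar vec6 R}) : Prop :=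
  [/\ forall p X, eta p X = 0,
      forall p X Y, inner g p (S p X) Y = inner g p X (S p Y),
      forall p, \tr (lin1_mx (S p)) = 0
    & forall p X, S p (J p X) = - J p (S p X)].

End TensorFields.

(* The real spin representation, as a module over the Clifford algebra of
   euclidean R^6; over a real closed field such a module of dimension 8 is
   automatically irreducible, and is unique up to isometry. *)
Record spin_module (R : realType) := SpinModule {
  cl :> {linear vec6 R -> 'M[R]_8};
  cl_sqr : forall v : vec6 R, cl v *m cl v = (- (v *m v^T) 0 0)%:M;
  cl_orthogonal : forall v : vec6 R, (v *m v^T) 0 0 = 1 ->
    (cl v)^T *m cl v = 1%:M }.

Section Spin.
Context {R : realType} (c : spin_module R).

(* The Clifford algebra acts faithfully on R^8, so Spin(6), the group of even
   products of unit vectors, is realized by 8 x 8 matrices. *)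
Definition Spin6 (h : 'M[R]_8) : Prop :=
  exists s : seq (vec6 R),
    [/\ ~~ odd (size s), forall v, v \in s -> (v *m v^T) 0 0 = 1
      & h = \big[mulmx/1%:M]_(v <- s) c v].

(* A in SO(6) is the image of h in Spin(6) under the double covering: h conjugates
   x into A x, where A acts on (the transpose of) x from the left. *)
Definition spin_covers (h : 'M[R]_8) (A : 'M[R]_6) : Prop :=
  forall x : vec6 R, h *m c x *m invmx h = c (x *m A^T).

Definition jmx : 'M[R]_8 := \big[mulmx/1%:M]_(a < 6) c (basis6 a).

Definition unit_spinor (psi : spinor8 R) : Prop := (psi^T *m psi) 0 0 = 1.

Definition SU3 (phi0 : spinor8 R) (A : 'M[R]_6) : Prop :=
  exists h, [/\ Spin6 h, h *m phi0 = phi0 & spin_covers h A].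

(* The Lie algebra of a closed matrix group: its tangent space at 1. *)
Definition lie_algebra (G : 'M[R]_6 -> Prop) (B : 'M[R]_6) : Prop :=
  exists gamma : R -> 'M[R]_6,
    [/\ forall t, G (gamma t), gamma 0 = 1%:M & is_derive (0 : R) 1 gamma B].

Definition su3 (phi0 : spinor8 R) : 'M[R]_6 -> Prop := lie_algebra (SU3 phi0).

(* The orthogonal complement of su(3) in so(6) *)
Definition su3_perp (phi0 : spinor8 R) (B : 'M[R]_6) : Prop :=
  B^T = - B /\ forall C, su3 phi0 C -> \tr (C^T *m B) = 0.

(* A spin structure, given by local oriented orthonormal frames covering M and
   a Spin(6)-valued cocycle lifting the SO(6)-valued cocycle of the frames:
   e^beta_b = \sum_a A_ab e^alpha_a with A the image of
   spin_trans alpha beta. *)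
Record spin_structure (M : oriented_manifold6 R) (g : riemannian_metric M) :=
  SpinStructure {
  spin_index :> Type;
  spin_dom : spin_index -> set M;
  spin_frame : spin_index -> 'I_6 -> M -> vec6 R;
  spin_trans : spin_index -> spin_index -> M -> 'M[R]_8;
  spin_dom_cover : forall p, exists al, spin_dom al p;
  spin_frameP : forall al,
    oriented_orthonormal_frame g (spin_dom al) (spin_frame al);
  spin_trans_smooth : forall al be i k,
    smooth_fun (spin_dom al `&` spin_dom be)
               (fun p => spin_trans al be p i k);
  spin_trans_spin : forall al be p, spin_dom al p -> spin_dom be p ->
    Spin6 (spin_trans al be p);
  spin_trans_lift : forall al be p, spin_dom al p -> spin_dom be p ->
    spin_covers (spin_trans al be p)
      (\matrix_(a < 6, b < 6)
         inner g p (spin_frame al a p) (spin_frame be b p));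
  spin_cocycle : forall al be ga p,
    spin_dom al p -> spin_dom be p -> spin_dom ga p ->
    spin_trans al be p *m spin_trans be ga p = spin_trans al ga p }.

Context {M : oriented_manifold6 R} {g : riemannian_metric M}.
Variable Q : spin_structure g.
Local Notation tangent_conn := (M -> vec6 R -> (M -> vec6 R) -> vec6 R).

(* A smooth section of S(M), given by its local representatives phi al in the
   trivializations of S(M) over spin_dom al. *)
Definition spinor_field (phi : Q -> M -> spinor8 R) : Prop :=
  (forall al i, smooth_fun (spin_dom al) (fun p => phi al p i 0)) /\
  (forall al be p, spin_dom al p -> spin_dom be p ->
     phi al p = spin_trans al be p *m phi be p).

Definition unit_spinor_field (phi : Q -> M -> spinor8 R) : Prop :=
  spinor_field phi /\ forall al p, spin_dom al p -> unit_spinor (phi al p).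

(* The operations below are read in the trivialization al, where e^al_a acts
   as c (basis6 a). *)

Definition vec_act (al : Q) (p : M) (X : vec6 R) : 'M[R]_8 :=
  c (\row_(a < 6) inner g p X (spin_frame al a p)).

(* omega_A acts as the sum of g(e_a, A e_b) e_a . e_b over a < b *)
Definition skew_act (al : Q) (p : M) (A : vec6 R -> vec6 R) : 'M[R]_8 :=
  \sum_(a < 6) \sum_(b < 6 | (a < b)%N)
    inner g p (spin_frame al a p) (A (spin_frame al b p)) *:
      (c (basis6 a) *m c (basis6 b)).

(* nabla_v phi = v(phi) + 1/2 \sum_(a < b) g(nabla_v e_a, e_b) e_a . e_b . phi *)
Definition spin_nabla (D : tangent_conn) (phi : Q -> M -> spinor8 R)
    (al : Q) (p : M) (v : vec6 R) : spinor8 R :=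
  (\col_(i < 8) dir p v (fun q => phi al q i 0)) +
  2^-1 *: ((\sum_(a < 6) \sum_(b < 6 | (a < b)%N)
     inner g p (D p v (spin_frame al a)) (spin_frame al b p) *:
       (c (basis6 a) *m c (basis6 b))) *m phi al p).

(* nabla_X phi = S(X) . phi + eta(X) j . phi *)
Definition spinor_derivative (D : tangent_conn) (phi : Q -> M -> spinor8 R)
    (S : M -> {linear vec6 R -> vec6 R}) (eta : M -> {scalar vec6 R}) : Prop :=
  forall al p X, spin_dom al p ->
    spin_nabla D phi al p X =
    vec_act al p (S p X) *m phi al p + eta p X *: (jmx *m phi al p).

Definition is_Jphi (phi : Q -> M -> spinor8 R) (J : M -> vec6 R -> vec6 R) :=
  forall al p X, spin_dom al p ->
    vec_act al p (J p X) *m phi al p = jmx *m vec_act al p X *m phi al p.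

(* The reduction P defined by phi: the frames u = e^al . A at p, with A the image
   of some h in Spin(6), such that the spin frame over u determined by h
   represents phi(p) by the fixed unit spinor phi0. *)
Definition reduction (phi0 : spinor8 R) (phi : Q -> M -> spinor8 R)
    (p : M) (u : 'I_6 -> vec6 R) : Prop :=
  exists al h A,
    [/\ spin_dom al p, Spin6 h, spin_covers h A,
        forall b, u b = \sum_(a < 6) A a b *: spin_frame al a p
      & phi al p = h *m phi0].

(* nabla^G: on local sections of P, its connection form is the su(3)-component
   of the connection form of D. *)
Definition SU3_connection (phi0 : spinor8 R) (phi : Q -> M -> spinor8 R)
    (D DG : tangent_conn) : Prop :=
  is_connection DG /\
  forall (W : set M) u, oriented_orthonormal_frame g W u ->
    (forall p, W p -> reduction phi0 phi p (u ^~ p)) ->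
    forall p v, W p ->
      su3 phi0 (conn_form g DG u p v) /\
      su3_perp phi0 (conn_form g D u p v - conn_form g DG u p v).

End Spin.

(* Main.v *)
From HB Require Import structures.
Require Import Defs.
From mathcomp Require Import all_boot all_order all_algebra.
From mathcomp Require Import all_classical all_reals all_analysis.
From mathcomp Require Import ring lra.
Import Order.TTheory GRing.Theory Num.Theory.
Import numFieldNormedType.Exports.
Local Open Scope classical_set_scope.
Local Open Scope ring_scope.

Set Implicit Arguments.
Unset Strict Implicit.
Unset Printing Implicit Defensive.

(** The idea is to compute in a local frame u of the reduction P, in which the
    spinor field phi is represented by the constant spinor phi0, so that only
    connection forms are left.

    Write w and wG for the connection forms of nabla^g and nabla^G in such a
    frame and N = wG - w for the matrices of xi. An element of su(3) kills
    phi0, so the spin covariant derivative of phi is (1/2) N . phi0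
    ([spin_nabla_adapted], [torsion_spinor]), which is S(X) . phi0 + eta(X) j . phi0.
    Let L be the matrix of the divergence of xi. Replacing w by wG - N in
    nabla^g, the quadratic terms [N(e_i), N(e_i)] vanish. Hence L takes values
    in the orthogonal complement m of su(3) ([torsion_div_mxP]), and
      (1/2) L . phi0 = (div S + chi^S) . phi0 + div(eta) j . phi0
    ([torsion_div_spinor]). Since m acts injectively on phi0
    ([torsion_module_inj]), L vanishes if and only if this spinor does. In the
    expression of the theorem, -(1/2) xi_eta . j . phi equals
    -j . S(eta) . phi + |eta|^2 phi, so it cancels the last two summands, and the
    expression is (1/2) L . phi ([harmonic_expression]).

    If eta = 0, then xi_X is the element of m with xi_X . phi = 2 S(X) . phi; it
    anticommutes with J and kills S(X), so chi^S = 0 ([torsion_kills_self],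
    [chiS_eta0]). For S = lambda J + mu Id, div S = lambda div J, and each summand
    of div J is computed from xi to be 0 ([W1_div_endo]). In the class W_3 the
    endomorphism S is symmetric and traceless. The contraction of the curvature
    of phi with Clifford multiplication has no component along phi, by the first
    Bianchi identity, and that component is the divergence of S up to sign
    ([div_endo_symmetric]).

    Two facts about spinors make this possible. A matrix commuting with the
    Clifford action acts on unit spinors by a scalar ([cl_commutant]); this identifies the
    differential of a lift to Spin(6) and shows that su(3) kills phi0. And any
    unit spinor is carried to any other by a product of two unit vectors, and
    this product can be chosen locally as a rational function of the spinors
    ([two_vectorsP], [avoidingP]); this gives the smooth local frames of P
    ([adapted_exists]). Conversely, explicit one-parameter
    subgroups of SU(3) suffice to describe m ([su3_generatorP],
    [su3_perp_torsion]). *)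

(** * Inner products of row and column vectors *)

(** Proves an equation between linear combinations of matrix products. The
    products are abstracted before passing to entries, where [ring] applies. *)
Ltac mxring :=
  repeat match goal with
  | |- context [@mulmx ?R ?m ?n ?p ?A ?B] =>
      let u := fresh "u" in set u := (@mulmx R m n p A B); clearbody u
  end;
  apply/matrixP => ? ?; rewrite !mxE; ring.

Section InnerProducts.
Context {R : comNzRingType}.

Definition dot n (x y : 'rV[R]_n) : R := (x *m y^T) 0 0.
Definition sprod n (f g : 'cV[R]_n) : R := (f^T *m g) 0 0.

Lemma dotE n (x y : 'rV[R]_n) : dot x y = \sum_a x 0 a * y 0 a.
Proof. by rewrite /dot mxE; apply: eq_bigr => a _; rewrite mxE. Qed.
Lemma dotC n (x y : 'rV[R]_n) : dot x y = dot y x.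
Proof. by rewrite !dotE; apply: eq_bigr => a _; rewrite mulrC. Qed.
Lemma dotDl n (x y z : 'rV[R]_n) : dot (x + y) z = dot x z + dot y z.
Proof. by rewrite /dot mulmxDl mxE. Qed.
Lemma dotDr n (x y z : 'rV[R]_n) : dot z (x + y) = dot z x + dot z y.
Proof. by rewrite !(dotC z) dotDl. Qed.
Lemma dotZl n k (x y : 'rV[R]_n) : dot (k *: x) y = k * dot x y.
Proof. by rewrite /dot -scalemxAl mxE. Qed.
Lemma dotZr n k (x y : 'rV[R]_n) : dot y (k *: x) = k * dot y x.
Proof. by rewrite dotC dotZl dotC. Qed.
Lemma dotNl n (x y : 'rV[R]_n) : dot (- x) y = - dot x y.
Proof. by rewrite -scaleN1r dotZl mulN1r. Qed.
Lemma dotNr n (x y : 'rV[R]_n) : dot x (- y) = - dot x y.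
Proof. by rewrite dotC dotNl dotC. Qed.
Lemma dot0l n (x : 'rV[R]_n) : dot 0 x = 0.
Proof. by rewrite /dot mul0mx mxE. Qed.
Lemma dot_basisr n (x : 'rV[R]_n) a : dot x (delta_mx 0 a) = x 0 a.
Proof.
rewrite dotE (bigD1 a) //= mxE !eqxx mulr1 big1 ?addr0 // => b ba.
by rewrite mxE (negPf ba) andbF mulr0.
Qed.
Lemma dot_mulmx n (x y : 'rV[R]_n) B : dot (x *m B) y = dot x (y *m B^T).
Proof. by rewrite /dot trmx_mul trmxK mulmxA. Qed.

Lemma sprodE n (f g : 'cV[R]_n) : sprod f g = \sum_i f i 0 * g i 0.
Proof. by rewrite /sprod mxE; apply: eq_bigr => a _; rewrite mxE. Qed.
Lemma sprodC n (f g : 'cV[R]_n) : sprod f g = sprod g f.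
Proof. by rewrite !sprodE; apply: eq_bigr => a _; rewrite mulrC. Qed.
Lemma sprodDl n (f g h : 'cV[R]_n) : sprod (f + g) h = sprod f h + sprod g h.
Proof. by rewrite /sprod linearD mulmxDl mxE. Qed.
Lemma sprodDr n (f g h : 'cV[R]_n) : sprod h (f + g) = sprod h f + sprod h g.
Proof. by rewrite !(sprodC h) sprodDl. Qed.
Lemma sprodZl n k (f g : 'cV[R]_n) : sprod (k *: f) g = k * sprod f g.
Proof. by rewrite /sprod linearZ -scalemxAl mxE. Qed.
Lemma sprodZr n k (f g : 'cV[R]_n) : sprod g (k *: f) = k * sprod g f.
Proof. by rewrite sprodC sprodZl sprodC. Qed.
Lemma sprodNl n (f g : 'cV[R]_n) : sprod (- f) g = - sprod f g.
Proof. by rewrite -scaleN1r sprodZl mulN1r. Qed.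
Lemma sprodNr n (f g : 'cV[R]_n) : sprod f (- g) = - sprod f g.
Proof. by rewrite sprodC sprodNl sprodC. Qed.
Lemma sprod0l n (f : 'cV[R]_n) : sprod 0 f = 0.
Proof. by rewrite /sprod trmx0 mul0mx mxE. Qed.
Lemma sprod0r n (f : 'cV[R]_n) : sprod f 0 = 0.
Proof. by rewrite sprodC sprod0l. Qed.
Lemma sprod_suml n (I : finType) (F : I -> 'cV[R]_n) z :
  sprod (\sum_i F i) z = \sum_i sprod (F i) z.
Proof. by rewrite /sprod linear_sum mulmx_suml summxE. Qed.
Lemma sprod_adj n (B : 'M[R]_n) (f g : 'cV[R]_n) :
  sprod (B *m f) g = sprod f (B^T *m g).
Proof. by rewrite /sprod trmx_mul mulmxA. Qed.

Lemma matrix_row_ext n m (A B : 'M[R]_(n, m)) :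
  (forall x : 'rV_n, x *m A = x *m B) -> A = B.
Proof. by move=> AB; apply/row_matrixP => i; rewrite !rowE. Qed.

End InnerProducts.

Lemma dotxx_ge0 (R : realDomainType) n (x : 'rV[R]_n) : 0 <= dot x x.
Proof. by rewrite dotE; apply: sumr_ge0 => a _; rewrite -expr2 sqr_ge0. Qed.
Lemma dotxx_eq0 (R : realDomainType) n (x : 'rV[R]_n) : dot x x = 0 -> x = 0.
Proof.
rewrite dotE => /eqP; rewrite psumr_eq0; last first.
  by move=> a _; rewrite -expr2 sqr_ge0.
move=> /allP x0; apply/rowP => a; rewrite !mxE.
have /= := x0 a; rewrite mem_index_enum => /(_ isT).
by rewrite -expr2 sqrf_eq0 => /eqP.
Qed.

(** * Clifford multiplication on spinors *)

Section Clifford.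
Context {R : realType} (c : spin_module R).
Local Notation basis a := (delta_mx 0 a : 'rV[R]_6).
Local Notation j := (jmx c).
Implicit Types (f : 'cV[R]_8) (x y : 'rV[R]_6).

Lemma cl_sum (x : 'rV[R]_6) : c x = \sum_a x 0 a *: c (basis a).
Proof.
rewrite {1}(row_sum_delta x) linear_sum; apply: eq_bigr => a _.
by rewrite linearZ.
Qed.

Lemma cl_sq x : c x *m c x = (- dot x x)%:M.
Proof. exact: cl_sqr. Qed.

(** Polarization of the Clifford relation, applied to x + y. *)
Lemma cl_anticomm x y : c x *m c y + c y *m c x = (- (2 * dot x y))%:M.
Proof.
have := cl_sq (x + y).
rewrite linearD mulmxDl !mulmxDr !cl_sq dotDl !dotDr (dotC y x).
set A := c x *m c y; set B := c y *m c x => h.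
have -> : A + B = (- dot x x)%:M + A + (B + (- dot y y)%:M)
   - (- dot x x)%:M - (- dot y y)%:M.
  by apply/matrixP => i k; rewrite !mxE; ring.
by rewrite h -!raddfB /=; congr (_%:M); ring.
Qed.

Lemma cl_swap x y : c x *m c y = - (c y *m c x) - (2 * dot x y)%:M.
Proof.
by apply: (addIr (c y *m c x)); rewrite cl_anticomm addrAC addNr add0r raddfN.
Qed.

(** A basis vector acts as an orthogonal matrix of square -1, so its transpose
    is its opposite; the general case follows by linearity. *)
Lemma cl_tr x : (c x)^T = - c x.
Proof.
rewrite cl_sum linear_sum -sumrN; apply: eq_bigr => a _.
rewrite linearZ /= -scalerN; congr (_ *: _).
have u : dot (basis a) (basis a) = 1 by rewrite dot_basisr mxE !eqxx.
have := cl_orthogonal c u; have := cl_sq (basis a); rewrite u raddfN => sq o.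
by rewrite -[LHS]mulmx1 -[1%:M]opprK -sq mulmxN mulmxA o mul1mx.
Qed.

Lemma cl_adj x f g : sprod (c x *m f) g = - sprod f (c x *m g).
Proof. by rewrite sprod_adj cl_tr mulNmx sprodNr. Qed.

(** The left side is symmetric in x and y, and the polarized Clifford relation
    computes its symmetrization. *)
Lemma cl_norm x y f : sprod (c x *m f) (c y *m f) = dot x y * sprod f f.
Proof.
have h : sprod (c x *m f) (c y *m f) + sprod (c x *m f) (c y *m f)
    = 2 * dot x y * sprod f f.
  rewrite {2}(sprodC (c x *m f)) !cl_adj !mulmxA -opprD -sprodDr -mulmxDl.
  by rewrite cl_anticomm mul_scalar_mx sprodZr; ring.
by rewrite -[LHS]mulr1 -(mulfV (_ : 2 != 0 :> R)) // mulrA mulr_natr mulr2n h; field.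
Qed.

Let word s := \big[mulmx/1%:M]_(a <- s) c (basis a).

Lemma basis_sqr a : c (basis a) *m c (basis a) = - 1%:M.
Proof. by rewrite cl_sq dot_basisr mxE !eqxx raddfN. Qed.

(** Moving a past s changes the sign once for each entry different from a. *)
Lemma word_comm a s : c (basis a) *m word s
  = (-1) ^+ count (predC1 a) s *: (word s *m c (basis a)).
Proof.
rewrite /word; elim: s => [|b s IH]; first by rewrite !big_nil mulmx1 mul1mx scale1r.
rewrite !big_cons mulmxA /=; case: (eqVneq b a) => [->|ba] /=.
  by rewrite add0n -!mulmxA IH -scalemxAr.
rewrite cl_swap dot_basisr mxE eqxx (negPf ba) mulr0 raddf0 subr0.
by rewrite mulNmx -!mulmxA IH -scalemxAr exprD expr1 mulN1r scaleNr.
Qed.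

(** Moving the head of the second copy to the front, past the tail of the first,
    yields one sign for each letter of the tail; its square yields one more. *)
Lemma word_sqr s : uniq s ->
  word s *m word s = (-1) ^+ (\sum_(k < (size s).+1) k) *: 1%:M.
Proof.
elim: s => [|a s IH]; first by rewrite /word !big_nil mulmx1 big_ord_recl big_ord0 scale1r.
move=> /= /andP[as_ us]; rewrite big_ord_recr /=.
have -> : word (a :: s) = c (basis a) *m word s by rewrite /word big_cons.
rewrite {1}word_comm.
have -> : count (predC1 a) s = size s.
  by apply/eqP; rewrite -all_count; apply/allP => b bs; apply: contraNneq as_ => <-.
rewrite -scalemxAl mulmxA -(mulmxA (word s)) basis_sqr mulmxN mulmx1 mulNmx IH //.
by rewrite scalerN scalerA -scaleNr exprD exprS; congr (_ *: _); ring.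
Qed.

Lemma word_orth s : (word s)^T *m word s = 1%:M.
Proof.
elim: s => [|a s IH]; first by rewrite /word !big_nil trmx1 mulmx1.
have -> : word (a :: s) = c (basis a) *m word s by rewrite /word big_cons.
by rewrite trmx_mul mulmxA -(mulmxA _ _ (c _)) cl_tr mulNmx basis_sqr opprK mulmx1.
Qed.

Lemma j_anti x : j *m c x = - (c x *m j).
Proof.
rewrite cl_sum mulmx_suml mulmx_sumr -sumrN; apply: eq_bigr => a _.
rewrite -scalemxAl -scalemxAr -scalerN; congr (_ *: _).
rewrite (word_comm a (index_enum _)).
have -> : count (predC1 a) (index_enum 'I_6) = 5.
  by rewrite -size_filter -/(enum _) -cardE cardC1 card_ord.
rewrite -scaleNr; set s := (- _); have -> : s = 1 by rewrite /s; ring.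
by rewrite scale1r.
Qed.

Lemma j_sqr : j *m j = - 1%:M.
Proof.
rewrite (word_sqr (index_enum_uniq 'I_6)).
have -> : size (index_enum 'I_6) = 6 by rewrite [index_enum _]unlock -enumT size_enum_ord.
rewrite !big_ord_recr big_ord0 /=; have -> : (-1) ^+ (0 + 0 + 1 + 2 + 3 + 4 + 5 + 6) = -1 :> R by ring.
by rewrite scaleN1r.
Qed.

Lemma j_tr : j^T = - j.
Proof.
have o := word_orth (index_enum 'I_6).
by rewrite -[LHS]mulmx1 -[1%:M]opprK -j_sqr mulmxN mulmxA o mul1mx.
Qed.

Lemma j_adj f g : sprod (j *m f) g = - sprod f (j *m g).
Proof. by rewrite sprod_adj j_tr mulNmx sprodNr. Qed.

Lemma j_cl x f : j *m (c x *m f) = - (c x *m (j *m f)).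
Proof. by rewrite !mulmxA j_anti mulNmx. Qed.
Lemma j_j f : j *m (j *m f) = - f.
Proof. by rewrite mulmxA j_sqr mulNmx mul1mx. Qed.
Lemma cl_cl x f : c x *m (c x *m f) = - dot x x *: f.
Proof. by rewrite mulmxA cl_sq mul_scalar_mx. Qed.

Lemma sprod_skew (B : 'M[R]_8) f : B^T = - B -> sprod f (B *m f) = 0.
Proof.
move=> sk; have : sprod f (B *m f) = - sprod f (B *m f).
  by rewrite -{1}(trmxK B) -sprod_adj sk mulNmx sprodNl sprodC.
by move=> h; lra.
Qed.

Lemma sprod_j f : sprod f (j *m f) = 0.
Proof. exact: sprod_skew j_tr. Qed.
Lemma sprod_cl f x : sprod f (c x *m f) = 0.
Proof. exact: sprod_skew (cl_tr x). Qed.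
Lemma sprod_jcl f x : sprod f (j *m (c x *m f)) = 0.
Proof.
rewrite mulmxA; apply: sprod_skew.
by rewrite trmx_mul j_tr cl_tr mulmxN mulNmx opprK j_anti opprK.
Qed.
Lemma sprod_jj f : sprod (j *m f) (j *m f) = sprod f f.
Proof. by rewrite j_adj j_j sprodNr opprK. Qed.

(** The vector V of the decomposition psi = a phi + b j phi + V . phi. *)
Definition vpart (phi psi : 'cV[R]_8) : 'rV[R]_6 :=
  \row_a sprod psi (c (basis a) *m phi).

Section UnitSpinor.
Variables (phi : 'cV[R]_8) (phi1 : unit_spinor phi).
Let u1 : sprod phi phi = 1 := phi1.

(** The eight spinors phi, j phi, e_1 phi, ..., e_6 phi are orthonormal in
    dimension eight, so they form a basis. *)
Lemma spinor_decomp psi : psi = sprod psi phi *: phi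
  + sprod psi (j *m phi) *: (j *m phi) + c (vpart phi psi) *m phi.
Proof.
pose f (k : 'I_(1 + (1 + 6))) := match fintype.split k with
  | inl _ => phi
  | inr l => match fintype.split l with
    | inl _ => j *m phi | inr a => c (basis a) *m phi end end.
pose F : 'M[R]_8 := \matrix_(i, k) f k i 0.
have FF : F^T *m F = 1%:M.
  apply/matrixP => k l; transitivity (sprod (f k) (f l)).
    by rewrite sprodE mxE; apply: eq_bigr => i _; rewrite !mxE.
  rewrite mxE -[k == l](inj_eq (can_inj (@splitK 1 (1 + 6)))) /f.
  case: (fintype.split (k : 'I_(1 + (1 + 6)))) => k1;
    case: (fintype.split (l : 'I_(1 + (1 + 6)))) => l1 //=.
  - by rewrite u1 !ord1.
  - by case: (fintype.split l1) => l2; rewrite ?sprod_j ?sprod_cl.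
  - by case: (fintype.split k1) => k2; rewrite sprodC ?sprod_j ?sprod_cl.
  - rewrite (inj_eq inr_inj) -[k1 == l1](inj_eq (can_inj (@splitK 1 6))).
    case: (fintype.split k1) => k2; case: (fintype.split l1) => l2 //=.
    + by rewrite sprod_jj u1 !ord1.
    + by rewrite j_adj sprod_jcl oppr0.
    + by rewrite sprodC j_adj sprod_jcl oppr0.
    + by rewrite cl_norm u1 mulr1 dot_basisr mxE eqxx (inj_eq inr_inj) eq_sym.
have E : psi = \sum_k sprod psi (f k) *: f k.
  rewrite -[LHS]mul1mx -(mulmx1C FF) -mulmxA; apply/colP => i.
  rewrite mxE summxE; apply: eq_bigr => k _; rewrite !mxE mulrC; congr (_ * _).
  by rewrite sprodE; apply: eq_bigr => l _; rewrite !mxE mulrC.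
rewrite {1}E big_split_ord big_ord1 /= big_split_ord big_ord1 /= addrA.
have f1 : f (lshift _ ord0) = phi by rewrite /f (unsplitK (inl _)).
have f2 : f (rshift _ (lshift _ ord0)) = j *m phi.
  by rewrite /f (unsplitK (inr _)) (unsplitK (inl _)).
rewrite f1 f2; congr (_ + _); rewrite cl_sum mulmx_suml; apply: eq_bigr => a _.
by rewrite /f !(unsplitK (inr _)) mxE scalemxAl.
Qed.

End UnitSpinor.
End Clifford.

(** A 6 x 2 matrix has a nonzero left kernel. *)
Lemma orthogonal_unit_exists (R : rcfType) (v w : 'rV[R]_6) :
  exists y : 'rV[R]_6, [/\ dot y y = 1, dot y v = 0 & dot y w = 0].
Proof.
pose A : 'M[R]_(6, 1 + 1) := row_mx v^T w^T.
have : kermx A != 0.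
  rewrite -mxrank_eq0 mxrank_ker -lt0n subn_gt0.
  by apply: leq_ltn_trans (rank_leq_col A) _.
case/rowV0Pn => y /sub_kermxP; rewrite /A mul_mx_row => yA y0.
have yv : dot y v = 0.
  by have /(congr1 lsubmx) := yA; rewrite row_mxKl linear0 /dot => ->; rewrite mxE.
have yw : dot y w = 0.
  by have /(congr1 rsubmx) := yA; rewrite row_mxKr linear0 /dot => ->; rewrite mxE.
have yy : dot y y != 0 by apply: contraNneq y0 => /dotxx_eq0 ->.
have yp : 0 < dot y y by rewrite lt0r yy dotxx_ge0.
exists ((Num.sqrt (dot y y))^-1 *: y); rewrite !dotZl dotZr yv yw !mulr0; split=> //.
by rewrite mulrA -expr2 exprVn sqr_sqrtr ?ltW // mulVf.
Qed.

(** * The action of 2-forms on spinors *)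

Section SpinRep.
Context {R : realType} (c : spin_module R).
Local Notation basis a := (delta_mx 0 a : 'rV[R]_6).
Local Notation j := (jmx c).
Implicit Types (f psi : 'cV[R]_8) (x y z : 'rV[R]_6) (A B C : 'M[R]_6).

Lemma cl_swapf x y f :
  c x *m (c y *m f) = - (c y *m (c x *m f)) - (2 * dot x y) *: f.
Proof. by rewrite !mulmxA cl_swap mulmxBl mulNmx mul_scalar_mx. Qed.

(** The Clifford action of the 2-form with matrix B, as a sum over a < b; it is
    meaningful for every B and linear, but [rhoE] needs B to be skew. *)
Definition rho B : 'M[R]_8 :=
  \sum_(a < 6) \sum_(b < 6 | (a < b)%N) B a b *: (c (basis a) *m c (basis b)).

Lemma rho_is_linear : linear rho.
Proof.
move=> k A B; rewrite /rho scaler_sumr -big_split; apply: eq_bigr => a _.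
rewrite scaler_sumr -big_split; apply: eq_bigr => b _.
by rewrite !mxE scalerDl scalerA.
Qed.
HB.instance Definition _ := GRing.isLinear.Build _ _ _ _ rho rho_is_linear.

Lemma rhoE B : B^T = - B ->
  rho B = 2^-1 *: \sum_b c (basis b *m B^T) *m c (basis b).
Proof.
move=> Bs.
have Bba a b : B b a = - B a b.
  by have /(congr1 (fun X : 'M[R]_6 => X a b)) := Bs; rewrite !mxE.
pose F a b := B a b *: (c (basis a) *m c (basis b)).
have E : \sum_b c (basis b *m B^T) *m c (basis b) = \sum_a \sum_b F a b.
  rewrite exchange_big; apply: eq_bigr => b _ /=.
  rewrite cl_sum mulmx_suml; apply: eq_bigr => a _.
  by rewrite -rowE !mxE -scalemxAl.
have E2 : \sum_a \sum_b F a b = rho B + rho B.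
  have -> : \sum_a \sum_b F a b =
      rho B + \sum_(a < 6) \sum_(b < 6 | (b < a)%N) F a b.
    rewrite -big_split; apply: eq_bigr => a _ /=.
    rewrite (bigID (fun b : 'I_6 => (a < b)%N)) /=; congr (_ + _).
    rewrite (bigD1 a) ?ltnn //= {1}/F.
    have -> : B a a = 0 by have := Bba a a => h; lra.
    rewrite scale0r add0r; apply: eq_bigl => b.
    by rewrite -leqNgt [RHS]ltn_neqAle andbC.
  congr (_ + _); rewrite (exchange_big_dep predT) //=; apply: eq_bigr => b _.
  apply: eq_bigr => a ab; rewrite /F cl_swap dot_basisr mxE eqxx.
  have -> : (b == a) = false by apply/eqP => e; rewrite e ltnn in ab.
  by rewrite mulr0 raddf0 subr0 Bba scalerN scaleNr opprK.
by rewrite E E2 -mulr2n -(scaler_nat 2 (rho B)) scalerA mulVf ?scale1r.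
Qed.

(** Taking commutators with vectors recovers the matrix of a 2-form. Thus
    - 1/2 rho(B) is the element of spin(6) that acts on vectors as B. *)
Lemma rho_cl B x : B^T = - B ->
  c x *m rho B - rho B *m c x = 2 *: c (x *m B^T).
Proof.
move=> Bs.
have E y z : c x *m (c y *m c z) - c y *m c z *m c x
     = (2 * dot x z) *: c y - (2 * dot x y) *: c z.
  rewrite mulmxA (cl_swap c x y) mulmxBl mulNmx mul_scalar_mx -!mulmxA (cl_swap c x z).
  by rewrite mulmxBr mulmxN mul_mx_scalar !mulmxA; mxring.
rewrite (rhoE Bs) -scalemxAr -scalemxAl -scalerBr mulmx_sumr mulmx_suml -sumrB.
under eq_bigr do rewrite E dot_basisr -!scalerA.
rewrite sumrB -!scaler_sumr scalerBr !scalerA.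
have -> : \sum_i x 0 i *: c (basis i *m B^T) = c (x *m B^T).
  rewrite [in RHS](row_sum_delta x) mulmx_suml linear_sum; apply: eq_bigr => a _.
  by rewrite -scalemxAl linearZ.
have -> : \sum_i dot x (basis i *m B^T) *: c (basis i) = - c (x *m B^T).
  rewrite [in RHS]cl_sum -sumrN; apply: eq_bigr => a _.
  rewrite dotC dot_mulmx trmxK -scaleNr; congr (_ *: _).
  by rewrite dotC dot_basisr Bs mulmxN [in RHS]mxE opprK.
by rewrite mulVf ?pnatr_eq0 // !scale1r opprK scaler_nat.
Qed.

Lemma rho_clf B x f : B^T = - B ->
  rho B *m (c x *m f) = c x *m (rho B *m f) - 2 *: (c (x *m B^T) *m f).
Proof. by move=> Bs; rewrite scalemxAl -(rho_cl _ Bs) mulmxBl !mulmxA opprB addrC subrK. Qed.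

Lemma rho_tr B : (rho B)^T = - rho B.
Proof.
rewrite /rho linear_sum -sumrN; apply: eq_bigr => a _.
rewrite linear_sum -sumrN; apply: eq_bigr => b ab.
rewrite linearZ /= -scalerN; congr (_ *: _).
rewrite trmx_mul !cl_tr mulNmx mulmxN opprK cl_swap dot_basisr mxE eqxx.
have -> : (b == a) = false by apply/eqP => e; rewrite e ltnn in ab.
by rewrite mulr0 raddf0 subr0 opprK.
Qed.

Lemma rho_j B f : rho B *m (j *m f) = j *m (rho B *m f).
Proof.
rewrite /rho !mulmx_suml mulmx_sumr; apply: eq_bigr => a _.
rewrite !mulmx_suml mulmx_sumr; apply: eq_bigr => b _.
by rewrite -!scalemxAl -scalemxAr -!mulmxA !j_cl mulmxN opprK.
Qed.

(** - 1/2 rho is a homomorphism of Lie algebras: expand rho(B) as a sum of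
    products of two vectors, on each of which rho(A) acts as a derivation. *)
Lemma rho_bracket A B : A^T = - A -> B^T = - B ->
  rho A *m rho B - rho B *m rho A = - 2 *: rho (A *m B - B *m A).
Proof.
move=> As Bs.
have Cs : (A *m B - B *m A)^T = - (A *m B - B *m A).
  by rewrite linearB /= !trmx_mul As Bs !mulNmx !mulmxN !opprK opprB.
have E y z : rho A *m (c y *m c z) - c y *m c z *m rho A
    = -2 *: (c (y *m A^T) *m c z + c y *m c (z *m A^T)).
  have r x : rho A *m c x = c x *m rho A - 2 *: c (x *m A^T).
    by rewrite -(rho_cl _ As) opprB addrC subrK.
  rewrite mulmxA r mulmxBl -!mulmxA r mulmxBr !mulmxA.
  by rewrite -scalemxAl -scalemxAr; mxring.
rewrite (rhoE Bs) (rhoE Cs) -scalemxAl -scalemxAr -scalerBr.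
rewrite mulmx_suml mulmx_sumr -sumrB scalerA mulrC -scalerA; congr (_ *: _).
under eq_bigr do rewrite E.
rewrite -scaler_sumr; congr (_ *: _); rewrite big_split /=.
have -> : \sum_i c (basis i *m B^T) *m c (basis i *m A^T)
    = - \sum_i c (basis i *m A^T *m B^T) *m c (basis i).
  transitivity (\sum_i \sum_k A k i *: (c (basis i *m B^T) *m c (basis k))).
    apply: eq_bigr => i _; rewrite [c (basis i *m A^T)]cl_sum mulmx_sumr.
    by apply: eq_bigr => k _; rewrite -scalemxAr -rowE !mxE.
  rewrite exchange_big -sumrN; apply: eq_bigr => k _ /=.
  have -> : basis k *m A^T = - \sum_i A k i *: basis i.
    rewrite As mulmxN -rowE [row k A]row_sum_delta; congr (- _).
    by apply: eq_bigr => i _; rewrite mxE.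
  rewrite mulNmx linearN mulNmx opprK mulmx_suml linear_sum mulmx_suml.
  by apply: eq_bigr => i _; rewrite -scalemxAl linearZ -scalemxAl.
rewrite -sumrB; apply: eq_bigr => i _.
rewrite -mulmxBl -[in LHS]linearB; congr (c _ *m _).
by rewrite [in RHS]linearB /= !trmx_mul mulmxBr !mulmxA.
Qed.

End SpinRep.

(** * The complex structure of a unit spinor *)

Section ComplexStructure.
Context {R : realType} (c : spin_module R).
Local Notation basis a := (delta_mx 0 a : 'rV[R]_6).
Local Notation j := (jmx c).
Implicit Types (f psi : 'cV[R]_8) (x y z : 'rV[R]_6) (A B C : 'M[R]_6).

(** The matrix of J_phi acting on column vectors; row vectors are therefore
    multiplied by its transpose. *)
Definition spinJ (phi : 'cV[R]_8) : 'M[R]_6 :=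
  \matrix_(a, b) sprod (j *m (c (basis b) *m phi)) (c (basis a) *m phi).

Lemma cl_commutant_j (M : 'M[R]_8) :
  (forall x, M *m c x = c x *m M) -> M *m j = j *m M.
Proof.
move=> Mc; rewrite /jmx; elim/big_rec: _ => [|a h _ IH]; first by rewrite mulmx1 mul1mx.
by rewrite mulmxA Mc -!mulmxA IH.
Qed.

Lemma vpart_is_linear (phi : 'cV[R]_8) : linear (vpart c phi).
Proof. by move=> k f psi; apply/rowP => a; rewrite !mxE sprodDl sprodZl. Qed.
HB.instance Definition _ phi :=
  GRing.isLinear.Build _ _ _ _ (vpart c phi) (vpart_is_linear phi).

Variables (phi : 'cV[R]_8) (phi1 : unit_spinor phi).
Let u1 : sprod phi phi = 1 := phi1.
Local Notation J := (spinJ phi).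

Lemma vpartK psi : sprod psi phi = 0 -> sprod psi (j *m phi) = 0 ->
  psi = c (vpart c phi psi) *m phi.
Proof. by move=> p0 p1; rewrite {1}(spinor_decomp c phi1 psi) p0 p1 !scale0r !add0r. Qed.

Lemma vpart_cl x : vpart c phi (c x *m phi) = x.
Proof. by apply/rowP => a; rewrite mxE cl_norm u1 mulr1 dot_basisr. Qed.

Lemma cl_phi_inj x y : c x *m phi = c y *m phi -> x = y.
Proof. by move=> xy; rewrite -(vpart_cl x) xy vpart_cl. Qed.

Lemma vpart_phi : vpart c phi phi = 0.
Proof. by apply/rowP => a; rewrite !mxE sprod_cl. Qed.
Lemma vpart_j : vpart c phi (j *m phi) = 0.
Proof. by apply/rowP => a; rewrite !mxE j_adj sprod_jcl oppr0. Qed.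

Lemma spinJ_vpart x : x *m J^T = vpart c phi (j *m (c x *m phi)).
Proof.
rewrite (row_sum_delta x) mulmx_suml !linear_sum mulmx_suml mulmx_sumr linear_sum.
apply: eq_bigr => b _; rewrite -scalemxAl !linearZ /= -scalemxAl -scalemxAr linearZ /=.
by congr (_ *: _); rewrite -rowE; apply/rowP => a; rewrite !mxE.
Qed.

Lemma spinJ_cl x : c (x *m J^T) *m phi = j *m (c x *m phi).
Proof.
rewrite spinJ_vpart -vpartK //; first by rewrite sprodC sprod_jcl.
by rewrite j_adj j_j sprodNr opprK sprodC sprod_cl.
Qed.

Lemma spinJ_tr : J^T = - J.
Proof. by apply/matrixP => a b; rewrite !mxE j_adj sprodC. Qed.

Lemma spinJ_sqr : J *m J = - 1%:M.
Proof.
have : J^T *m J^T = - 1%:M.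
  apply: matrix_row_ext => x; apply: cl_phi_inj.
  by rewrite mulmxA !spinJ_cl j_j mulmxN mulmx1 linearN mulNmx.
by rewrite spinJ_tr mulmxN mulNmx opprK.
Qed.

Lemma dotJ x y : dot (x *m J^T) y = - dot x (y *m J^T).
Proof. by rewrite dot_mulmx trmxK -[J in LHS]opprK -spinJ_tr mulmxN dotNr. Qed.
Lemma spinJJ x : x *m J^T *m J^T = - x.
Proof. by rewrite -mulmxA -trmx_mul spinJ_sqr linearN /= trmx1 mulmxN mulmx1. Qed.
Lemma dotJJ x y : dot (x *m J^T) (y *m J^T) = dot x y.
Proof. by rewrite dotJ spinJJ dotNr opprK. Qed.
Lemma dotxJ x : dot x (x *m J^T) = 0.
Proof. by have := dotJ x x; rewrite dotC => h; lra. Qed.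

(** Jy . phi = j . y . phi, and j anticommutes with y, which has square -1. *)
Lemma cl_complex_line y : dot y y = 1 -> c y *m (c (y *m J^T) *m phi) = j *m phi.
Proof. by move=> y1; rewrite spinJ_cl -[c y *m _]opprK -j_cl cl_cl y1 scaleN1r mulmxN opprK. Qed.

(** If y is orthogonal to x and Jx, then y . x . phi is again a vector times
    phi: z is the complex cross product of y and x. *)
Lemma cross_exists x : exists y z, [/\ dot y y = 1, dot y x = 0,
  dot y (x *m J^T) = 0 & c y *m (c x *m phi) = c z *m phi].
Proof.
have [y [y1 yx yJx]] := orthogonal_unit_exists x (x *m J^T).
exists y, (vpart c phi (c y *m (c x *m phi))); split => //; apply: vpartK.
  by rewrite cl_adj sprodC cl_norm yx mul0r oppr0.
have e : c y *m (j *m phi) = - (c (y *m J^T) *m phi) by rewrite spinJ_cl j_cl opprK.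
by rewrite cl_adj e sprodNr opprK cl_norm dotC dotJ yJx oppr0 mul0r.
Qed.

(** A matrix M commuting with the Clifford action also commutes with j. Write
    M phi = a phi + b j phi + V . phi. Applying M to y . Jy . phi = j phi with y
    orthogonal to V and JV gives V = 0, as y . Jy commutes with V while j
    anticommutes with it. Now M is a + b j on phi and a - b j on vectors times
    phi, but the even element y . e_1 maps phi to such a vector, so b = 0. *)
Lemma cl_commutant (M : 'M[R]_8) :
  (forall x, M *m c x = c x *m M) -> exists k, M *m phi = k *: phi.
Proof.
move=> Mc.
have Mcf x f : M *m (c x *m f) = c x *m (M *m f) by rewrite !mulmxA Mc.
have Mj f : M *m (j *m f) = j *m (M *m f) by rewrite !mulmxA cl_commutant_j.
have [a [b [V E]]] : exists a b V, M *m phi = a *: phi + b *: (j *m phi) + c V *m phi.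
  by eexists _, _, _; apply: (spinor_decomp c phi1).
have V0 : V = 0.
  have [y [y1 yV yJV]] := orthogonal_unit_exists V (V *m J^T).
  have := congr1 (mulmx M) (cl_complex_line y1).
  rewrite !Mcf Mj E !mulmxDr -!scalemxAr.
  rewrite spinJ_cl.
  have e1 : c y *m (c (y *m J^T) *m (j *m phi)) = j *m (j *m phi).
    by rewrite -[in RHS](cl_complex_line y1) !j_cl mulmxN opprK.
  have e2 : c y *m (c (y *m J^T) *m (c V *m phi)) = - (j *m (c V *m phi)).
    rewrite (cl_swapf c _ V) dotJ yJV oppr0 mulr0 scale0r subr0.
    rewrite mulmxN (cl_swapf c y V) yV mulr0 scale0r subr0 opprK.
    by rewrite cl_complex_line // j_cl opprK.
  rewrite e1 e2 -spinJ_cl cl_complex_line // => /addrI h.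
  have : j *m (c V *m phi) = 0.
    by apply/colP => i; have /colP/(_ i) := h; rewrite !mxE => hi; lra.
  by rewrite -spinJ_cl -[0](mul0mx _ phi) -[in X in _ = X](linear0 c)
    => /cl_phi_inj VJ; rewrite -[V]opprK -(spinJJ V) VJ mul0mx oppr0.
have [y [z [y1 yx yJx E2]]] := cross_exists (basis ord0).
have h : b *: (j *m (c z *m phi)) = 0.
  have := congr1 (mulmx M) E2; rewrite !Mcf E V0 linear0 mul0mx addr0 !mulmxDr.
  rewrite -!scalemxAr E2 => /addrI.
  have -> : c y *m (c (basis ord0) *m (j *m phi)) = j *m (c z *m phi).
    by rewrite -E2 !j_cl mulmxN opprK.
  rewrite j_cl scalerN => hh; apply/colP => i; have /colP/(_ i) := hh.
  by rewrite !mxE => hi; lra.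
exists a; rewrite E V0 linear0 mul0mx addr0; suff -> : b = 0 by rewrite scale0r addr0.
have zz : dot z z = 1.
  have : sprod (c z *m phi) (c z *m phi) = 1.
    rewrite -E2 cl_adj cl_cl y1 scaleN1r sprodNr opprK cl_norm u1 mulr1.
    by rewrite dot_basisr mxE !eqxx.
  by rewrite cl_norm u1 mulr1.
have := congr1 (sprod (j *m (c z *m phi))) h.
by rewrite sprodZr sprod_jj cl_norm zz u1 !mulr1 sprod0r.
Qed.

End ComplexStructure.

(** * The spin group and its transitivity on unit spinors *)

(** Factor the block matrix (1, v; 2 v^T, 1) in two ways. *)
Lemma det_reflection (R : comNzRingType) n (v : 'rV[R]_n) :
  \det (1%:M - 2 *: (v^T *m v)) = 1 - 2 * dot v v.
Proof.
pose M1 : 'M[R]_(1 + n) := block_mx 1%:M v (2 *: v^T) 1%:M.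
have e1 : M1 = block_mx 1%:M 0 (2 *: v^T) 1%:M
    *m block_mx 1%:M v 0 (1%:M - 2 *: (v^T *m v)).
  rewrite mulmx_block !mul1mx !mulmx1 ?mul0mx ?mulmx0 ?addr0.
  by rewrite -scalemxAl addrC subrK.
have e2 : M1 = block_mx (1%:M - 2 *: (v *m v^T)) v 0 1%:M
    *m block_mx 1%:M 0 (2 *: v^T) 1%:M.
  rewrite mulmx_block !mul1mx !mulmx1 ?mul0mx ?mulmx0 ?add0r ?addr0.
  by rewrite -scalemxAr subrK.
have d1 : \det M1 = \det (1%:M - 2 *: (v^T *m v)).
  by rewrite e1 det_mulmx det_lblock det_ublock !det1 !mul1r.
have d2 : \det M1 = \det (1%:M - 2 *: (v *m v^T)).
  by rewrite e2 det_mulmx det_lblock det_ublock !det1 !mulr1.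
by rewrite -d1 d2 det_mx11 !mxE /dot eqxx mxE.
Qed.

Section SpinGroup.
Context {R : realType} (c : spin_module R).
Local Notation basis a := (delta_mx 0 a : 'rV[R]_6).
Local Notation j := (jmx c).
Implicit Types (f psi phi : 'cV[R]_8) (x y z : 'rV[R]_6) (A B C : 'M[R]_6) (h k : 'M[R]_8).

Let word (s : seq 'rV[R]_6) := \big[mulmx/1%:M]_(v <- s) c v.
Let units (s : seq 'rV[R]_6) := forall v, v \in s -> dot v v = 1.

Lemma spin_mul h k : Spin6 c h -> Spin6 c k -> Spin6 c (h *m k).
Proof.
move=> [s [se su ->]] [t [te tu ->]]; exists (s ++ t); split.
- by rewrite size_cat oddD (negPf se) (negPf te).
- by move=> v; rewrite mem_cat => /orP[/su|/tu].
- rewrite big_cat_nested /=; elim: s {se su} => [|v s IH]; first by rewrite !big_nil mul1mx.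
  by rewrite !big_cons -mulmxA IH.
Qed.

Lemma spin_two x y : dot x x = 1 -> dot y y = 1 -> Spin6 c (c x *m c y).
Proof.
move=> x1 y1; exists [:: x; y]; split=> //.
- by move=> v; rewrite !inE => /orP[]/eqP->.
- by rewrite !big_cons big_nil mulmx1.
Qed.

(** A unit vector v conjugates x to minus its reflection, with matrix
    2 v^T v - 1; in dimension 6 this has determinant -1. *)
Lemma spin_covering_word s : units s -> exists A,
  [/\ word s *m (word s)^T = 1%:M, forall x, word s *m c x *m (word s)^T = c (x *m A^T),
      A *m A^T = 1%:M & \det A = (-1) ^+ size s].
Proof.
rewrite /word; elim: s => [_|v s IH us].
  exists 1%:M; rewrite big_nil !trmx1 !mulmx1 det1; split=> // x.
  by rewrite mul1mx !mulmx1.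
have [A [wo cov oA dA]] := IH (fun w ws => us w (mem_behead (s := v :: s) ws)).
have v1 : dot v v = 1 by apply: us; rewrite mem_head.
set B : 'M[R]_6 := 2 *: (v^T *m v) - 1%:M.
have BT : B^T = B by rewrite /B linearB linearZ /= trmx_mul trmxK trmx1.
have BB : B *m B = 1%:M.
  have e : v^T *m v *m (v^T *m v) = v^T *m v.
    rewrite mulmxA -(mulmxA v^T) (_ : v *m v^T = 1%:M) ?mulmx1 //.
    by apply/matrixP => i k; rewrite !ord1 [RHS]mxE -v1.
  rewrite /B mulmxBl !mulmxBr !mul1mx mulmx1 -!scalemxAl -!scalemxAr e ?mulmx1.
  by rewrite scalerA; mxring.
have cB x : c v *m c x *m (c v)^T = c (x *m B^T).
  rewrite BT /B mulmxBr mulmx1 -scalemxAr mulmxA linearB linearZ /=.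
  have -> : x *m v^T = (dot x v)%:M by apply/matrixP => i k; rewrite !ord1 [RHS]mxE.
  rewrite mul_scalar_mx linearZ /= cl_tr mulmxN cl_swap mulmxBl mulNmx -mulmxA.
  rewrite cl_sq v1 mul_scalar_mx mul_mx_scalar scalerA (dotC v x); mxring.
exists (B *m A); rewrite big_cons; split.
- by rewrite trmx_mul mulmxA -(mulmxA (c v)) wo mulmx1 cl_tr mulmxN cl_sq v1 raddfN opprK.
- move=> x; rewrite [in LHS]trmx_mul mulmxA -(mulmxA (c v)) -(mulmxA (c v)) cov cB.
  by rewrite trmx_mul mulmxA.
- by rewrite trmx_mul mulmxA -(mulmxA B) oA mulmx1 BT BB.
- rewrite det_mulmx dA exprS; congr (_ * _).
  have -> : B = -1 *: (1%:M - 2 *: (v^T *m v)) by rewrite scaleN1r opprB.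
  by rewrite detZ det_reflection v1 -signr_odd /= expr0; ring.
Qed.

Lemma spin_orth h : Spin6 c h -> h *m h^T = 1%:M.
Proof. by move=> [s [_ us ->]]; have [A []] := spin_covering_word us. Qed.
Lemma spin_orthl h : Spin6 c h -> h^T *m h = 1%:M.
Proof. by move=> /spin_orth /mulmx1C. Qed.

Lemma spin_invmx h : Spin6 c h -> invmx h = h^T.
Proof.
move=> sh; have hu : h \in unitmx by apply: (mulmx1_unit (spin_orth sh)).1.
by rewrite -[LHS]mulmx1 -(spin_orth sh) mulmxA mulVmx // mul1mx.
Qed.

Lemma spin_covering h : Spin6 c h -> exists A,
  [/\ spin_covers c h A, A *m A^T = 1%:M & \det A = 1].
Proof.
move=> sh; have := sh => -[s [es us hE]].
have [A [wo cov oA dA]] := spin_covering_word us.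
exists A; split=> //; last by rewrite dA -signr_odd (negPf es).
by move=> x; rewrite (spin_invmx sh) hE.
Qed.

Lemma covers_cl h A x : Spin6 c h -> spin_covers c h A ->
  h *m c x = c (x *m A^T) *m h.
Proof. by move=> sh cov; rewrite -cov (spin_invmx sh) -mulmxA spin_orthl // mulmx1. Qed.

Lemma exists_unit_spinor : exists f : 'cV[R]_8, unit_spinor f.
Proof.
exists (delta_mx ord0 0); rewrite /unit_spinor -/(sprod _ _) sprodE (bigD1 ord0) //=.
rewrite mxE !eqxx mulr1 big1 ?addr0 // => i i0.
by rewrite mxE (negPf i0) mul0r.
Qed.

(** Clifford multiplication on a unit spinor is injective. *)
Lemma covers_unique h A B : spin_covers c h A -> spin_covers c h B -> A = B.
Proof.
move=> hA hB; have [f f1] := exists_unit_spinor; apply: trmx_inj.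
by apply: matrix_row_ext => x; apply: (cl_phi_inj (c := c) f1); rewrite -hA hB.
Qed.

Lemma covers_orth h A : Spin6 c h -> spin_covers c h A -> A *m A^T = 1%:M.
Proof. by move=> sh hA; have [B [/(covers_unique hA) -> ]] := spin_covering sh. Qed.
Lemma covers_det h A : Spin6 c h -> spin_covers c h A -> \det A = 1.
Proof. by move=> sh hA; have [B [/(covers_unique hA) -> ]] := spin_covering sh. Qed.

Lemma spin_j h : Spin6 c h -> h *m j = j *m h.
Proof.
move=> [s [se _ ->]].
suff : word s *m j = (-1) ^+ size s *: (j *m word s).
  by rewrite -signr_odd (negPf se) scale1r.
rewrite /word; elim: s {se} => [|v s IH]; first by rewrite big_nil mul1mx mulmx1 scale1r.
rewrite !big_cons -mulmxA IH -scalemxAr !mulmxA j_anti mulNmx exprS mulN1r.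
by rewrite scaleNr scalerN opprK.
Qed.
Lemma spin_jf h f : Spin6 c h -> h *m (j *m f) = j *m (h *m f).
Proof. by move=> sh; rewrite !mulmxA spin_j. Qed.

(** If psi is orthogonal to y . phi and j . y . phi, then y . psi = z . phi for a
    vector z, so y . z . phi = - |y|^2 psi. Normalizing here instead of assuming
    |y| = 1 makes the element a rational function of y and psi. *)
Definition two_vectors phi y psi : 'M[R]_8 :=
  - (dot y y)^-1 *: (c y *m c (vpart c phi (c y *m psi))).

Lemma two_vectorsP phi y psi : unit_spinor phi -> unit_spinor psi ->
  y != 0 -> dot y (vpart c phi psi) = 0 -> dot y (vpart c phi (j *m psi)) = 0 ->
  Spin6 c (two_vectors phi y psi) /\ two_vectors phi y psi *m phi = psi.
Proof.
move=> phi1 psi1 y0 y1 y2.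
have yy : 0 < dot y y.
  by rewrite lt0r dotxx_ge0 andbT; apply: contraNneq y0 => /dotxx_eq0 ->.
have vE f : dot y (vpart c phi f) = sprod f (c y *m phi).
  rewrite cl_sum mulmx_suml sprodC sprod_suml dotE; apply: eq_bigr => a _.
  by rewrite mxE -scalemxAl sprodZl sprodC.
set z := vpart c phi (c y *m psi).
have zE : c z *m phi = c y *m psi.
  rewrite -vpartK //.
    by rewrite cl_adj -vE y1 oppr0.
  by rewrite cl_adj -[_ *m (_ *m _)]opprK -j_cl sprodNr opprK sprodC j_adj sprodC -vE y2 oppr0.
have zz : dot z z = dot y y.
  rewrite -[LHS]mulr1 -phi1 -/(sprod _ _) -(cl_norm c) zE cl_norm.
  by rewrite [sprod _ _]psi1 mulr1.
have yn : dot y y != 0 by rewrite gt_eqF.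
split; last first.
  by rewrite -scalemxAl -mulmxA zE cl_cl scalerA mulrNN mulVf // scale1r.
pose r := (Num.sqrt (dot y y))^-1.
have rr : r * r * dot y y = 1.
  by rewrite -expr2 exprVn sqr_sqrtr ?ltW // mulVf.
have -> : two_vectors phi y psi = c (r *: y) *m c (- r *: z).
  rewrite /two_vectors [c (r *: y)]linearZ [c (- r *: z)]linearZ /= -scalemxAl -scalemxAr scalerA; congr (_ *: _).
  by rewrite mulrN; congr (- _); apply: (mulIf yn); rewrite rr mulVf.
by apply: spin_two; rewrite dotZl dotZr mulrA ?mulrNN ?zz.
Qed.

(** Two linear conditions on a vector of R^6 leave room for a unit vector. *)
Lemma spin_transitive phi psi : unit_spinor phi -> unit_spinor psi ->
  exists2 h, Spin6 c h & h *m phi = psi.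
Proof.
move=> phi1 psi1.
have [y [yy y1 y2]] := orthogonal_unit_exists (vpart c phi psi) (vpart c phi (j *m psi)).
have [] := two_vectorsP phi1 psi1 _ y1 y2; last by move=> sh hE; exists (two_vectors phi y psi).
by apply: contra_eq_neq yy => ->; rewrite dot0l eq_sym oner_eq0.
Qed.

(** The two vectors to which [two_vectorsP] requires y to be orthogonal are
    orthogonal to each other and have the same length. Scaling by the square of
    that length makes the projection of y polynomial in psi. *)
Definition avoiding phi y psi : 'rV[R]_6 :=
  let v := vpart c phi psi in let w := vpart c phi (j *m psi) in
  dot v v *: y - dot y v *: v - dot y w *: w.

Lemma vpart_jpsi phi psi : unit_spinor phi ->
  vpart c phi (j *m psi) = vpart c phi psi *m (spinJ c phi)^T.
Proof.
move=> phi1; rewrite {1}(spinor_decomp c phi1 psi) !mulmxDr -!scalemxAr j_j.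
by rewrite !linearD !linearZ /= linearN /= vpart_phi vpart_j oppr0 !scaler0 !add0r spinJ_vpart.
Qed.

Lemma avoidingP phi y psi : unit_spinor phi ->
  dot (avoiding phi y psi) (vpart c phi psi) = 0 /\
  dot (avoiding phi y psi) (vpart c phi (j *m psi)) = 0.
Proof.
move=> phi1; rewrite /avoiding vpart_jpsi //; set v := vpart c phi psi.
set w := v *m _; have vw : dot v w = 0 by apply: dotxJ.
have ww : dot w w = dot v v by apply: dotJJ.
rewrite -!scaleNr !dotDl !dotZl (dotC w v) vw ww; split; ring.
Qed.
End SpinGroup.

(** * The Lie algebra of the stabilizer of a spinor *)

Section MatrixDerivatives.
Context {R : realType} {V : normedModType R}.
Implicit Types (x v : V).

Lemma is_derive_mxP m n (F : V -> 'M[R]_(m, n)) (dF : 'M[R]_(m, n)) x v :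
  is_derive x v F dF <-> forall i k, is_derive x v (fun t => F t i k) (dF i k).
Proof.
split=> [dF1 i k|h].
  have dF' : derivable F x v := @ex_derive _ _ _ _ _ _ _ dF1.
  split; first exact: ((derivable_mxP F x v).1 dF').
  by have := @derive_val _ _ _ _ _ _ _ dF1; rewrite derive_mx // => <-; rewrite mxE.
have dF' : derivable F x v.
  by apply: (derivable_mxP F x v).2 => i k; have [] := h i k.
split=> //; rewrite derive_mx //; apply/matrixP => i k; rewrite mxE.
by have [] := h i k.
Qed.

Lemma is_derive_mulmx m n p (F : V -> 'M[R]_(m, n)) (G : V -> 'M[R]_(n, p)) dF dG x v :
  is_derive x v F dF -> is_derive x v G dG ->
  is_derive x v (fun t => F t *m G t) (dF *m G x + F x *m dG).
Proof.
move=> /is_derive_mxP hF /is_derive_mxP hG; apply/is_derive_mxP => i k.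
have -> : (fun t => (F t *m G t) i k) =
    \sum_l ((fun t => F t i l) * (fun t => G t l k)).
  by apply/funext => t; rewrite mxE fct_sumE.
apply: is_derive_eq.
rewrite !mxE -big_split; apply: eq_bigr => l _ /=.
by rewrite addrC /GRing.scale /= (mulrC (G x l k)).
Qed.
End MatrixDerivatives.

Section StabilizerAlgebra.
Context {R : realType} (c : spin_module R).
Local Notation basis a := (delta_mx 0 a : 'rV[R]_6).
Local Notation j := (jmx c).
Implicit Types (f psi : 'cV[R]_8) (x y z : 'rV[R]_6) (A B C : 'M[R]_6) (h : 'M[R]_8).
Variables (phi : 'cV[R]_8) (phi1 : unit_spinor phi).
Let u1 : sprod phi phi = 1 := phi1.
Local Notation J := (spinJ c phi).

(** The spin element fixing phi and covering A is determined on the basis phi,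
    j phi, e_a phi; it is affine in A, so it inherits differentiability in A. *)
Let lift A : 'M[R]_8 := phi *m phi^T + (j *m phi) *m (j *m phi)^T
  + \sum_a (c (basis a *m A^T) *m phi) *m (c (basis a) *m phi)^T.

Let outer (f psi g : 'cV[R]_8) : f *m psi^T *m g = sprod g psi *: f.
Proof.
rewrite -mulmxA (_ : psi^T *m g = (sprod g psi)%:M) ?mul_mx_scalar //.
by apply/matrixP => i k; rewrite !ord1 sprodC /sprod [RHS]mxE.
Qed.

Let liftE h A : Spin6 c h -> h *m phi = phi -> spin_covers c h A -> h = lift A.
Proof.
move=> sh hphi cov; apply: trmx_inj; apply: matrix_row_ext => x.
apply: trmx_inj; rewrite !trmx_mul !trmxK; move: x^T => f.
rewrite {1}(spinor_decomp c phi1 f) !mulmxDr -!scalemxAr hphi spin_jf // hphi.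
rewrite mulmxA (covers_cl _ sh cov) -mulmxA hphi /lift !mulmxDl !outer.
congr (_ + _); rewrite [vpart c phi f]row_sum_delta mulmx_suml linear_sum !mulmx_suml.
apply: eq_bigr => a _; rewrite outer -scalemxAl linearZ /= -scalemxAl.
by rewrite !mxE.
Qed.

(** Let A_t be a curve in SU(3) through 1 with derivative C. Its lift h_t fixes
    phi and is differentiable. Differentiating h_t c(x) = c(A_t x) h_t shows that
    h' + 1/2 rho(C) commutes with the Clifford action, so it acts on phi as a
    scalar. As h' phi = 0 and rho(C) is skew, this scalar is 0. *)
Lemma su3_kills C : su3 c phi C -> C^T = - C /\ rho c C *m phi = 0.
Proof.
move=> [gamma [G g0 dg]].
have dgT : is_derive (0 : R) 1 (fun t => (gamma t)^T) C^T.
  apply/is_derive_mxP => i k; rewrite mxE.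
  rewrite (_ : (fun t => (gamma t)^T i k) = (fun t => gamma t k i)).
    by move/is_derive_mxP : dg; apply.
  by apply/funext => t; rewrite mxE.
have CT : C^T = - C.
  have := is_derive_mulmx dg dgT.
  have -> : (fun t => gamma t *m (gamma t)^T) = cst 1%:M.
    by apply/funext => t; have [h [sh _ cov]] := G t; rewrite (covers_orth sh cov).
  move=> [_]; rewrite derive_cst g0 trmx1 mulmx1 mul1mx => /esym/eqP.
  by rewrite addrC addr_eq0 => /eqP.
split=> //.
pose H t := lift (gamma t).
pose H' : 'M[R]_8 := \sum_a (c (basis a *m C^T) *m phi) *m (c (basis a) *m phi)^T.
have HE t h : Spin6 c h -> h *m phi = phi -> spin_covers c h (gamma t) -> h = H t.
  by move=> *; apply: liftE.
have dcl x : is_derive (0 : R) 1 (fun t => c (x *m (gamma t)^T)) (c (x *m C^T)).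
  apply/is_derive_mxP => i k.
  have /is_derive_mxP dx := is_derive_mulmx (is_derive_cst x (0 : R) 1) dgT.
  have E y : (c y) i k = (\sum_a y 0 a *: c (basis a) i k).
    by rewrite cl_sum summxE; apply: eq_bigr => a _; rewrite mxE.
  under eq_fun do rewrite E.
  have -> : (fun t => \sum_a (x *m (gamma t)^T) 0 a *: (c (basis a) i k : R)) =
     \sum_a (c (basis a) i k \*: (fun t => (x *m (gamma t)^T) 0 a)).
    by apply/funext => t; rewrite fct_sumE; apply: eq_bigr => a _; rewrite /GRing.scale /= mulrC.
  apply: is_derive_eq; rewrite E; apply: eq_bigr => a _.
  by rewrite mul0mx add0r /GRing.scale /= mulrC.
have dH : is_derive (0 : R) 1 H H'.
  rewrite -[H']add0r.
  have -> : H = cst (phi *m phi^T + (j *m phi) *m (j *m phi)^T)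
    + \sum_a (fun t => c (basis a *m (gamma t)^T) *m phi *m (c (basis a) *m phi)^T).
    by apply/funext => t; rewrite /H /lift /= !fctE fct_sumE.
  apply: is_deriveD.
  apply: is_derive_sum => a.
  have := is_derive_mulmx (is_derive_mulmx (dcl (basis a)) (is_derive_cst phi (0 : R) 1))
    (is_derive_cst (c (basis a) *m phi)^T (0 : R) 1).
  by rewrite !mulmx0 !addr0.
have H0 : H 0 = 1%:M.
  apply/esym/HE; rewrite ?mul1mx //; first by exists [::]; rewrite big_nil.
  by move=> x; rewrite g0 trmx1 mulmx1 mul1mx invmx1 mulmx1.
have Hc x : H' *m c x - c x *m H' = c (x *m C^T).
  have d1 := is_derive_mulmx dH (is_derive_cst (c x) (0 : R) 1).
  have := is_derive_mulmx (dcl x) dH.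
  have -> : (fun t => c (x *m (gamma t)^T) *m H t) = (fun t => H t *m c x).
    apply/funext => t; have [h [sh hp cov]] := G t.
    by rewrite -(HE _ _ sh hp cov) (covers_cl _ sh cov).
  move=> [_ e1]; case: d1 => [_ e2]; move: e1; rewrite e2 H0 g0 trmx1 !mulmx1 mulmx0 addr0.
  by move=> ->; rewrite addrK.
have H'phi : H' *m phi = 0.
  rewrite mulmx_suml big1 // => a _; rewrite outer sprod_cl scale0r //.
have [k kE] : exists k, (H' + 2^-1 *: rho c C) *m phi = k *: phi.
  apply: (cl_commutant (c := c) phi1) => x.
  have e := rho_cl c x CT; have e2 := Hc x.
  rewrite mulmxDl mulmxDr -scalemxAl -scalemxAr.
  apply/eqP; rewrite -subr_eq0 opprD addrACA e2 -scalerBr -opprB e.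
  by rewrite scalerN scalerA mulVf ?pnatr_eq0 // scale1r subrr.
move: kE; rewrite mulmxDl H'phi add0r -scalemxAl => kE.
have : sprod phi (2^-1 *: (rho c C *m phi)) = k by rewrite kE sprodZr u1 mulr1.
rewrite sprodZr (sprod_skew _ (rho_tr c C)) mulr0 => k0.
move: kE; rewrite -k0 scale0r => /eqP; rewrite scaler_eq0 invr_eq0 pnatr_eq0 /=.
by move=> /eqP.
Qed.

End StabilizerAlgebra.

(** * The orthogonal complement of the stabilizer algebra *)

Section TorsionModule.
Context {R : realType} (c : spin_module R).
Local Notation basis a := (delta_mx 0 a : 'rV[R]_6).
Local Notation j := (jmx c).
Implicit Types (f psi : 'cV[R]_8) (x y z : 'rV[R]_6) (A B C : 'M[R]_6) (h : 'M[R]_8).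
Variables (phi : 'cV[R]_8) (phi1 : unit_spinor phi).
Let u1 : sprod phi phi = 1 := phi1.
Local Notation J := (spinJ c phi).

Let rot (t : R) x y : 'M[R]_8 := cos t *: 1%:M + sin t *: (c x *m c y).

Let rot_spin t x y : dot x x = 1 -> dot y y = 1 -> dot y x = 0 -> Spin6 c (rot t x y).
Proof.
move=> x1 y1 yx; have -> : rot t x y = c x *m c (sin t *: y - cos t *: x).
  have -> : c (sin t *: y - cos t *: x) = sin t *: c y - cos t *: c x.
    by rewrite linearB !linearZ.
  rewrite mulmxBr -!scalemxAr cl_sq x1 raddfN scalerN opprK.
  by rewrite addrC.
apply: spin_two => //; rewrite dotDl dotNl !dotZl !dotDr !dotNr !dotZr x1 y1 yx (dotC x) yx.
by have := cos2Dsin2 t; lra.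
Qed.

Let rot_derive x y : is_derive (0 : R) 1 (fun t => rot t x y) (c x *m c y).
Proof.
apply/is_derive_mxP => i k; rewrite /rot.
set P := c x *m c y; set I := 1%:M.
have -> : (fun t => (cos t *: I + sin t *: P) i k) =
  (I i k \*: cos) + (P i k \*: (sin : R -> R)).
  by apply/funext => t; rewrite !mxE !fctE /= /GRing.scale /= mulrC (mulrC (sin t)).
apply: is_derive_eq.
by rewrite sin0 cos0 oppr0 scaler0 add0r /GRing.scale /= mulr1.
Qed.

Let rot0 x y : rot 0 x y = 1%:M.
Proof. by rewrite /rot sin0 cos0 scale1r scale0r addr0. Qed.

Let bivector_bracket x y z : c x *m c y *m c z - c z *m (c x *m c y)
  = 2 *: c (dot x z *: y - dot y z *: x).
Proof.
have -> : c (dot x z *: y - dot y z *: x) = dot x z *: c y - dot y z *: c x.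
  by rewrite linearB !linearZ.
rewrite -mulmxA (cl_swap c y z) mulmxBr mulmxN !mulmxA (cl_swap c x z) mul_mx_scalar.
by rewrite mulmxBl mulNmx mul_scalar_mx; mxring.
Qed.

(** The matrix of 2 (x /\ y + Jx /\ Jy), up to the sign convention for 2-forms. *)
Definition su3_generator x y : 'M[R]_6 :=
  2 *: (y^T *m x - x^T *m y + ((y *m J^T)^T *m (x *m J^T) - (x *m J^T)^T *m (y *m J^T))).

(** The curve (cos t + sin t xy)(cos t + sin t Jx Jy) in Spin(6) fixes phi,
    because Jx . Jy . phi = - x . y . phi when y is orthogonal to x and Jx. *)
Lemma su3_generatorP x y : dot x x = 1 -> dot y y = 1 -> dot y x = 0 ->
  dot y (x *m J^T) = 0 -> su3 c phi (su3_generator x y).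
Proof.
move=> x1 y1 yx yJx.
set x' := x *m J^T; set y' := y *m J^T.
have x'1 : dot x' x' = 1 by rewrite dotJJ.
have y'1 : dot y' y' = 1 by rewrite dotJJ.
have y'x' : dot y' x' = 0 by rewrite dotJJ.
pose h t := rot t x y *m rot t x' y'.
have sh t : Spin6 c (h t) by apply: spin_mul; apply: rot_spin.
have hphi t : h t *m phi = phi.
  have e : c x' *m (c y' *m phi) = - (c x *m (c y *m phi)).
    have ex : c x' *m phi = j *m (c x *m phi) := spinJ_cl c phi1 x.
    have ey : c y' *m phi = j *m (c y *m phi) := spinJ_cl c phi1 y.
    rewrite ey -[LHS]opprK -j_cl (cl_swapf c x' y) (dotC x') yJx mulr0 scale0r subr0.
    rewrite ex mulmxN opprK (j_cl c y) j_j mulmxN opprK (cl_swapf c y x) yx.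
    by rewrite mulr0 scale0r subr0.
  have rotf v w f : rot t v w *m f = cos t *: f + sin t *: (c v *m (c w *m f)).
    by rewrite /rot mulmxDl -!scalemxAl mul1mx mulmxA.
  rewrite /h -mulmxA (rotf x') e rotf !mulmxDr -!scalemxAr !mulmxN.
  have -> : c x *m (c y *m (c x *m (c y *m phi))) = - phi.
    rewrite (cl_swapf c y x) yx mulr0 scale0r subr0 mulmxN.
    by rewrite !cl_cl x1 y1 !scaleN1r opprK.
  transitivity ((cos t ^+ 2 + sin t ^+ 2) *: phi); last by rewrite cos2Dsin2 scale1r.
  by mxring.
pose gamma t : 'M[R]_6 := \matrix_(a, b)
  sprod (h t *m c (basis b) *m (h t)^T *m phi) (c (basis a) *m phi).
have cov t : spin_covers c (h t) (gamma t).
  have [A [hA _ _]] := spin_covering (sh t).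
  suff -> : gamma t = A by [].
  apply/matrixP => a b; rewrite mxE -(spin_invmx (sh t)) hA cl_norm u1 mulr1.
  by rewrite dot_basisr -rowE !mxE.
exists gamma; split.
- by move=> t; exists (h t).
- apply/matrixP => a b; rewrite mxE /h !rot0 !mulmx1 mul1mx trmx1 mulmx1 cl_norm u1 mulr1.
  by rewrite dot_basisr !mxE eqxx.
have dh : is_derive (0 : R) 1 h (c x *m c y + c x' *m c y').
  have := is_derive_mulmx (rot_derive x y) (rot_derive x' y').
  by rewrite !rot0 mulmx1 mul1mx.
have dhT : is_derive (0 : R) 1 (fun t => (h t)^T) (- (c x *m c y + c x' *m c y')).
  have tE v w : dot w v = 0 -> (c v *m c w)^T = - (c v *m c w).
    move=> wv; rewrite trmx_mul !cl_tr mulNmx mulmxN opprK [LHS]cl_swap wv mulr0 raddf0 subr0.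
    by [].
  apply/is_derive_mxP => i k.
  rewrite (_ : (fun t => (h t)^T i k) = (fun t => h t k i)); last first.
    by apply/funext => t; rewrite mxE.
  rewrite opprD -!tE // -linearD /= mxE.
  by move/is_derive_mxP : dh; apply.
apply/is_derive_mxP => a b.
have E t : gamma t a b = ((c (basis a) *m phi)^T *m
  (h t *m c (basis b) *m (h t)^T *m phi)) 0 0 by rewrite mxE sprodC.
rewrite (_ : (fun t => gamma t a b) = (fun t => ((c (basis a) *m phi)^T *m
  (h t *m c (basis b) *m (h t)^T *m phi)) 0 0)); last exact/funext.
have d1 := is_derive_mulmx dh (is_derive_cst (c (basis b)) (0 : R) 1).
have d2 := is_derive_mulmx (is_derive_mulmx d1 dhT) (is_derive_cst phi (0 : R) 1).
have := is_derive_mulmx (is_derive_cst (c (basis a) *m phi)^T (0 : R) 1) d2.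
move=> /is_derive_mxP/(_ 0 0); rewrite mul0mx add0r !mulmx0 !addr0 /cst.
move=> d3; apply: is_derive_eq d3 _.
rewrite /h !rot0 !mulmx1 trmx1 mulmx1 mul1mx mulmxN.
set v := dot x (basis b) *: y - dot y (basis b) *: x
  + (dot x' (basis b) *: y' - dot y' (basis b) *: x').
have -> : (c x *m c y + c x' *m c y') *m c (basis b)
    - c (basis b) *m (c x *m c y + c x' *m c y') = 2 *: c v.
  by rewrite mulmxDl mulmxDr opprD addrACA !bivector_bracket -scalerDr -linearD.
rewrite -/(sprod _ _) -scalemxAl sprodZr cl_norm u1 mulr1 dotC /v !dot_basisr.
rewrite -/x' -/y' /su3_generator [RHS]mxE; congr (_ * _).
have F (p q : (vec6 R)) : (p^T *m q) a b = p 0 a * q 0 b.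
  by rewrite mxE big_ord1 mxE.
set B1 := y^T *m x; set B2 := x^T *m y; set B3 := _ *m x'; set B4 := _ *m y'.
have E1 : B1 a b = y 0 a * x 0 b by apply: F.
have E2 : B2 a b = x 0 a * y 0 b by apply: F.
have E3 : B3 a b = y' 0 a * x' 0 b by apply: F.
have E4 : B4 a b = x' 0 a * y' 0 b by apply: F.
have L m n (p q r s : 'M[R]_(m, n)) i k : (p - q + (r - s)) i k
    = p i k - q i k + (r i k - s i k) by rewrite !mxE.
have Z n k (p : 'rV[R]_n) i : (k *: p) 0 i = k * p 0 i by rewrite mxE.
by rewrite !L !Z E1 E2 E3 E4; ring.
Qed.

(** The complement m of su(3) is R J plus the skew matrices that anticommute
    with J. So A is in m when A - J A J, which is twice its part commuting with
    J, is a multiple of J; taking the trace against J determines the factor. *)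
Definition torsion_defect A : 'M[R]_6 := A - J *m A *m J + (3^-1 * \tr (J *m A)) *: J.

Lemma torsion_defect_is_linear : linear torsion_defect.
Proof.
move=> k A B; rewrite /torsion_defect !(mulmxDl, mulmxDr) -!scalemxAr -scalemxAl.
rewrite mxtraceD mxtraceZ.
by set t := \tr _; set s := \tr _; mxring.
Qed.
HB.instance Definition _ := GRing.isLinear.Build _ _ _ _ torsion_defect torsion_defect_is_linear.

Definition torsion_module A : Prop := A^T = - A /\ torsion_defect A = 0.

Lemma torsion_moduleD A B : torsion_module A -> torsion_module B -> torsion_module (A + B).
Proof.
move=> [As hA] [Bs hB]; split; first by rewrite linearD /= As Bs opprD.
by rewrite [LHS]linearD /= hA hB addr0.
Qed.

Lemma torsion_moduleZ k A : torsion_module A -> torsion_module (k *: A).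
Proof.
move=> [As hA]; split; first by rewrite linearZ /= As scalerN.
by rewrite [LHS]linearZ /= hA scaler0.
Qed.

Lemma torsion_module_sum (I : finType) (F : I -> 'M[R]_6) :
  (forall i, torsion_module (F i)) -> torsion_module (\sum_i F i).
Proof.
move=> hF; apply: big_ind => //; last by move=> *; apply: torsion_moduleD.
by split; [rewrite trmx0 oppr0|apply: linear0].
Qed.

Let tr_outer x y A : \tr ((y^T *m x)^T *m A) = dot (x *m A^T) y.
Proof.
rewrite trmx_mul trmxK -mulmxA mxtrace_mulC dotC /dot trmx_mul trmxK mulmxA.
by rewrite /mxtrace big_ord1.
Qed.

Let skew_dot x A : A^T = - A -> dot (x *m A^T) x = 0.
Proof.
move=> As; have : dot (x *m A^T) x = - dot (x *m A^T) x.
  by rewrite {1}dot_mulmx trmxK -{1}[A]opprK -As mulmxN dotNr dotC.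
by move=> e; lra.
Qed.

(** Pairing with [su3_generator x y] gives g(Ax, y) + g(AJx, Jy), which is
    g((A - J A J)x, y). *)
Let perp_unit A x y : su3_perp c phi A -> dot x x = 1 -> dot y y = 1 ->
  dot y x = 0 -> dot y (x *m J^T) = 0 -> dot (x *m (A - J *m A *m J)^T) y = 0.
Proof.
move=> [As hA] x1 y1 yx yJx.
have sk v w : dot (w *m A^T) v = - dot (v *m A^T) w.
  by rewrite [LHS]dot_mulmx trmxK -{1}[A]opprK -As mulmxN dotNr dotC.
have trg (v w v' w' : 'rV[R]_6) : \tr ((2 *: (w^T *m v - v^T *m w + (w'^T *m v' - v'^T *m w')))^T *m A)
    = 2 * (dot (v *m A^T) w - dot (w *m A^T) v + (dot (v' *m A^T) w' - dot (w' *m A^T) v')).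
  rewrite -!tr_outer; move: (w^T *m v) (v^T *m w) (w'^T *m v') (v'^T *m w') => B1 B2 B3 B4.
  by rewrite [(_ *: _)^T]linearZ /= -scalemxAl mxtraceZ !(linearD, linearN) /=
    !(mulmxDl, mulNmx) !(linearD, linearN).
have e : dot (x *m A^T) y + dot (x *m J^T *m A^T) (y *m J^T) = 0.
  have := hA _ (su3_generatorP x1 y1 yx yJx).
  by rewrite trg (sk x y) (sk (x *m J^T)) => h; lra.
rewrite linearB /= mulmxBr dotDl dotNl !trmx_mul !mulmxA dotJ // opprK.
by rewrite e.
Qed.

Let perp_any A x y : su3_perp c phi A ->
  dot y x = 0 -> dot y (x *m J^T) = 0 -> dot (x *m (A - J *m A *m J)^T) y = 0.
Proof.
move=> hA yx yJx.
have [->|x0] := eqVneq x 0; first by rewrite mul0mx dot0l.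
have [->|y0] := eqVneq y 0; first by rewrite dotC dot0l.
have nz (v : 'rV[R]_6) : v != 0 -> exists2 r, r != 0 & dot (r *: v) (r *: v) = 1.
  move=> v0; have vv : 0 < dot v v.
    by rewrite lt0r dotxx_ge0 andbT; apply: contraNneq v0 => /dotxx_eq0 ->.
  exists (Num.sqrt (dot v v))^-1; first by rewrite invr_eq0 sqrtr_eq0 -ltNge.
  rewrite dotZl dotZr mulrA -expr2 exprVn sqr_sqrtr ?ltW // mulVf //.
  by rewrite gt_eqF.
have [r r0 rx] := nz x x0; have [s s0 sy] := nz y y0.
have := perp_unit hA rx sy; rewrite -!scalemxAl !dotZl !dotZr yx yJx !mulr0.
move=> /(_ erefl erefl) /eqP; rewrite !mulf_eq0 (negPf r0) (negPf s0) /=.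
by move/eqP.
Qed.

(** T = A - J A J is skew, so T x is orthogonal to x; by [perp_any] it is
    orthogonal to everything orthogonal to x and Jx. Hence T x is a multiple of
    Jx for every x. Comparing the factors at e_a, e_b and e_a + e_b shows that
    they agree. *)
Lemma su3_perp_torsion A : su3_perp c phi A -> torsion_module A.
Proof.
move=> hA; have As : A^T = - A by case: hA.
split=> //; rewrite /torsion_defect; set T := A - J *m A *m J.
have JT : J^T = - J by apply: spinJ_tr.
have Ts : T^T = - T.
  by rewrite /T linearB /= !trmx_mul JT As !(mulNmx, mulmxN) !opprK mulmxA opprB addrC.
have line x : dot x x *: (x *m T^T) = dot (x *m T^T) (x *m J^T) *: (x *m J^T).
  apply/eqP; rewrite -subr_eq0; apply/eqP; apply: dotxx_eq0.
  set w := _ - _; set m := dot (x *m T^T) (x *m J^T) in w *.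
  have wx : dot w x = 0.
    by rewrite /w dotDl dotNl !dotZl !skew_dot // !mulr0 subr0.
  have wJ : dot w (x *m J^T) = 0.
    by rewrite /w dotDl dotNl !dotZl dotJJ // -/m mulrC subrr.
  have wT : dot (x *m T^T) w = 0 by apply: perp_any.
  by rewrite {2}/w dotDr dotNr !dotZr wJ (dotC w) wT !mulr0 subr0.
pose lam a := dot (basis a *m T^T) (basis a *m J^T).
have bT a : basis a *m T^T = lam a *: (basis a *m J^T).
  by rewrite -line dot_basisr mxE !eqxx scale1r.
have lamE a b : lam a = lam b.
  have [->//|ab] := eqVneq a b.
  have bb i k : dot (basis i) (basis k) = (k == i)%:R by rewrite dot_basisr mxE eqxx.
  have := line (basis a + basis b); set m := dot (_ *m _) _.
  rewrite dotDl !dotDr !bb !eqxx eq_sym (negPf ab) addr0 add0r !mulmxDl !bT.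
  move=> /(congr1 (mulmx^~ J^T)); rewrite -!scalemxAl !mulmxDl -!scalemxAl !spinJJ //.
  move=> e; have ea := congr1 (fun v : 'rV[R]_6 => v 0 a) e.
  have eb := congr1 (fun v : 'rV[R]_6 => v 0 b) e; move: ea eb.
  by rewrite !mxE !eqxx (negPf ab) eq_sym (negPf ab) /= => ea eb; lra.
have TE : T = lam ord0 *: J.
  apply: trmx_inj; apply/row_matrixP => a; rewrite !rowE bT linearZ /= -scalemxAr.
  by rewrite (lamE a ord0).
have := congr1 (fun B => \tr (J *m B)) TE; rewrite -scalemxAr linearZ /= spinJ_sqr //.
rewrite linearN /= mxtrace1 /T mulmxBr linearB /= !mulmxA spinJ_sqr // !mulNmx mul1mx.
rewrite linearN /= opprK (mxtrace_mulC A) => e.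
rewrite -/T TE -scalerDl (_ : lam ord0 + _ = 0) ?scale0r //.
by lra.
Qed.

(** If rho(A) kills phi, then rho(A) . x . phi = - 2 (Ax) . phi, and rho(A)
    commutes with j. *)
Lemma kills_commutes A : A^T = - A -> rho c A *m phi = 0 -> A *m J = J *m A.
Proof.
move=> As hA; apply: trmx_inj; rewrite !trmx_mul; apply: matrix_row_ext => x.
apply: (cl_phi_inj phi1 (c := c)).
have e y : rho c A *m (c y *m phi) = - 2 *: (c (y *m A^T) *m phi).
  by rewrite rho_clf // hA mulmx0 sub0r scaleNr.
have := e (x *m J^T); rewrite spinJ_cl // rho_j e -scalemxAr -spinJ_cl // !mulmxA.
by move/scalerI => <- //; rewrite oppr_eq0 pnatr_eq0.
Qed.

Lemma rho_pair_j A : A^T = - A -> sprod (rho c A *m phi) (j *m phi) = 2^-1 * \tr (J *m A).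
Proof.
move=> As; rewrite rhoE // -scalemxAl sprodZl mulmx_suml sprod_suml; congr (_ * _).
rewrite -mxtrace_tr trmx_mul /mxtrace; apply: eq_bigr => b _.
rewrite -mulmxA cl_adj -[_ *m (j *m _)]opprK -j_cl sprodNr opprK -spinJ_cl //.
by rewrite cl_norm u1 mulr1 dotC dot_basisr -mulmxA -rowE mxE.
Qed.

(** Such an A commutes with J and has no component along J, while its part
    commuting with J is a multiple of J. *)
Lemma torsion_module_inj A : torsion_module A -> rho c A *m phi = 0 -> A = 0.
Proof.
move=> [As hA] A0; have := rho_pair_j As; rewrite A0 sprod0l => /esym /eqP.
rewrite mulf_eq0 invr_eq0 pnatr_eq0 /= => /eqP t0; move: hA.
rewrite /torsion_defect t0 mulr0 scale0r addr0 -(kills_commutes As A0) -mulmxA spinJ_sqr // mulmxN mulmx1.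
by rewrite opprK => h; apply/matrixP => a b; have /matrixP/(_ a b) := h; rewrite !mxE => e; lra.
Qed.

(** rho(A) phi has no component along j phi, so A has none along J. *)
Lemma torsion_anti A V : torsion_module A -> rho c A *m phi = c V *m phi ->
  J *m A = - (A *m J).
Proof.
move=> [As hA] AV; have := rho_pair_j As.
rewrite AV cl_adj -[_ *m (_ *m _)]opprK -j_cl sprodNr opprK sprod_jcl => /esym /eqP.
rewrite mulf_eq0 invr_eq0 pnatr_eq0 /= => /eqP t0; move: hA.
rewrite /torsion_defect t0 mulr0 scale0r addr0 => /eqP; rewrite subr_eq0 => /eqP {1}->.
by rewrite !mulmxA spinJ_sqr // !mulNmx mul1mx.
Qed.

(** Compute rho(A) . Jy . phi in two ways: through the commutator with Jy, and
    as j . rho(A) . y . phi. *)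
Lemma torsion_action A V y : torsion_module A -> rho c A *m phi = c V *m phi ->
  4 *: (c (y *m J^T *m A^T) *m phi) =
  c (y *m J^T) *m (c V *m phi) - j *m (c y *m (c V *m phi)).
Proof.
move=> hA AV; have [As _] := hA; have an := torsion_anti hA AV.
have e1 := rho_clf c (y *m J^T) phi As; have e2 := rho_clf c y phi As.
have := rho_j c A (c y *m phi); rewrite -spinJ_cl // e1 e2 AV mulmxBr -scalemxAr.
have an' : y *m A^T *m J^T = - (y *m J^T *m A^T).
  by rewrite -!mulmxA -!trmx_mul an linearN mulmxN.
rewrite -(spinJ_cl c phi1 (y *m A^T)) an' linearN mulNmx.
set p := c (y *m J^T) *m _; set q := j *m _; set r := c (y *m J^T *m A^T) *m phi => e.
by apply/colP => i; have /colP/(_ i) := e; rewrite !mxE => ei; lra.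
Qed.

Lemma complex_line_action x a b : dot x x = 1 ->
  let V := a *: (x *m J^T) + b *: x in
  c (x *m J^T) *m (c V *m phi) = j *m (c x *m (c V *m phi)).
Proof.
move=> x1 V.
have VE : c V *m phi = a *: (j *m (c x *m phi)) + b *: (c x *m phi).
  by rewrite /V linearD !linearZ mulmxDl -!scalemxAl spinJ_cl.
have e1 : c (x *m J^T) *m (c x *m phi) = - (j *m phi).
  rewrite (cl_swapf c (x *m J^T)) (dotC _ x) dotxJ // mulr0 scale0r subr0 spinJ_cl //.
  by rewrite -j_cl cl_cl x1 scaleN1r mulmxN.
have e2 : c x *m (c x *m phi) = - phi by rewrite cl_cl x1 scaleN1r.
rewrite VE !mulmxDr -!scalemxAr.
have -> : c (x *m J^T) *m (j *m (c x *m phi)) = - phi.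
  by rewrite -[LHS]opprK -j_cl e1 mulmxN j_j opprK.
have -> : c x *m (j *m (c x *m phi)) = j *m phi.
  by rewrite -[LHS]opprK -j_cl e2 mulmxN opprK.
by rewrite e1 e2 j_j mulmxN.
Qed.

(** [torsion_action] at y = - JV, where both terms are multiples of phi. *)
Lemma torsion_kills_self A V : torsion_module A -> rho c A *m phi = c V *m phi ->
  V *m A^T = 0.
Proof.
move=> hA AV; apply: (cl_phi_inj phi1 (c := c)); rewrite linear0 mul0mx.
have := torsion_action (- (V *m J^T)) hA AV.
rewrite mulNmx spinJJ // opprK linearN !mulNmx mulmxN opprK.
rewrite (cl_swapf c (V *m J^T)) (dotC _ V) dotxJ // mulr0 scale0r subr0 spinJ_cl //.
rewrite -j_cl j_j addrN => /eqP; rewrite scaler_eq0 pnatr_eq0 /=.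
by move/eqP.
Qed.

(** C commutes with J, so bracketing with C preserves m. *)
Lemma torsion_bracket A C : C^T = - C -> rho c C *m phi = 0 -> torsion_module A ->
  torsion_module (C *m A - A *m C).
Proof.
move=> Cs C0 [As hA]; have CJ := kills_commutes Cs C0; split.
  by rewrite linearB /= !trmx_mul As Cs !mulNmx !mulmxN !opprK opprB.
have t0 : \tr (J *m (C *m A - A *m C)) = 0.
  by rewrite mulmxBr linearB /= !mulmxA (mxtrace_mulC (J *m A)) !mulmxA CJ subrr.
rewrite /torsion_defect t0 mulr0 scale0r addr0.
move: hA; rewrite /torsion_defect; set l := 3^-1 * _ => hA.
have E : A - J *m A *m J = - l *: J.
  by apply/eqP; rewrite scaleNr -addr_eq0 hA.
transitivity (C *m (A - J *m A *m J) - (A - J *m A *m J) *m C); last first.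
  by rewrite E -scalemxAr -scalemxAl CJ subrr.
have e1 : J *m (C *m A) *m J = C *m (J *m A *m J) by rewrite !mulmxA CJ.
have e2 : J *m (A *m C) *m J = J *m A *m J *m C by rewrite -!mulmxA CJ.
by rewrite [J *m (_ - _)]mulmxBr !(mulmxBl, mulmxBr) e1 e2; mxring.
Qed.

End TorsionModule.

(** * Smooth functions and vector fields *)

Section SmoothEuclid.
Context {R : realType}.
Implicit Types (U : set (vec6 R)) (f g : vec6 R -> R) (x : vec6 R).

(** C^n on U. Unlike the iterated partial derivatives of [smooth_on], this
    recursion differentiates first and recurses on the derivative, which is the
    form needed for products and quotients. *)
Fixpoint class_on (n : nat) U f : Prop :=
  (forall x, U x -> {for x, continuous f}) /\
  if n is n'.+1 then forall i, (forall x, U x -> derivable f x (basis6 i)) /\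
    class_on n' U (fun x => 'D_(basis6 i) f x) else True.

Lemma iter_partial_rcons s i f :
  iter_partial (rcons s i) f = iter_partial s (fun x => 'D_(basis6 i) f x).
Proof. by elim: s => //= a s ->. Qed.

Lemma smooth_onP U f : smooth_on U f <-> forall n, class_on n U f.
Proof.
split=> [sf n|].
  elim: n f sf => [|n IH] f sf; first by split=> // x Ux; have [] := sf [::] x Ux.
  split=> [x Ux|i]; first by have [] := sf [::] x Ux.
  split=> [x Ux|]; first by have [_] := sf [::] x Ux; apply.
  by apply: IH => s x Ux; rewrite -iter_partial_rcons; apply: sf.
move=> cf s; elim/last_ind: s f cf => [|s i IH] f cf x Ux.
  by have [c0 d0] := cf 1; split=> [|i]; [apply: c0|apply: (d0 i).1].
rewrite iter_partial_rcons; apply: IH => // n.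
by have [_ d0] := cf n.+1; apply: (d0 i).2.
Qed.

Lemma near_open U (P : vec6 R -> Prop) x : open U -> U x -> (forall y, U y -> P y) ->
  \near x, P x.
Proof.
move=> oU Ux UP; have : nbhs x U by apply: open_nbhs_nbhs.
by apply: filterS.
Qed.

Lemma continuous_near_eq U f g x : open U -> U x -> (forall y, U y -> f y = g y) ->
  {for x, continuous f} -> {for x, continuous g}.
Proof.
move=> oU Ux fg cf; rewrite /prop_for /continuous_at -(fg x Ux).
have nE : \near x, f x = g x by apply: (near_open oU Ux).
apply: cvg_trans cf; exact: (@near_eq_cvg _ _ (nbhs x) _ _ _ nE).
Qed.

(** On an open set derivatives only depend on the values in that set. *)
Lemma class_on_ext n U f g : open U -> (forall x, U x -> f x = g x) ->
  class_on n U f -> class_on n U g.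
Proof.
move=> oU; elim: n f g => [|n IH] f g fg /= [cf df].
    by split=> // x Ux; apply: (continuous_near_eq oU Ux fg); apply: cf.
  split=> [x Ux|i]; first by apply: (continuous_near_eq oU Ux fg); apply: cf.
  have [d0 d1] := df i; split=> [x Ux|].
    by apply: near_eq_derivable (d0 _ Ux); apply: (near_open oU Ux).
  apply: IH d1 => x Ux; by apply: near_eq_derive; apply: (near_open oU Ux).
Qed.

Lemma class_onS n U f : class_on n.+1 U f -> class_on n U f.
Proof.
elim: n f => [|n IH] f [cf df]; first by split.
split=> // i; have [d0 d1] := df i; split=> //; exact: IH.
Qed.

Lemma class_on_cst n U k : class_on n U (cst k).
Proof.
elim: n k => [|n IH] k; (split=> [x Ux|//]; first exact: cst_continuous).
move=> i; split=> [x Ux|]; first exact: derivable_cst.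
rewrite (_ : (fun x => _) = cst 0); first exact: IH.
by apply/funext => x; rewrite derive_cst.
Qed.

Lemma class_onD n U f g : open U -> class_on n U f -> class_on n U g ->
  class_on n U (fun x => f x + g x).
Proof.
move=> oU; elim: n f g => [|n IH] f g [cf df] [cg dg];
  (split=> [x Ux|//]; first by apply: continuousD; [exact: cf|exact: cg]).
move=> i; have [f0 f1] := df i; have [g0 g1] := dg i; split=> [x Ux|].
  by apply: derivableD; [exact: f0|exact: g0].
apply: (class_on_ext oU) (IH _ _ f1 g1) => x Ux.
by rewrite -[RHS]/('D_(basis6 i) (f + g) x) deriveD; [|exact: f0|exact: g0].
Qed.

Lemma class_onM n U f g : open U -> class_on n U f -> class_on n U g ->
  class_on n U (fun x => f x * g x).
Proof.
move=> oU; elim: n f g => [|n IH] f g Cf Cg; move: (Cf) (Cg) => [cf df] [cg dg];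
  (split=> [x Ux|//]; first by apply: continuousM; [exact: cf|exact: cg]).
move=> i; have [f0 f1] := df i; have [g0 g1] := dg i; split=> [x Ux|].
  by apply: derivableM; [exact: f0|exact: g0].
have C1 := IH _ _ (class_onS Cf) g1; have C2 := IH _ _ (class_onS Cg) f1.
apply: (class_on_ext oU) (class_onD oU C1 C2) => x Ux.
by rewrite -[RHS]/('D_(basis6 i) (f * g) x) deriveM; [|exact: f0|exact: g0].
Qed.

Lemma class_onV n U f : open U -> (forall x, U x -> f x != 0) -> class_on n U f ->
  class_on n U (fun x => (f x)^-1).
Proof.
move=> oU nz; elim: n => [|n IH] Cf; move: (Cf) => [cf df];
  (split=> [x Ux|//]; first by apply: continuousV; [exact: nz|exact: cf]).
move=> i; have [f0 f1] := df i; split=> [x Ux|].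
  by apply: derivableV; [exact: nz|exact: f0].
have C1 := IH (class_onS Cf).
have C2 := class_onM oU (class_onM oU (class_on_cst n U (-1)) (class_onM oU C1 C1)) f1.
apply: (class_on_ext oU) C2 => x Ux; rewrite deriveV; [|exact: nz|exact: f0].
by rewrite /cst /GRing.scale /= mulN1r -expr2 exprVn.
Qed.

End SmoothEuclid.

Section SmoothManifold.
Context {R : realType} {M : oriented_manifold6 R}.
Implicit Types (W : set M) (f g : M -> R) (p q : M) (v w : vec6 R).

Lemma chart_img_openI W q : open W -> open (chart q @` (W `&` chart_dom q)).
Proof.
move=> oW; rewrite openE => x [p [Wp dp] <-].
have xi : (chart q @` chart_dom q) (chart q p) by exists p.
have n1 : nbhs (chart q p) (chart q @` chart_dom q).
  by apply: open_nbhs_nbhs; split=> //; apply: chart_img_open.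
have cc := chart_inv_continuous xi.
have n2 : nbhs (chart q p) (chart_inv q @^-1` W).
  apply: cc; rewrite chartK //; by apply: open_nbhs_nbhs; split.
apply: filterS (filterI n1 n2) => y [[r dr <-]]; rewrite /= chartK // => Wr.
by exists r.
Qed.

Lemma chart_img_inv W q x : (chart q @` (W `&` chart_dom q)) x -> W (chart_inv q x).
Proof. by move=> [p [Wp dp] <-]; rewrite chartK. Qed.

Lemma smooth_fun_class W f : smooth_fun W f <->
  forall q n, class_on n (chart q @` (W `&` chart_dom q)) (f \o chart_inv q).
Proof.
split=> h q; first by apply/smooth_onP; apply: h.
by apply/smooth_onP; apply: h.
Qed.

Lemma smooth_fun_sub W W' f : W' `<=` W -> smooth_fun W f -> smooth_fun W' f.
Proof.
move=> sub h q s x [p [Wp dp] xE]; apply: h.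
by exists p => //; split=> //; apply: sub.
Qed.

Lemma smooth_fun_ext W f g : open W -> (forall p, W p -> f p = g p) ->
  smooth_fun W f -> smooth_fun W g.
Proof.
move=> oW fg /smooth_fun_class h; apply/smooth_fun_class => q n.
apply: class_on_ext (h q n); first exact: chart_img_openI.
by move=> x /chart_img_inv; apply: fg.
Qed.

Lemma smooth_fun_cst W k : smooth_fun W (fun=> k).
Proof. by apply/smooth_fun_class => q n; apply: class_on_cst. Qed.

Lemma smooth_funD W f g : open W -> smooth_fun W f -> smooth_fun W g ->
  smooth_fun W (fun p => f p + g p).
Proof.
move=> oW /smooth_fun_class hf /smooth_fun_class hg; apply/smooth_fun_class => q n.
by apply: (class_onD (f := f \o chart_inv q) (g := g \o chart_inv q)) => //; apply: chart_img_openI.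
Qed.

Lemma smooth_funM W f g : open W -> smooth_fun W f -> smooth_fun W g ->
  smooth_fun W (fun p => f p * g p).
Proof.
move=> oW /smooth_fun_class hf /smooth_fun_class hg; apply/smooth_fun_class => q n.
by apply: (class_onM (f := f \o chart_inv q) (g := g \o chart_inv q)) => //; apply: chart_img_openI.
Qed.

Lemma smooth_funV W f : open W -> (forall p, W p -> f p != 0) -> smooth_fun W f ->
  smooth_fun W (fun p => (f p)^-1).
Proof.
move=> oW nz /smooth_fun_class hf; apply/smooth_fun_class => q n.
apply: (class_onV (f := f \o chart_inv q)) => //; first exact: chart_img_openI.
by move=> x /chart_img_inv; apply: nz.
Qed.

Lemma smooth_funZ W k f : open W -> smooth_fun W f -> smooth_fun W (fun p => k * f p).
Proof. by move=> oW; apply: smooth_funM => //; apply: smooth_fun_cst. Qed.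

Lemma smooth_funN W f : open W -> smooth_fun W f -> smooth_fun W (fun p => - f p).
Proof.
by move=> oW /(smooth_funZ (-1) oW); apply: smooth_fun_ext => // p _; rewrite mulN1r.
Qed.

Lemma smooth_funB W f g : open W -> smooth_fun W f -> smooth_fun W g ->
  smooth_fun W (fun p => f p - g p).
Proof. by move=> oW hf /(smooth_funN oW); apply: smooth_funD. Qed.

Lemma smooth_fun_sum (I : Type) (r : seq I) (P : pred I) W (F : I -> M -> R) : open W ->
  (forall i, smooth_fun W (F i)) -> smooth_fun W (fun p => \sum_(i <- r | P i) F i p).
Proof.
move=> oW hF; elim: r => [|i r IH].
  by apply: (smooth_fun_ext oW _ (@smooth_fun_cst W 0)) => p _; rewrite big_nil.
case Pi : (P i); last first.
  by apply: (smooth_fun_ext oW _ IH) => p _; rewrite big_cons Pi.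
by apply: (smooth_fun_ext oW _ (smooth_funD oW (hF i) IH)) => p _; rewrite big_cons Pi.
Qed.

Lemma chart_center_in W p : W p -> (chart p @` (W `&` chart_dom p)) (chart p p).
Proof. by move=> Wp; exists p => //; split=> //; apply: chart_dom_center. Qed.

Lemma smooth_fun_derivable W p f i : W p -> smooth_fun W f ->
  derivable (f \o chart_inv p) (chart p p) (basis6 i).
Proof. by move=> Wp h; have [_] := h p [::] _ (chart_center_in Wp); apply. Qed.

Lemma dir_is_linear p f : forall a v w, dir p (a *: v + w) f = a * dir p v f + dir p w f.
Proof.
move=> a v w; rewrite /dir mulr_sumr -big_split; apply: eq_bigr => i _ /=.
by rewrite !mxE; ring.
Qed.
Lemma dir_suml (I : finType) p f (F : I -> vec6 R) (k : I -> R) :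
  dir p (\sum_i k i *: F i) f = \sum_i k i * dir p (F i) f.
Proof.
rewrite /dir; under eq_bigr do rewrite summxE mulr_suml.
rewrite exchange_big; apply: eq_bigr => i _; rewrite mulr_sumr.
by apply: eq_bigr => l _; rewrite mxE mulrA.
Qed.
Lemma dirDv p f v w : dir p (v + w) f = dir p v f + dir p w f.
Proof. by rewrite -[v]scale1r dir_is_linear mul1r scale1r. Qed.
Lemma dirZv p f a v : dir p (a *: v) f = a * dir p v f.
Proof.
have d0 : dir p 0 f = 0 by rewrite /dir big1 // => i _; rewrite mxE mul0r.
by rewrite -[a *: v]addr0 dir_is_linear d0 addr0.
Qed.

Lemma dir0v p f : dir p 0 f = 0.
Proof. by rewrite /dir big1 // => i _; rewrite mxE mul0r. Qed.

Lemma dir_ext W p v f g : open W -> W p -> (forall q, W q -> f q = g q) ->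
  dir p v f = dir p v g.
Proof.
move=> oW Wp fg; apply: eq_bigr => i _; congr (_ * _).
have oI := @chart_img_openI W p oW; have := chart_center_in Wp.
set z := chart p p => Iz.
have nE : \near z, (f \o chart_inv p) z = (g \o chart_inv p) z.
  by apply: (near_open oI Iz) => x /chart_img_inv; apply: fg.
exact: near_eq_derive nE.
Qed.

Lemma dir_cst p v k : dir p v (fun=> k) = 0.
Proof.
by rewrite /dir big1 // => i _; rewrite (_ : _ \o _ = cst k) // derive_cst mulr0.
Qed.

Lemma dirD W p v f g : W p -> smooth_fun W f -> smooth_fun W g ->
  dir p v (fun q => f q + g q) = dir p v f + dir p v g.
Proof.
move=> Wp hf hg; rewrite /dir -big_split; apply: eq_bigr => i _ /=.
rewrite -mulrDr -deriveD //; exact: smooth_fun_derivable Wp _.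
Qed.

Lemma dirM W p v f g : W p -> smooth_fun W f -> smooth_fun W g ->
  dir p v (fun q => f q * g q) = dir p v f * g p + f p * dir p v g.
Proof.
move=> Wp hf hg; rewrite /dir mulr_suml mulr_sumr -big_split; apply: eq_bigr => i _ /=.
have := deriveM (@smooth_fun_derivable W p f i Wp hf) (@smooth_fun_derivable W p g i Wp hg).
rewrite -/(_ \o _) /= /GRing.scale /= chartK; last exact: chart_dom_center.
by move=> e; rewrite -[X in v 0 i * X]/('D_(basis6 i) ((f \o chart_inv p) * (g \o chart_inv p)) (chart p p)) e; ring.
Qed.

Lemma dirZ W p v k f : W p -> smooth_fun W f -> dir p v (fun q => k * f q) = k * dir p v f.
Proof.
by move=> Wp hf; rewrite (dirM _ Wp (@smooth_fun_cst W k) hf) dir_cst mul0r add0r.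
Qed.

Lemma dir_sum (I : Type) (r : seq I) (P : pred I) W p v (F : I -> M -> R) : open W -> W p ->
  (forall i, smooth_fun W (F i)) ->
  dir p v (fun q => \sum_(i <- r | P i) F i q) = \sum_(i <- r | P i) dir p v (F i).
Proof.
move=> oW Wp hF; elim: r => [|i r IH].
  rewrite big_nil; transitivity (dir p v (fun=> 0)); last exact: dir_cst.
  by apply: (dir_ext _ oW Wp) => q _; rewrite big_nil.
rewrite big_cons -IH; case: ifP => Pi.
  rewrite -(dirD _ Wp (hF i) (@smooth_fun_sum _ r P W F oW hF)).
  by apply: (dir_ext _ oW Wp) => q _; rewrite big_cons Pi.
by apply: (dir_ext _ oW Wp) => q _; rewrite big_cons Pi.
Qed.

Lemma smooth_fun_coord p k : smooth_fun (chart_dom p) (fun q => chart p q 0 k).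
Proof. by move=> q; rewrite setIC; apply: chart_smooth. Qed.

(** The coordinates of the chart at p are smooth near p and separate tangent vectors. *)
Lemma dir_inj W p v w : open W -> W p ->
  (forall W' f, open W' -> W' p -> W' `<=` W -> smooth_fun W' f -> dir p v f = dir p w f) -> v = w.
Proof.
move=> oW Wp vw; apply/rowP => k.
have oW' : open (W `&` chart_dom p) by apply: openI => //; apply: chart_dom_open.
have pW' : (W `&` chart_dom p) p by split=> //; apply: chart_dom_center.
have dE u : dir p u (fun q => chart p q 0 k) = u 0 k.
  have dX i (x : vec6 R) : 'D_(basis6 i) (fun y : vec6 R => y 0 k) x = (basis6 i : vec6 R) 0 k.
    have h := @derive_mx R (vec6 R) 1 6 id x (basis6 i) (@derivable_id _ _ _ _).
    by rewrite derive_id in h; rewrite [in RHS]h mxE.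
  have E i : 'D_(basis6 i) ((fun q => chart p q 0 k) \o chart_inv p) (chart p p)
     = (basis6 i : vec6 R) 0 k.
    rewrite -(dX i (chart p p)).
    have oI := @chart_img_open _ M p; have : (chart p @` chart_dom p) (chart p p).
      by exists p => //; apply: chart_dom_center.
    set z := chart p p => Iz.
    have nE : \near z, ((fun q => chart p q 0 k) \o chart_inv p) z = z 0 k.
      by apply: (near_open oI Iz) => x [q dq <-]; rewrite /= chartK.
    exact: near_eq_derive nE.
  rewrite /dir; under eq_bigr do rewrite E mxE eqxx /=.
  rewrite (bigD1 k) //= eqxx mulr1 big1 ?addr0 // => i ik.
  by rewrite eq_sym (negPf ik) mulr0.
rewrite -!dE; apply: vw oW' pW' _ _; first by move=> q [].
by apply: smooth_fun_sub (@smooth_fun_coord p k) => q [].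
Qed.

Lemma smooth_vf_sub W W' X : W' `<=` W -> smooth_vf W X -> smooth_vf (M := M) W' X.
Proof. by move=> sub h W1 f oW1 sW1 sf; apply: h => //; apply: subset_trans sub. Qed.

Lemma smooth_vf_ext W X Y : (forall p, W p -> X p = Y p) -> smooth_vf W X ->
  smooth_vf (M := M) W Y.
Proof.
move=> XY h W1 f oW1 sW1 sf; apply: (smooth_fun_ext oW1 _ (h _ _ oW1 sW1 sf)) => p W1p.
by rewrite XY //; apply: sW1.
Qed.

Lemma smooth_vfD W X Y : smooth_vf W X -> smooth_vf W Y ->
  smooth_vf (M := M) W (fun p => X p + Y p).
Proof.
move=> hX hY W1 f oW1 sW1 sf.
apply: (smooth_fun_ext oW1 _ (smooth_funD oW1 (hX _ _ oW1 sW1 sf) (hY _ _ oW1 sW1 sf))) => p _.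
by rewrite dirDv.
Qed.

Lemma smooth_vfZ W k X : smooth_fun W k -> smooth_vf W X ->
  smooth_vf (M := M) W (fun p => k p *: X p).
Proof.
move=> hk hX W1 f oW1 sW1 sf.
apply: (smooth_fun_ext oW1 _ (smooth_funM oW1 (smooth_fun_sub sW1 hk) (hX _ _ oW1 sW1 sf))) => p _.
by rewrite dirZv.
Qed.

Lemma smooth_vf0 W : smooth_vf (M := M) W (fun=> 0).
Proof.
move=> W1 f oW1 sW1 sf; apply: (smooth_fun_ext oW1 _ (@smooth_fun_cst W1 0)) => p _.
by rewrite dir0v.
Qed.

Lemma smooth_vf_sum (I : Type) (r : seq I) W (F : I -> M -> vec6 R) :
  (forall i, smooth_vf W (F i)) -> smooth_vf W (fun p => \sum_(i <- r) F i p).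
Proof.
move=> hF; elim: r => [|i r IH].
  by apply: (smooth_vf_ext _ (@smooth_vf0 W)) => p _; rewrite big_nil.
by apply: (smooth_vf_ext _ (smooth_vfD (hF i) IH)) => p _; rewrite big_cons.
Qed.

Lemma open_nonzero W f : open W -> smooth_fun W f -> open (W `&` [set p | f p != 0]).
Proof.
move=> oW hf; rewrite openE => q [Wq fq].
have nW : nbhs q (W `&` chart_dom q).
  apply: open_nbhs_nbhs; split; first by apply: openI => //; apply: chart_dom_open.
  by split=> //; apply: chart_dom_center.
have dq : chart_dom q q by apply: chart_dom_center.
have cf : {for chart q q, continuous (f \o chart_inv q)}.
  by have [] := hf q [::] _ (chart_center_in Wq).
have nz : nbhs (chart q q) [set x | (f \o chart_inv q) x != 0].
  have o0 : open [set y : R | y != 0] by apply: open_neq.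
  by apply: (cf [set y : R | y != 0]); apply: open_nbhs_nbhs; split=> //=; rewrite chartK.
have n2 : nbhs q [set p | (f \o chart_inv q) (chart q p) != 0].
  exact: (chart_continuous dq nz).
apply: filterS (filterI nW n2) => p [[Wp dp]] /=; rewrite chartK; last exact: dp.
by move=> fp; split.
Qed.
End SmoothManifold.

(** * Matrix-valued fields *)

Section MatrixFields.
Context {R : realType} {M : oriented_manifold6 R}.
Implicit Types (W : set M) (p q : M) (v w : vec6 R).

Definition smoothm m n W (F : M -> 'M[R]_(m, n)) :=
  forall i k, smooth_fun W (fun q => F q i k).
Definition dirm m n p v (F : M -> 'M[R]_(m, n)) : 'M[R]_(m, n) :=
  \matrix_(i, k) dir p v (fun q => F q i k).

Lemma smoothm_sub m n W W' (F : M -> 'M[R]_(m, n)) : W' `<=` W -> smoothm W F -> smoothm W' F.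
Proof. by move=> sub h i k; apply: smooth_fun_sub (h i k). Qed.

Lemma smoothm_ext m n W (F G : M -> 'M[R]_(m, n)) : open W ->
  (forall q, W q -> F q = G q) -> smoothm W F -> smoothm W G.
Proof.
by move=> oW FG h i k; apply: (smooth_fun_ext oW _ (h i k)) => q Wq; rewrite FG.
Qed.

Lemma smoothm_cst m n W (A : 'M[R]_(m, n)) : smoothm W (fun=> A).
Proof. by move=> i k; apply: smooth_fun_cst. Qed.

Lemma smoothm_mul m n r W (F : M -> 'M[R]_(m, n)) (G : M -> 'M[R]_(n, r)) : open W ->
  smoothm W F -> smoothm W G -> smoothm W (fun q => F q *m G q).
Proof.
move=> oW hF hG i k; apply: (smooth_fun_ext oW (f := fun q => \sum_l F q i l * G q l k)).
  by move=> q _; rewrite mxE.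
by apply: smooth_fun_sum => // l; apply: smooth_funM.
Qed.

Lemma smoothm_tr m n W (F : M -> 'M[R]_(m, n)) : open W -> smoothm W F ->
  smoothm W (fun q => (F q)^T).
Proof.
by move=> oW h i k; apply: (smooth_fun_ext oW _ (h k i)) => q _; rewrite mxE.
Qed.

Lemma smoothmZ m n W f (F : M -> 'M[R]_(m, n)) : open W -> smooth_fun W f -> smoothm W F ->
  smoothm W (fun q => f q *: F q).
Proof.
move=> oW hf hF i k; apply: (smooth_fun_ext oW _ (smooth_funM oW hf (hF i k))) => q _.
by rewrite mxE.
Qed.

Lemma smoothmB m n W (F G : M -> 'M[R]_(m, n)) : open W -> smoothm W F -> smoothm W G ->
  smoothm W (fun q => F q - G q).
Proof.
move=> oW hF hG i k; apply: (smooth_fun_ext oW _ (smooth_funB oW (hF i k) (hG i k))) => q _.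
by rewrite !mxE.
Qed.

(** Entries of a linear image are fixed linear combinations of entries; hence
    linear maps preserve smoothness and commute with derivatives. *)
Lemma linear_mx_entries m n m' n' (L : {linear 'M[R]_(m, n) -> 'M[R]_(m', n')}) A i k :
  L A i k = \sum_a \sum_b L (delta_mx a b) i k * A a b.
Proof.
rewrite {1}(matrix_sum_delta A) linear_sum summxE; apply: eq_bigr => a _.
rewrite linear_sum summxE; apply: eq_bigr => b _.
by rewrite linearZ mxE mulrC.
Qed.

Lemma smoothm_lin m n m' n' (L : {linear 'M[R]_(m, n) -> 'M[R]_(m', n')}) W F : open W ->
  smoothm W F -> smoothm W (fun q => L (F q)).
Proof.
move=> oW hF i k.
apply: (smooth_fun_ext oW (f := fun q => \sum_a \sum_b L (delta_mx a b) i k * F q a b)).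
  by move=> q _; rewrite -linear_mx_entries.
do 2!(apply: smooth_fun_sum => // ?); exact: smooth_funZ.
Qed.

Lemma dirm_lin m n m' n' (L : {linear 'M[R]_(m, n) -> 'M[R]_(m', n')}) W F p v :
  open W -> W p -> smoothm W F -> dirm p v (fun q => L (F q)) = L (dirm p v F).
Proof.
move=> oW Wp hF; apply/matrixP => i k; rewrite mxE linear_mx_entries.
transitivity (dir p v (fun q => \sum_a \sum_b L (delta_mx a b) i k * F q a b)).
  by apply: (dir_ext _ oW Wp) => q _; rewrite -linear_mx_entries.
rewrite (dir_sum _ _ _ oW Wp) => [|a]; last first.
  by apply: smooth_fun_sum => // b; apply: smooth_funZ.
apply: eq_bigr => a _; rewrite (dir_sum _ _ _ oW Wp) => [|b]; last exact: smooth_funZ.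
by apply: eq_bigr => b _; rewrite mxE (dirZ _ _ Wp (hF a b)).
Qed.

Lemma dirm_ext m n W (F G : M -> 'M[R]_(m, n)) p v : open W -> W p ->
  (forall q, W q -> F q = G q) -> dirm p v F = dirm p v G.
Proof.
move=> oW Wp FG; apply/matrixP => i k; rewrite !mxE.
by apply: (dir_ext _ oW Wp) => q Wq; rewrite FG.
Qed.

Lemma dirm_cst m n (A : 'M[R]_(m, n)) p v : dirm p v (fun=> A) = 0.
Proof. by apply/matrixP => i k; rewrite !mxE dir_cst. Qed.

Lemma dirmD m n W (F G : M -> 'M[R]_(m, n)) p v : W p -> smoothm W F -> smoothm W G ->
  dirm p v (fun q => F q + G q) = dirm p v F + dirm p v G.
Proof.
move=> Wp hF hG; apply/matrixP => i k; rewrite !mxE -(dirD _ Wp (hF i k) (hG i k)).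
by congr dir; apply/funext => q; rewrite mxE.
Qed.

Lemma dirm_mul m n r W (F : M -> 'M[R]_(m, n)) (G : M -> 'M[R]_(n, r)) p v :
  open W -> W p -> smoothm W F -> smoothm W G ->
  dirm p v (fun q => F q *m G q) = dirm p v F *m G p + F p *m dirm p v G.
Proof.
move=> oW Wp hF hG; apply/matrixP => i k; rewrite !mxE -big_split /=.
transitivity (dir p v (fun q => \sum_l F q i l * G q l k)).
  by apply: (dir_ext _ oW Wp) => q _; rewrite mxE.
rewrite (dir_sum _ _ _ oW Wp) => [|l]; last exact: smooth_funM.
by apply: eq_bigr => l _; rewrite (dirM _ Wp (hF i l) (hG l k)) !mxE.
Qed.

Lemma dirm_tr m n (F : M -> 'M[R]_(m, n)) p v : dirm p v (fun q => (F q)^T) = (dirm p v F)^T.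
Proof.
by apply/matrixP => i k; rewrite !mxE; congr dir; apply/funext => q; rewrite mxE.
Qed.

Lemma dirm_sumv m n (I : finType) p (F : M -> 'M[R]_(m, n)) (k : I -> R) (x : I -> vec6 R) :
  dirm p (\sum_i k i *: x i) F = \sum_i k i *: dirm p (x i) F.
Proof.
apply/matrixP => a b; rewrite mxE dir_suml summxE.
by apply: eq_bigr => i _; rewrite !mxE.
Qed.

End MatrixFields.

(** * Components in an orthonormal frame *)

Section Frames.
Context {R : realType} {M : oriented_manifold6 R} (g : riemannian_metric M).
Implicit Types (W : set M) (p q : M) (v w : vec6 R) (u : 'I_6 -> M -> vec6 R).
Local Notation basis a := (delta_mx 0 a : 'rV[R]_6).

Lemma innerDl p X Y v : inner g p (X + Y) v = inner g p X v + inner g p Y v.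
Proof. by rewrite /inner /bilin !mulmxDl mxE. Qed.
Lemma innerZl p k X v : inner g p (k *: X) v = k * inner g p X v.
Proof. by rewrite /inner /bilin -!scalemxAl mxE. Qed.
Lemma innerC p X Y : inner g p X Y = inner g p Y X.
Proof.
rewrite /inner /bilin -[in LHS](gram_sym g p) -[in LHS](trmxK X) -!trmx_mul mxE.
by rewrite mulmxA.
Qed.
Lemma inner_suml p (I : finType) (F : I -> vec6 R) v :
  inner g p (\sum_i F i) v = \sum_i inner g p (F i) v.
Proof. by rewrite /inner /bilin !mulmx_suml summxE. Qed.

(** The components of a tangent vector in the frame u, for u orthonormal at p. *)
Definition crd u p X : 'rV[R]_6 := \row_a inner g p X (u a p).

Lemma crd_is_linear u p : linear (crd u p).
Proof. by move=> k X Y; apply/rowP => a; rewrite !mxE innerDl innerZl. Qed.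
HB.instance Definition _ u p := GRing.isLinear.Build _ _ _ _ (crd u p) (crd_is_linear u p).

Definition combine u (x : M -> 'rV[R]_6) p : vec6 R := \sum_a x p 0 a *: u a p.

Section AtPoint.
Variables (u : 'I_6 -> M -> vec6 R) (p : M).
Hypothesis on : Defs.orthonormal g p (u ^~ p).

Lemma crd_frame a : crd u p (u a p) = basis a.
Proof. by apply/rowP => b; rewrite !mxE on eqxx eq_sym. Qed.

Lemma crd_combine x : crd u p (combine u x p) = x p.
Proof.
rewrite /combine linear_sum [RHS]row_sum_delta; apply: eq_bigr => a _.
by rewrite linearZ /= crd_frame.
Qed.

Lemma crdK X : \sum_a crd u p X 0 a *: u a p = X.
Proof.
pose E : 'M[R]_6 := \matrix_(a, i) u a p 0 i.
have EE : E *m (g p *m E^T) = 1%:M.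
  apply/matrixP => a b; rewrite [RHS]mxE -on /inner /bilin -mulmxA mxE [RHS]mxE.
  apply: eq_bigr => k _; rewrite !mxE; congr (_ * _).
  by apply: eq_bigr => l _; rewrite !mxE.
have cE : crd u p X = X *m (g p *m E^T).
  apply/rowP => a; rewrite mxE /inner /bilin -mulmxA !mxE.
  apply: eq_bigr => k _; rewrite !mxE; congr (_ * _).
  by apply: eq_bigr => l _; rewrite !mxE.
have -> : \sum_a crd u p X 0 a *: u a p = crd u p X *m E.
  apply/rowP => i; rewrite summxE mxE; apply: eq_bigr => a _; by rewrite [LHS]mxE [E _ _]mxE.
by rewrite cE -mulmxA (mulmx1C EE) mulmx1.
Qed.

Lemma crd_inj X Y : crd u p X = crd u p Y -> X = Y.
Proof. by move=> XY; rewrite -(crdK X) XY crdK. Qed.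

Lemma inner_crd X Y : inner g p X Y = dot (crd u p X) (crd u p Y).
Proof.
rewrite -{1}(crdK X) inner_suml dotE; apply: eq_bigr => a _.
by rewrite innerZl (innerC p (u a p)) [crd u p Y 0 a]mxE.
Qed.
End AtPoint.

Lemma combine_crd W u (Y : M -> vec6 R) q : orthonormal_frame g W u -> W q ->
  combine u (fun q => crd u q (Y q)) q = Y q.
Proof. by move=> [_ _ on] Wq; apply: crdK (on q Wq) _. Qed.

Lemma crd_smooth W u Y : orthonormal_frame g W u -> smooth_vf W Y ->
  smoothm W (fun q => crd u q (Y q)).
Proof.
move=> [oW us on] sY i k.
by apply: (smooth_fun_ext oW _ (gram_smooth g oW sY (us k))) => q _; rewrite mxE.
Qed.

Lemma combine_smooth W u x : orthonormal_frame g W u -> smoothm W x ->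
  smooth_vf W (combine u x).
Proof.
by move=> [oW us on] sx; apply: smooth_vf_sum => a; apply: smooth_vfZ (us a); apply: sx.
Qed.

Lemma frame_sub W W' u : open W' -> W' `<=` W -> orthonormal_frame g W u ->
  orthonormal_frame g W' u.
Proof.
move=> oW' sub [oW us on]; split=> // [a|p W'p]; last by apply: on; apply: sub.
exact: smooth_vf_sub (us a).
Qed.

Section Connection.
Variables (D : M -> vec6 R -> (M -> vec6 R) -> vec6 R) (HD : is_connection D).

Lemma conn_lin W Y p a v w : open W -> W p -> smooth_vf W Y ->
  D p (a *: v + w) Y = a *: D p v Y + D p w Y.
Proof. by move=> oW Wp sY; have [h _ _ _ _] := HD oW sY; apply: h. Qed.
Lemma conn_ext W Y Z p v : open W -> W p -> smooth_vf W Y ->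
  (forall q, W q -> Z q = Y q) -> D p v Z = D p v Y.
Proof. by move=> oW Wp sY; have [_ _ _ h _] := HD oW sY; apply: h. Qed.
Lemma connD W Y Z p v : open W -> W p -> smooth_vf W Y -> smooth_vf W Z ->
  D p v (fun q => Y q + Z q) = D p v Y + D p v Z.
Proof. by move=> oW Wp sY sZ; have [_ h _ _ _] := HD oW sY; apply: h. Qed.
Lemma connZ W Y f p v : open W -> W p -> smooth_fun W f -> smooth_vf W Y ->
  D p v (fun q => f q *: Y q) = dir p v f *: Y p + f p *: D p v Y.
Proof. by move=> oW Wp sf sY; have [_ _ h _ _] := HD oW sY; apply: h. Qed.
Lemma conn_smooth W X Y : open W -> smooth_vf W X -> smooth_vf W Y ->
  smooth_vf W (fun p => D p (X p) Y).
Proof. by move=> oW sX sY; have [_ _ _ _ h] := HD oW sY; apply: h. Qed.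

Lemma conn0 p v : D p v (fun=> 0) = 0.
Proof.
have s0 := @smooth_vf0 R M setT.
have := connD v openT (I : [set: M] p) s0 s0.
rewrite (_ : (fun _ => 0 + 0) = (fun=> 0)); last by apply/funext => q; rewrite addr0.
by move=> e; apply: (addrI (D p v (fun=> 0))); rewrite addr0 -e.
Qed.

Lemma conn_sum (I : Type) (r : seq I) W (Y : I -> M -> vec6 R) p v : open W -> W p ->
  (forall i, smooth_vf W (Y i)) ->
  D p v (fun q => \sum_(i <- r) Y i q) = \sum_(i <- r) D p v (Y i).
Proof.
move=> oW Wp sY; elim: r => [|i r IH].
  rewrite big_nil; transitivity (D p v (fun=> 0)); last exact: conn0.
  by apply: (conn_ext v oW Wp (@smooth_vf0 R M W)) => q _; rewrite big_nil.
rewrite big_cons -IH -(connD v oW Wp (sY i) (smooth_vf_sum r sY)).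
apply: (conn_ext v oW Wp (smooth_vfD (sY i) (smooth_vf_sum r sY))) => q _.
by rewrite big_cons.
Qed.

Lemma conn_suml (I : finType) W Y p (k : I -> R) (x : I -> vec6 R) : open W -> W p ->
  smooth_vf W Y -> D p (\sum_i k i *: x i) Y = \sum_i k i *: D p (x i) Y.
Proof.
move=> oW Wp sY; have d0 : D p 0 Y = 0.
  have := conn_lin 1 0 0 oW Wp sY; rewrite !scale1r addr0 => e.
  by apply: (addrI (D p 0 Y)); rewrite addr0 -e.
elim: (index_enum I) => [|i r IH]; first by rewrite !big_nil.
by rewrite !big_cons (conn_lin _ _ _ oW Wp sY) IH.
Qed.

(** D_v Y = v(Y) + w(v) Y in components: expand Y in the frame and use the
    Leibniz rule. *)
Lemma crd_conn W u Y p v : orthonormal_frame g W u -> W p -> smooth_vf W Y ->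
  crd u p (D p v Y) = dirm p v (fun q => crd u q (Y q))
    + crd u p (Y p) *m (conn_form g D u p v)^T.
Proof.
move=> fu Wp sY; have [oW us on] := fu; set y := fun q => crd u q (Y q).
have sy := crd_smooth fu sY.
rewrite -(conn_ext (Z := combine u y) v oW Wp sY); last first.
  by move=> q Wq; apply: combine_crd fu Wq.
have sya a : smooth_fun W (fun q => y q 0 a) by apply: sy.
rewrite (conn_sum _ v oW Wp) => [|a]; last exact: smooth_vfZ.
under eq_bigr do rewrite (connZ v oW Wp) //.
rewrite linear_sum /=.
under eq_bigr do rewrite linearD !linearZ /= (crd_frame (on p Wp)).
rewrite big_split /=; congr (_ + _).
  by rewrite [RHS]row_sum_delta; apply: eq_bigr => a _; rewrite mxE.
apply/rowP => b; rewrite summxE mxE; apply: eq_bigr => a _.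
by rewrite !mxE.
Qed.
End Connection.
End Frames.

(** * Frames of the reduction *)

Section AdaptedFrames.
Context {R : realType} (c : spin_module R) {M : oriented_manifold6 R} {g : riemannian_metric M}.
Variable Q : spin_structure c g.
Local Notation basis a := (delta_mx 0 a : 'rV[R]_6).
Local Notation j := (jmx c).
Implicit Types (W : set M) (p q : M) (v w : vec6 R).

Lemma smooth_dot n W (x y : M -> 'rV[R]_n) : open W -> smoothm W x -> smoothm W y ->
  smooth_fun W (fun q => dot (x q) (y q)).
Proof.
move=> oW sx sy; exact: (smoothm_mul oW sx (smoothm_tr oW sy)).
Qed.

Lemma smooth_sprod n W (x y : M -> 'cV[R]_n) : open W -> smoothm W x -> smoothm W y ->
  smooth_fun W (fun q => sprod (x q) (y q)).
Proof.
move=> oW sx sy; exact: (smoothm_mul oW (smoothm_tr oW sx) sy).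
Qed.

(** A local section u = e A of the reduction, where e is the frame of the
    trivialization al, together with a smooth lift h of A to Spin(6). Keeping h
    avoids lifting A later on. *)
Record adapted (phi0 : 'cV[R]_8) (phi : Q -> M -> 'cV[R]_8) (al : Q) W
    (u : 'I_6 -> M -> vec6 R) (h : M -> 'M[R]_8) (A : M -> 'M[R]_6) : Prop := Adapted {
  ad_open : open W;
  ad_dom : W `<=` spin_dom al;
  ad_smooth_h : smoothm W h;
  ad_smooth_A : smoothm W A;
  ad_spin : forall q, W q -> Spin6 c (h q);
  ad_cov : forall q, W q -> spin_covers c (h q) (A q);
  ad_phi : forall q, W q -> phi al q = h q *m phi0;
  ad_frame : forall b q, u b q = \sum_a A q a b *: spin_frame al a q }.

(** Near p, [two_vectors] carries phi' = e_1 . phi(p) to phi: at p the vector part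
    of phi relative to phi' has length 1, so the y given by [avoiding] is nonzero
    near p. Composing with a constant element that carries phi0 to phi' gives h. *)
Lemma adapted_exists phi0 phi al W p : unit_spinor phi0 -> unit_spinor_field phi ->
  open W -> W p -> spin_dom al p ->
  exists W' u h A, [/\ adapted phi0 phi al W' u h A, W' p & W' `<=` W].
Proof.
move=> phi01 [[sphi _] uphi] oW Wp alp.
have [[oal sal onal] _] := spin_frameP al.
pose psi q := phi al q; pose psi0 := psi p.
have psi01 : unit_spinor psi0 by apply: uphi.
pose phi' := c (basis ord0) *m psi0.
have phi'1 : unit_spinor phi'.
  by rewrite /unit_spinor -/(sprod _ _) cl_norm dot_basisr mxE !eqxx mul1r.
have [h0 sh0 h0E] := spin_transitive c phi01 phi'1.
pose v := vpart c phi' psi0; pose w := vpart c phi' (j *m psi0).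
have [y0 [y01 y0v y0w]] := orthogonal_unit_exists v w.
pose y q := avoiding c phi' y0 (psi q).
have psiE : psi0 = c v *m phi'.
  apply: vpartK => //; first exact: sprod_cl.
  by rewrite sprod_jcl.
have vv : dot v v = 1.
  have : sprod psi0 psi0 = 1 := psi01.
  by rewrite psiE cl_norm [sprod _ _]phi'1 mulr1.
have yp : y p = y0 by rewrite /y /avoiding -/v -/w vv y0v y0w !scale0r !subr0 scale1r.
pose W0 := W `&` spin_dom al.
have oW0 : open W0 by apply: openI.
have spsi : smoothm W0 psi.
  move=> i k; rewrite (ord1 k); apply: smooth_fun_sub (sphi al i); by move=> q [].
have sv : smoothm W0 (fun q => vpart c phi' (psi q)) by apply: smoothm_lin.
have sjpsi : smoothm W0 (fun q => j *m psi q).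
  by apply: smoothm_mul => //; apply: smoothm_cst.
have sw : smoothm W0 (fun q => vpart c phi' (j *m psi q)) by apply: smoothm_lin.
have sy0 := @smoothm_cst R M _ _ W0 y0.
have sy : smoothm W0 y.
  exact: smoothmB oW0 (smoothmB oW0 (smoothmZ oW0 (smooth_dot oW0 sv sv) sy0)
    (smoothmZ oW0 (smooth_dot oW0 sy0 sv) sv)) (smoothmZ oW0 (smooth_dot oW0 sy0 sw) sw).
have syy : smooth_fun W0 (fun q => dot (y q) (y q)) by apply: smooth_dot.
pose W' := W0 `&` [set q | dot (y q) (y q) != 0].
have oW' : open W' by apply: open_nonzero.
have sub' : W' `<=` W0 by move=> q [].
pose h q := two_vectors c phi' (y q) (psi q) *m h0.
have sh : smoothm W' h.
  apply: smoothm_mul => //; last exact: smoothm_cst.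
  apply: smoothmZ => //.
    by apply: smooth_funN => //; apply: smooth_funV => //; [move=> q []|exact: smooth_fun_sub syy].
  have scy := smoothm_lin c oW0 sy.
  have scyp := smoothm_mul oW0 scy spsi.
  have sz := smoothm_lin c oW0 (smoothm_lin (vpart c phi') oW0 scyp).
  exact: smoothm_sub sub' (smoothm_mul oW0 scy sz).
have spin q : W' q -> Spin6 c (h q) /\ h q *m phi0 = psi q.
  move=> [[Wq alq] yq]; have psi1 : unit_spinor (psi q) by apply: uphi.
  have [y1 y2] := avoidingP c y0 (psi q) phi'1.
  have [|s1 s2] := two_vectorsP phi'1 psi1 _ y1 y2.
    by apply: contraNneq yq => e; rewrite /y e dot0l.
  by split; [apply: spin_mul|rewrite -mulmxA h0E].
pose A q : 'M[R]_6 := \matrix_(a, b)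
  sprod (h q *m c (basis b) *m (h q)^T *m phi0) (c (basis a) *m phi0).
have cov q : W' q -> spin_covers c (h q) (A q).
  move=> W'q; have [sq _] := spin q W'q; have [B [hB _ _]] := spin_covering sq.
  suff -> : A q = B by [].
  apply/matrixP => a b; rewrite mxE -(spin_invmx sq) hB cl_norm [sprod _ _]phi01 mulr1.
  by rewrite dot_basisr -rowE !mxE.
exists W', (fun b q => \sum_a A q a b *: spin_frame al a q), h, A; split.
- split=> //.
  + by move=> q [[]].
  + move=> a b; have sB : smoothm W' (fun q => h q *m c (basis b) *m (h q)^T *m phi0).
      have s1 := smoothm_mul oW' sh (@smoothm_cst R M _ _ W' (c (basis b))).
      have s2 := smoothm_mul oW' s1 (smoothm_tr oW' sh).
      exact: smoothm_mul oW' s2 (@smoothm_cst R M _ _ W' phi0).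
    apply: (smooth_fun_ext oW' _ (smooth_sprod oW' sB (@smoothm_cst R M _ _ W' (c (basis a) *m phi0)))).
    by move=> q _; rewrite mxE.
  + by move=> q /spin[].
  + by move=> q /spin[].
- by split=> //=; rewrite yp y01 oner_eq0.
- by move=> q [[]].
Qed.

Section Fixed.
Variables (phi0 : 'cV[R]_8) (phi : Q -> M -> 'cV[R]_8) (al : Q) (W : set M).
Variables (u : 'I_6 -> M -> vec6 R) (h : M -> 'M[R]_8) (A : M -> 'M[R]_6).
Hypotheses (phi01 : unit_spinor phi0) (uphi : unit_spinor_field phi).
Hypothesis ad : adapted phi0 phi al W u h A.
Local Notation e := (spin_frame al).

Lemma adapted_spin_frame : orthonormal_frame g W e.
Proof. by have [fe _] := spin_frameP al; apply: frame_sub (ad_open ad) (ad_dom ad) fe. Qed.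

Let on_e q (Wq : W q) : Defs.orthonormal g q (e ^~ q).
Proof. by have [_ _] := adapted_spin_frame; apply. Qed.

Lemma adapted_crd_frame b q : W q -> crd g e q (u b q) = basis b *m (A q)^T.
Proof.
move=> Wq; rewrite (ad_frame ad) linear_sum; apply/rowP => a.
rewrite -rowE summxE !mxE (bigD1 a) //= linearZ /= (crd_frame (on_e Wq)) !mxE !eqxx mulr1.
rewrite big1 ?addr0 // => k ka; rewrite linearZ /= (crd_frame (on_e Wq)) !mxE.
by rewrite eq_sym (negPf ka) andbF mulr0.
Qed.

Lemma adapted_frame : orthonormal_frame g W u.
Proof.
have fe := adapted_spin_frame; have oW := ad_open ad; split=> // [b|q Wq a b].
  apply: (smooth_vf_ext _ (combine_smooth (x := fun q => basis b *m (A q)^T) fe _)).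
    move=> q Wq; rewrite -(crdK (on_e Wq) (u b q)) adapted_crd_frame //.
  by apply: smoothm_mul => //; [apply: smoothm_cst|apply: smoothm_tr (ad_smooth_A ad)].
rewrite (inner_crd (on_e Wq)) !adapted_crd_frame // dot_mulmx trmxK -mulmxA.
rewrite (mulmx1C (covers_orth (ad_spin ad Wq) (ad_cov ad Wq))) mulmx1 dot_basisr.
by rewrite mxE eqxx eq_sym.
Qed.

Lemma adapted_reduction q : W q -> reduction phi0 phi q (u ^~ q).
Proof.
move=> Wq; exists al, (h q), (A q); split.
- exact: (ad_dom ad).
- exact: (ad_spin ad).
- exact: (ad_cov ad).
- by move=> b; apply: (ad_frame ad).
- exact: (ad_phi ad).
Qed.

(** Elements of Spin(6) cover matrices of determinant 1. *)
Lemma adapted_oriented : oriented_orthonormal_frame g W u.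
Proof.
split; first exact: adapted_frame.
move=> q Wq; have [_ or] := spin_frameP al; have := or q (ad_dom ad Wq).
rewrite /oriented.
have -> : \matrix_(a, i) u a q 0 i = (A q)^T *m \matrix_(a, i) e a q 0 i.
  apply/matrixP => b i; rewrite !mxE (ad_frame ad) summxE.
  by apply: eq_bigr => a _; rewrite !mxE.
by rewrite det_mulmx det_tr (covers_det (ad_spin ad Wq) (ad_cov ad Wq)) mul1r.
Qed.

Lemma adapted_crd q X : W q -> crd g e q X = crd g u q X *m (A q)^T.
Proof.
move=> Wq; have [_ _ on] := adapted_frame.
rewrite -{1}(crdK (on q Wq) X) linear_sum [crd g u q X in RHS]row_sum_delta mulmx_suml.
by apply: eq_bigr => b _; rewrite linearZ /= adapted_crd_frame // -scalemxAl.
Qed.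

(** h intertwines the trivialization al with the one given by u. *)
Lemma adapted_vec_act q X : W q -> vec_act al q X *m phi al q = h q *m (c (crd g u q X) *m phi0).
Proof.
move=> Wq; rewrite /vec_act -/(crd g e q X) adapted_crd // (ad_phi ad Wq) !mulmxA.
by rewrite (covers_cl _ (ad_spin ad Wq) (ad_cov ad Wq)).
Qed.

End Fixed.
End AdaptedFrames.

(** * The spin connection in an adapted frame *)

(** Conjugation by h carries one orthonormal basis in [rhoE] to another. *)
Lemma rho_covers (R : realType) (c : spin_module R) h A B : Spin6 c h -> spin_covers c h A ->
  B^T = - B -> h *m rho c B = rho c (A *m B *m A^T) *m h.
Proof.
move=> sh cov Bs; have Bs' : (A *m B *m A^T)^T = - (A *m B *m A^T).
  by rewrite !trmx_mul trmxK Bs mulmxA mulmxN mulNmx.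
rewrite !rhoE // -scalemxAl -scalemxAr; congr (_ *: _); rewrite mulmx_sumr mulmx_suml.
transitivity (\sum_b c ((delta_mx 0 b : 'rV[R]_6) *m B^T *m A^T) *m c ((delta_mx 0 b : 'rV[R]_6) *m A^T) *m h).
  apply: eq_bigr => b _; rewrite mulmxA (covers_cl _ sh cov) -(mulmxA (c _) h) (covers_cl _ sh cov).
  by rewrite mulmxA.
transitivity (\sum_b \sum_a A a b *:
    (c ((delta_mx 0 b : 'rV[R]_6) *m B^T *m A^T) *m c ((delta_mx 0 a : 'rV[R]_6)) *m h)).
  apply: eq_bigr => b _; rewrite [c (_ *m A^T) in X in _ *m X *m _]cl_sum.
  rewrite mulmx_sumr mulmx_suml; apply: eq_bigr => a _.
  by rewrite -scalemxAr -scalemxAl -rowE !mxE.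
rewrite exchange_big; apply: eq_bigr => a _ /=.
have -> : (delta_mx 0 a : 'rV[R]_6) *m (A *m B *m A^T)^T = \sum_b A a b *: ((delta_mx 0 b : 'rV[R]_6) *m B^T *m A^T).
  rewrite !trmx_mul trmxK !mulmxA -rowE {1}(row_sum_delta (row a A)) !mulmx_suml.
  by apply: eq_bigr => b _; rewrite mxE -!scalemxAl.
rewrite linear_sum !mulmx_suml; apply: eq_bigr => b _.
by rewrite linearZ /= -!scalemxAl.
Qed.

Section Torsion.
Context {R : realType} (c : spin_module R) {M : oriented_manifold6 R} {g : riemannian_metric M}.
Variable Q : spin_structure c g.
Variables (D : M -> 'rV[R]_6 -> (M -> 'rV[R]_6) -> 'rV[R]_6) (HD : levi_civita g D).
Local Notation basis a := (delta_mx 0 a : 'rV[R]_6).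
Local Notation j := (jmx c).
Implicit Types (W : set M) (p q : M) (v w : vec6 R).

Lemma lc_conn : is_connection D. Proof. by case: HD. Qed.

(** Differentiate g(u_a, u_b), which is constant. *)
Lemma conn_form_skew W u p v : orthonormal_frame g W u -> W p ->
  (conn_form g D u p v)^T = - conn_form g D u p v.
Proof.
move=> [oW su on] Wp; have [_ compat _] := HD; apply/matrixP => a b; rewrite !mxE.
have := compat W (u a) (u b) p v oW Wp (su a) (su b).
rewrite (dir_ext v oW Wp (g := fun=> (a == b)%:R)); last by move=> q Wq; apply: on.
rewrite dir_cst (innerC g p (u a p)) => e; lra.
Qed.

Lemma spin_nablaE al W p v (phi : Q -> M -> 'cV[R]_8) :
  orthonormal_frame g W (spin_frame al) -> W p ->
  spin_nabla D phi al p v = dirm p v (phi al)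
    - 2^-1 *: (rho c (conn_form g D (spin_frame al) p v) *m phi al p).
Proof.
move=> fe Wp; rewrite /spin_nabla; congr (_ + _).
  by apply/matrixP => i k; rewrite (ord1 k) !mxE.
rewrite -scalerN -mulNmx -linearN -(conn_form_skew v fe Wp); congr (_ *: (_ *m _)).
by apply: eq_bigr => a _; apply: eq_bigr => b _; rewrite !mxE.
Qed.

Section Fixed.
Variables (phi0 : 'cV[R]_8) (phi : Q -> M -> 'cV[R]_8) (al : Q) (W : set M).
Variables (u : 'I_6 -> M -> vec6 R) (h : M -> 'M[R]_8) (A : M -> 'M[R]_6).
Hypotheses (phi01 : unit_spinor phi0) (uphi : unit_spinor_field phi).
Hypothesis ad : adapted phi0 phi al W u h A.
Local Notation e := (spin_frame al).

(** phi = h phi0, so the derivative of phi is h' phi0. Both h' and the spin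
    connection in the frame e are controlled by their commutators with
    vectors. Comparing with the transformation rule A w_u = A' + w_e A of
    connection forms shows that h^-1 (h' - 1/2 rho(w_e) h) + 1/2 rho(w_u)
    commutes with the Clifford action. By [cl_commutant] it acts on phi0 as a
    scalar, and this scalar is 0 because |phi| = 1 and rho is skew. *)
Lemma spin_nabla_adapted p v : W p ->
  spin_nabla D phi al p v = - 2^-1 *: (h p *m (rho c (conn_form g D u p v) *m phi0)).
Proof.
move=> Wp; have oW := ad_open ad; have fe := adapted_spin_frame ad.
have fu := adapted_frame ad; have on : Defs.orthonormal g p (e ^~ p) by case: fe => _ _; apply.
set wu := conn_form g D u p v; set we := conn_form g D e p v.
have wus : wu^T = - wu by apply: conn_form_skew fu Wp.
have wes : we^T = - we by apply: conn_form_skew fe Wp.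
have sh := ad_spin ad Wp; have cov := ad_cov ad Wp.
set dA := dirm p v A; set dh := dirm p v h.
have star : wu^T *m (A p)^T = dA^T + (A p)^T *m we^T.
  apply/row_matrixP => b; rewrite !rowE mulmxDr !mulmxA.
  have [_ su _] := fu.
  have := crd_conn lc_conn v fe Wp (su b).
  rewrite (adapted_crd ad) // (crd_conn lc_conn v fu Wp (su b)).
  have [_ _ onu] := fu.
  rewrite (crd_frame (onu p Wp)) (adapted_crd_frame ad) // -/we -/wu mulmxDl.
  rewrite (dirm_ext v oW Wp (G := fun=> basis b)); last first.
    by move=> q Wq; rewrite (crd_frame (onu q Wq)).
  rewrite dirm_cst mul0mx add0r => ->; congr (_ + _).
  rewrite (dirm_ext v oW Wp (G := fun q => basis b *m (A q)^T)); last first.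
    by move=> q Wq; rewrite (adapted_crd_frame ad).
  rewrite (dirm_mul v oW Wp (@smoothm_cst R M _ _ W (basis b)) (smoothm_tr oW (ad_smooth_A ad))).
  by rewrite dirm_cst mul0mx add0r dirm_tr.
have star2 x : dh *m c x = c (x *m dA^T) *m h p + c (x *m (A p)^T) *m dh.
  have sA : smoothm W (fun q => x *m (A q)^T).
    by apply: smoothm_mul => //; [apply: smoothm_cst|apply: smoothm_tr (ad_smooth_A ad)].
  have := dirm_mul v oW Wp (smoothm_lin c oW sA) (ad_smooth_h ad).
  rewrite (dirm_lin c v oW Wp sA).
  rewrite (dirm_mul v oW Wp (@smoothm_cst R M _ _ W x) (smoothm_tr oW (ad_smooth_A ad))).
  rewrite dirm_cst mul0mx add0r dirm_tr -/dA -/dh => <-.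
  rewrite (dirm_ext v oW Wp (G := fun q => h q *m c x)); last first.
    by move=> q Wq; rewrite (covers_cl _ (ad_spin ad Wq) (ad_cov ad Wq)).
  rewrite (dirm_mul v oW Wp (ad_smooth_h ad) (@smoothm_cst R M _ _ W (c x))).
  by rewrite dirm_cst mulmx0 addr0.
pose G := dh - 2^-1 *: (rho c we *m h p) + 2^-1 *: (h p *m rho c wu).
have rc B x : B^T = - B -> rho c B *m c x = c x *m rho c B - 2 *: c (x *m B^T).
  by move=> Bs; rewrite -(rho_cl c x Bs) opprB addrC subrK.
have Gc x : G *m c x = c (x *m (A p)^T) *m G.
  rewrite /G !mulmxDl !mulmxDr !mulNmx !mulmxN -!scalemxAl -!scalemxAr star2.
  rewrite -(mulmxA (rho c we)) (covers_cl _ sh cov) (mulmxA (rho c we)) rc // mulmxBl.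
  rewrite -(mulmxA (h p)) rc // mulmxBr (mulmxA (h p)) (covers_cl _ sh cov).
  rewrite -!scalemxAl -!scalemxAr (covers_cl _ sh cov) -(mulmxA x wu^T) star.
  rewrite [x *m (_ + _)]mulmxDr [c (_ + _)]linearD mulmxDl !mulmxA !scalerBr !scalerA mulVf ?pnatr_eq0 //.
  by mxring.
have [k kE] : exists k, ((h p)^T *m G) *m phi0 = k *: phi0.
  apply: (cl_commutant (c := c) phi01) => x; rewrite -mulmxA Gc.
  have hT : (h p)^T *m c (x *m (A p)^T) = c x *m (h p)^T.
    rewrite -[LHS]mulmx1 -(spin_orth sh) -mulmxA (mulmxA (c _)) -(covers_cl _ sh cov).
    by rewrite !mulmxA (spin_orthl sh) mul1mx.
  by rewrite mulmxA hT mulmxA.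
have GE : G *m phi0 = k *: phi al p.
  have -> : G = h p *m ((h p)^T *m G) by rewrite mulmxA (spin_orth sh) mul1mx.
  by rewrite -mulmxA kE -scalemxAr (ad_phi ad Wp).
have dphi : dirm p v (phi al) = dh *m phi0.
  rewrite (dirm_ext v oW Wp (ad_phi ad)).
  rewrite (dirm_mul v oW Wp (ad_smooth_h ad) (@smoothm_cst R M _ _ W phi0)).
  by rewrite dirm_cst mulmx0 addr0.
have nabE : spin_nabla D phi al p v = k *: phi al p - 2^-1 *: (h p *m (rho c wu *m phi0)).
  rewrite (spin_nablaE v phi fe Wp) -/we -GE /G dphi !mulmxDl mulNmx -!scalemxAl.
  rewrite -!mulmxA -(ad_phi ad Wp); mxring.
suff k0 : k = 0 by rewrite nabE k0 scale0r add0r scaleNr.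
have uu q : W q -> sprod (phi al q) (phi al q) = 1.
  by move=> Wq; apply: uphi.2; apply: (ad_dom ad).
have sphi : smoothm W (phi al).
  move=> i l; rewrite (ord1 l); apply: smooth_fun_sub (ad_dom ad) _; exact: uphi.1.1.
have dd : sprod (phi al p) (dirm p v (phi al)) = 0.
  have : dirm p v (fun q => (phi al q)^T *m phi al q) = 0.
    rewrite -(dirm_cst (1%:M : 'M[R]_1) p v); apply: (dirm_ext v oW Wp) => q Wq.
    by apply/matrixP => i l; rewrite !ord1 [RHS]mxE -(uu q Wq).
  rewrite (dirm_mul v oW Wp (smoothm_tr oW sphi) sphi) dirm_tr.
  move=> /matrixP/(_ 0 0); rewrite mxE -!/(sprod _ _) (sprodC (dirm _ _ _)) [RHS]mxE => e.
  by lra.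
have := congr1 (sprod (phi al p)) nabE.
rewrite (spin_nablaE v phi fe Wp) !sprodDr !sprodNr !sprodZr dd uu // (sprod_skew _ (rho_tr c we)).
rewrite {1}(ad_phi ad Wp) sprod_adj (mulmxA (h p)^T) (spin_orthl sh) mul1mx (sprod_skew _ (rho_tr c wu)).
by move=> e; lra.
Qed.

Lemma adapted_skew_act p (X : vec6 R -> vec6 R) (N : 'M[R]_6) (f : 'cV[R]_8) : W p -> N^T = - N ->
  (forall Y, crd g u p (X Y) = crd g u p Y *m N^T) ->
  skew_act al p X *m (h p *m f) = h p *m (rho c N *m f).
Proof.
move=> Wp Ns XN; have sh := ad_spin ad Wp; have cov := ad_cov ad Wp.
rewrite [RHS]mulmxA (rho_covers sh cov Ns) -mulmxA; congr (_ *m _).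
apply: eq_bigr => a _; apply: eq_bigr => b _; congr (_ *: _).
have [_ _ on] := adapted_spin_frame ad.
have eb : crd g u p (e b p) = basis b *m A p.
  rewrite -(crd_frame (on p Wp)) (adapted_crd ad) // -mulmxA.
  by rewrite (mulmx1C (covers_orth sh cov)) mulmx1.
transitivity (crd g e p (X (e b p)) 0 a); first by rewrite mxE innerC.
rewrite (adapted_crd ad) // XN eb.
have -> : basis b *m A p *m N^T *m (A p)^T = basis b *m (A p *m N *m (A p)^T)^T.
  by rewrite !trmx_mul trmxK !mulmxA.
by rewrite -rowE [LHS]mxE [LHS]mxE.
Qed.

End Fixed.
End Torsion.

(** * The divergence of the intrinsic torsion *)

Section Harmonic.
Context {R : realType} (c : spin_module R) {M : oriented_manifold6 R} {g : riemannian_metric M}.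
Variable Q : spin_structure c g.
Variables (D : M -> 'rV[R]_6 -> (M -> 'rV[R]_6) -> 'rV[R]_6) (HD : levi_civita g D).
Variables (phi : Q -> M -> 'cV[R]_8) (Hphi : unit_spinor_field phi).
Variables (S : M -> {linear 'rV[R]_6 -> 'rV[R]_6}) (eta : M -> {scalar 'rV[R]_6}).
Hypothesis HS : spinor_derivative D phi S eta.
Variables (phi0 : 'cV[R]_8) (phi01 : unit_spinor phi0).
Variables (DG : M -> 'rV[R]_6 -> (M -> 'rV[R]_6) -> 'rV[R]_6).
Hypothesis HDG : SU3_connection phi0 phi D DG.
Variables (xi : M -> 'rV[R]_6 -> 'rV[R]_6 -> 'rV[R]_6) (Hxi : intrinsic_torsion D DG xi).
Local Notation basis a := (delta_mx 0 a : 'rV[R]_6).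
Local Notation j := (jmx c).
Implicit Types (W : set M) (p q : M) (v w : vec6 R).

(** The matrix of xi_v in an adapted frame; see [crd_xi]. *)
Definition torsion_mx u p v : 'M[R]_6 := conn_form g DG u p v - conn_form g D u p v.

(** The matrix of the divergence of xi in the frame u, the sum being over the
    frame f; see [crd_torsion_div]. *)
Definition torsion_div_mx u (f : 'I_6 -> M -> vec6 R) p : 'M[R]_6 :=
  \sum_i (dirm p (f i p) (fun q => torsion_mx u q (f i q))
    + (conn_form g D u p (f i p) *m torsion_mx u p (f i p)
       - torsion_mx u p (f i p) *m conn_form g D u p (f i p))
    - torsion_mx u p (D p (f i p) (f i))).

Let div_term (z dz : 'rV[R]_6) (dn np w Nd : 'M[R]_6) :
  dz *m np^T + z *m dn^T + z *m np^T *m w^T - z *m Nd^T - (dz + z *m w^T) *m np^T =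
  z *m (dn + (w *m np - np *m w) - Nd)^T.
Proof.
have -> : (dn + (w *m np - np *m w) - Nd)^T = dn^T + (np^T *m w^T - w^T *m np^T) - Nd^T.
  by rewrite linearB linearD linearB /= !trmx_mul.
by rewrite mulmxDl mulmxBr mulmxDr mulmxBr !mulmxA; mxring.
Qed.

Section Fixed.
Variables (al : Q) (W : set M).
Variables (u : 'I_6 -> M -> vec6 R) (h : M -> 'M[R]_8) (A : M -> 'M[R]_6).
Hypothesis ad : adapted phi0 phi al W u h A.
Let oW : open W := ad_open ad.
Let fu : orthonormal_frame g W u := adapted_frame ad.
Let onu q (Wq : W q) : Defs.orthonormal g q (u ^~ q).
Proof. by have [_ _] := fu; apply. Qed.
Let su b : smooth_vf W (u b).
Proof. by have [_ su _] := fu; apply: su. Qed.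
Local Notation N := (torsion_mx u).
Local Notation wG := (conn_form g DG u).
Local Notation w := (conn_form g D u).

Lemma wG_kills q v : W q -> (wG q v)^T = - wG q v /\ rho c (wG q v) *m phi0 = 0.
Proof.
move=> Wq; have [k _] := HDG.2 W u (adapted_oriented ad) (adapted_reduction ad) q v Wq.
exact: (su3_kills phi01 k).
Qed.

Lemma torsion_mxP q v : W q -> torsion_module c phi0 (N q v).
Proof.
move=> Wq; have [_ k] := HDG.2 W u (adapted_oriented ad) (adapted_reduction ad) q v Wq.
have := torsion_moduleZ (-1) (su3_perp_torsion phi01 k).
by rewrite scaleN1r opprB.
Qed.

Lemma torsion_mx_skew q v : W q -> (N q v)^T = - N q v.
Proof. by move=> Wq; have [] := torsion_mxP v Wq. Qed.

Lemma crd_xi q X Y : W q -> crd g u q (xi q X Y) = crd g u q Y *m (N q X)^T.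
Proof.
move=> Wq; pose Z := combine u (fun=> crd g u q Y).
have sZ : smooth_vf W Z by apply: combine_smooth fu _; apply: smoothm_cst.
have ZY : Z q = Y by apply: (crdK (onu Wq)).
rewrite -{1}ZY (Hxi X oW Wq sZ) linearB /= (crd_conn HDG.1 X fu Wq sZ).
rewrite (crd_conn (lc_conn HD) X fu Wq sZ) ZY /torsion_mx linearB /= mulmxBr.
by move: (dirm _ _ _) => d; mxring.
Qed.

Lemma torsion_spinor q v : W q ->
  2^-1 *: (rho c (N q v) *m phi0) = c (crd g u q (S q v)) *m phi0 + eta q v *: (j *m phi0).
Proof.
move=> Wq; have alq := ad_dom ad Wq; have := HS v alq.
rewrite (spin_nabla_adapted HD phi01 Hphi ad v Wq) (adapted_vec_act ad) // (ad_phi ad Wq).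
have sh := ad_spin ad Wq; have [_ k] := wG_kills v Wq.
rewrite -(spin_jf _ sh) scalemxAr [eta q v *: _]scalemxAr -mulmxDr => /(congr1 (mulmx (h q)^T)).
rewrite !(mulmxA _ (h q)) !(spin_orthl sh) !mul1mx => <-.
by rewrite /torsion_mx linearB mulmxBl k sub0r scalerN scaleNr.
Qed.

Lemma torsion_spinor2 q v : W q -> rho c (N q v) *m phi0 =
  2 *: (c (crd g u q (S q v)) *m phi0 + eta q v *: (j *m phi0)).
Proof. by move=> Wq; rewrite -torsion_spinor // scalerA mulfV ?pnatr_eq0 // scale1r. Qed.

Lemma torsion_mx_smooth X : smooth_vf W X -> smoothm W (fun q => N q (X q)).
Proof.
move=> sX a b.
have sD D' : is_connection D' -> smooth_fun W (fun q => inner g q (D' q (X q) (u b)) (u a q)).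
  by move=> hD'; apply: (gram_smooth g oW _ (su a)); apply: (conn_smooth hD').
apply: (smooth_fun_ext oW _ (smooth_funB oW (sD _ HDG.1) (sD _ (lc_conn HD)))) => q _.
by rewrite !mxE.
Qed.

Variable f : 'I_6 -> M -> vec6 R.
Hypothesis ff : orthonormal_frame g W f.
Let sf i : smooth_vf W (f i).
Proof. by have [_ sf _] := ff; apply: sf. Qed.
Let n i q := N q (f i q).
Let s i q := crd g u q (S q (f i q)).
Let sn i : smoothm W (n i) := torsion_mx_smooth (sf i).
Local Notation L := (torsion_div_mx u f).

Lemma crd_torsion_div p Z : W p -> smooth_vf W Z ->
  crd g u p (torsion_div D xi f p Z) = crd g u p (Z p) *m (L p)^T.
Proof.
move=> Wp sZ; rewrite /torsion_div /torsion_div_mx linear_sum [(\sum_i _)^T]linear_sum mulmx_sumr; apply: eq_bigr => i _.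
have sZc := crd_smooth fu sZ.
pose Y q := xi q (f i q) (Z q).
have sYc : smoothm W (fun q => crd g u q (Z q) *m (n i q)^T).
  by apply: smoothm_mul => //; apply: smoothm_tr.
have YE q : W q -> Y q = combine u (fun q => crd g u q (Z q) *m (n i q)^T) q.
  move=> Wq; apply: (crd_inj (onu Wq)); rewrite crd_xi // (crd_combine (onu Wq)).
  by [].
have sY : smooth_vf W Y.
  by apply: (smooth_vf_ext _ (combine_smooth fu sYc)) => q Wq; rewrite YE.
rewrite [LHS]linearB [X in X - _ = _]linearB /= -/(Y) (crd_conn (lc_conn HD) _ fu Wp sY) !crd_xi //.
rewrite (crd_conn (lc_conn HD) _ fu Wp sZ) -/(n i p).
rewrite (dirm_ext _ oW Wp (G := fun q => crd g u q (Z q) *m (n i q)^T)); last first.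
  by move=> q Wq; rewrite YE // (crd_combine (onu Wq)).
rewrite (dirm_mul _ oW Wp sZc (smoothm_tr oW (sn i))) dirm_tr.
exact: div_term.
Qed.

Lemma torsion_mx_dirm i p v : W p -> torsion_module c phi0 (dirm p v (n i)).
Proof.
move=> Wp; split.
  rewrite -dirm_tr -[RHS]scaleN1r -(dirm_lin (GRing.scale (-1)) v oW Wp (sn i)).
  by apply: (dirm_ext _ oW Wp) => q Wq; rewrite /n torsion_mx_skew //= scaleN1r.
rewrite -(dirm_lin (torsion_defect c phi0) v oW Wp (sn i)).
transitivity (dirm p v (fun=> 0 : 'M[R]_6)); last exact: dirm_cst.
apply: (dirm_ext _ oW Wp) => q Wq.
by have [_] := torsion_mxP (f i q) Wq.
Qed.

(** With w = wG - N the brackets [N(f_i), N(f_i)] vanish. Derivatives of m-valued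
    functions and brackets with wG, which is in su(3), stay in m. *)
Lemma torsion_div_mxP p : W p -> torsion_module c phi0 (L p).
Proof.
move=> Wp; apply: torsion_module_sum => i.
have [wGs k] := wG_kills (f i p) Wp.
have -> : w p (f i p) *m n i p - n i p *m w p (f i p)
    = wG p (f i p) *m n i p - n i p *m wG p (f i p).
  have -> : w p (f i p) = wG p (f i p) - n i p by rewrite /n /torsion_mx opprB addrC subrK.
  by move: (n i p) => np; rewrite mulmxBl mulmxBr; mxring.
rewrite -[- torsion_mx u p _]scaleN1r; apply: torsion_moduleD; first apply: torsion_moduleD.
- exact: torsion_mx_dirm.
- by apply: (torsion_bracket phi01) => //; apply: torsion_mxP.
- by apply: torsion_moduleZ; apply: torsion_mxP.
Qed.

(** The action of a 2-form on phi0, normalized so that half (N v) is nabla_v phi. *)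
Let half (X : 'M[R]_6) : 'cV[R]_8 := 2^-1 *: (rho c X *m phi0).
Let half_lin : linear half.
Proof.
move=> k X Y; rewrite /half linearD linearZ mulmxDl -scalemxAl scalerDr !scalerA.
by rewrite mulrC.
Qed.
(** 2-forms act by skew matrices, so there is no component along phi0. *)
Let half_decomp X : half X = c (vpart c phi0 (half X)) *m phi0
  + sprod (half X) (j *m phi0) *: (j *m phi0).
Proof.
rewrite {1}(spinor_decomp c phi01 (half X)).
have -> : sprod (half X) phi0 = 0.
  by rewrite sprodC /half sprodZr (sprod_skew _ (rho_tr c X)) mulr0.
by rewrite scale0r add0r addrC.
Qed.
Let sE i q : W q -> s i q = vpart c phi0 (half (n i q)).
Proof.
move=> Wq; rewrite /half /n torsion_spinor // linearD linearZ /= vpart_j scaler0 addr0.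
by rewrite vpart_cl.
Qed.
Let etaE i q : W q -> eta q (f i q) = sprod (half (n i q)) (j *m phi0).
Proof.
move=> Wq; rewrite /half /n torsion_spinor // sprodDl sprodZl sprod_jj [sprod phi0 phi0]phi01.
by rewrite mulr1 sprodC j_adj sprod_jcl oppr0 add0r.
Qed.

Lemma S_smooth i : smoothm W (s i).
Proof.
pose H := HB.pack_for {linear 'M[R]_6 -> 'cV[R]_8} half (GRing.isLinear.Build _ _ _ _ half half_lin).
apply: (smoothm_ext oW (F := fun q => vpart c phi0 (H (n i q)))).
  by move=> q Wq; rewrite sE.
by apply: smoothm_lin => //; apply: smoothm_lin.
Qed.

Let half_dirm i p v : W p -> half (dirm p v (n i)) =
  c (dirm p v (s i)) *m phi0 + dir p v (fun q => eta q (f i q)) *: (j *m phi0).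
Proof.
move=> Wp.
pose H := HB.pack_for {linear 'M[R]_6 -> 'cV[R]_8} half (GRing.isLinear.Build _ _ _ _ half half_lin).
have sH : smoothm W (fun q => H (n i q)) by apply: smoothm_lin.
have dH : dirm p v (fun q => H (n i q)) = half (dirm p v (n i)) := dirm_lin H v oW Wp (sn i).
have ds : vpart c phi0 (half (dirm p v (n i))) = dirm p v (s i).
  rewrite -dH -(dirm_lin (vpart c phi0) v oW Wp sH).
  by apply: (dirm_ext _ oW Wp) => q Wq; rewrite sE.
rewrite [LHS]half_decomp ds -dH; congr (_ + _ *: _).
rewrite sprodC /sprod; have cst1 := @smoothm_cst R M _ _ W (j *m phi0)^T.
have := dirm_mul v oW Wp cst1 sH; rewrite dirm_cst mul0mx add0r => <-.
by rewrite mxE; apply: (dir_ext _ oW Wp) => q Wq; rewrite etaE // sprodC.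
Qed.

Lemma crd_div_endo p : W p -> crd g u p (div_endo D S f p) =
  \sum_i (dirm p (f i p) (s i) + s i p *m (w p (f i p))^T
          - crd g u p (S p (D p (f i p) (f i)))).
Proof.
move=> Wp; rewrite linear_sum; apply: eq_bigr => i _.
have sS : smooth_vf W (fun q => S q (f i q)).
  apply: (smooth_vf_ext _ (combine_smooth fu (S_smooth i))) => q Wq.
  exact: (combine_crd _ fu Wq).
by rewrite linearB /= (crd_conn (lc_conn HD) _ fu Wp sS).
Qed.

Lemma crd_chiS p : W p -> crd g u p (chiS xi S f p) = \sum_i s i p *m (n i p)^T.
Proof. by move=> Wp; rewrite linear_sum; apply: eq_bigr => i _; rewrite /= crd_xi. Qed.

(** The action of the bracket [wG, N(f_i)] on phi0 is that of wG on the vector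
    s_i, because wG kills phi0. With chi^S = sum of N(f_i) s_i this completes w
    to wG in the formula for div S. *)
Lemma torsion_div_spinor p : W p -> 2^-1 *: (rho c (L p) *m phi0) =
  c (crd g u p (div_endo D S f p) + crd g u p (chiS xi S f p)) *m phi0
  + div_form D eta f p *: (j *m phi0).
Proof.
move=> Wp; rewrite crd_div_endo // crd_chiS // -big_split /= [c (\sum_i _)]linear_sum [X in _ = X + _]mulmx_suml.
rewrite /div_form scaler_suml -big_split /= -/(half _).
pose H := HB.pack_for {linear 'M[R]_6 -> 'cV[R]_8} half (GRing.isLinear.Build _ _ _ _ half half_lin).
rewrite -[LHS]/(H _) /torsion_div_mx linear_sum; apply: eq_bigr => i _; rewrite -[LHS]/(half _).
have [wGs k] := wG_kills (f i p) Wp.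
have wE : w p (f i p) = wG p (f i p) - n i p by rewrite /n /torsion_mx opprB addrC subrK.
have -> : w p (f i p) *m n i p - n i p *m w p (f i p)
    = wG p (f i p) *m n i p - n i p *m wG p (f i p).
  by rewrite wE; move: (n i p) => np; rewrite mulmxBl mulmxBr; mxring.
have br : half (wG p (f i p) *m n i p - n i p *m wG p (f i p)) =
    c (s i p *m (wG p (f i p))^T) *m phi0.
  have := rho_bracket c wGs (torsion_mx_skew (f i p) Wp).
  move=> /(congr1 (fun X => X *m phi0)); rewrite mulmxBl -!mulmxA k mulmx0 subr0.
  rewrite torsion_spinor2 // -scalemxAr mulmxDr -scalemxAr rho_clf // rho_j k !mulmx0.
  rewrite sub0r scaler0 addr0 -scalemxAl scaleNr scalerN => /oppr_inj /scalerI.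
  rewrite pnatr_eq0 => /(_ isT) e; rewrite /half -e.
  by rewrite scalerA mulVf ?pnatr_eq0 // scale1r.
have hl X Y Z : half (X + Y - Z) = half X + half Y - half Z.
  by rewrite -[half _]/(H _) linearB linearD.
rewrite hl br half_dirm // [half (N p _)]torsion_spinor //.
have e : s i p *m (w p (f i p))^T + s i p *m (n i p)^T = s i p *m (wG p (f i p))^T.
  by rewrite -mulmxDr -linearD /= wE subrK.
have -> : dirm p (f i p) (s i) + s i p *m (w p (f i p))^T
    - crd g u p (S p (D p (f i p) (f i))) + s i p *m (n i p)^T
  = dirm p (f i p) (s i) + s i p *m (wG p (f i p))^T
    - crd g u p (S p (D p (f i p) (f i))) by rewrite -e; mxring.
have cE X Y Z : c (X + Y - Z) *m phi0 = c X *m phi0 + c Y *m phi0 - c Z *m phi0.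
  by rewrite linearB linearD !mulmxDl mulNmx.
rewrite cE scalerBl.
by mxring.
Qed.

Lemma torsion_div_mx_eq0 p : W p -> rho c (L p) *m phi0 = 0 -> L p = 0.
Proof. by move=> Wp; apply: (torsion_module_inj phi01); apply: torsion_div_mxP. Qed.

(** rho commutes with j, so the term with xi_eta becomes
    - j . (S(eta) . phi + |eta|^2 j . phi) and cancels the last two summands. *)
Lemma harmonic_expression p (V : vec6 R) : W p -> (forall X, inner g p V X = eta p X) ->
  vec_act al p (chiS xi S f p) *m phi al p
  - 2^-1 *: (skew_act al p (xi p V) *m (j *m phi al p))
  + vec_act al p (div_endo D S f p) *m phi al p
  + div_form D eta f p *: (j *m phi al p)
  + j *m vec_act al p (S p V) *m phi al p
  - inner g p V V *: phi al p = h p *m (2^-1 *: (rho c (L p) *m phi0)).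
Proof.
move=> Wp HV; have sh := ad_spin ad Wp; have Ns := torsion_mx_skew V Wp.
rewrite torsion_div_spinor // -mulmxA !(adapted_vec_act ad) // (ad_phi ad Wp) -!(spin_jf _ sh).
rewrite (adapted_skew_act ad _ Wp Ns) => [|Y]; last exact: crd_xi.
rewrite rho_j torsion_spinor2 // -HV -!scalemxAr !scalerA mulVf ?pnatr_eq0 // scale1r.
rewrite [c (_ + _)]linearD !mulmxDl !mulmxDr -!scalemxAr j_j.
rewrite !mulmxN; mxring.
Qed.

Section NoPhase.
Hypothesis eta0 : forall p X, eta p X = 0.

Lemma torsion_spinor_eta0 q v : W q ->
  rho c (N q v) *m phi0 = c (2 *: crd g u q (S q v)) *m phi0.
Proof.
by move=> Wq; rewrite torsion_spinor2 // eta0 scale0r addr0 linearZ -scalemxAl.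
Qed.

Lemma chiS_eta0 p : W p -> crd g u p (chiS xi S f p) = 0.
Proof.
move=> Wp; rewrite crd_chiS // big1 // => i _.
have := torsion_kills_self phi01 (torsion_mxP (f i p) Wp) (torsion_spinor_eta0 (f i p) Wp).
rewrite -scalemxAl => /eqP; rewrite scaler_eq0 pnatr_eq0 /= => /eqP e.
exact: e.
Qed.

Lemma torsion_div_eta0 p : W p ->
  2^-1 *: (rho c (L p) *m phi0) = c (crd g u p (div_endo D S f p)) *m phi0.
Proof.
move=> Wp; rewrite torsion_div_spinor // chiS_eta0 // addr0 /div_form big1 ?scale0r ?addr0 //.
move=> i _; rewrite eta0 subr0 (dir_ext _ oW Wp (g := fun=> 0)) ?dir_cst //.
Qed.

Lemma rho_div_eta0 p : W p -> rho c (L p) *m phi0 = 0 <-> div_endo D S f p = 0.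
Proof.
move=> Wp; split=> e.
  apply: (crd_inj (onu Wp)); rewrite linear0; apply: (cl_phi_inj phi01 (c := c)).
  by rewrite -torsion_div_eta0 // e scaler0 linear0 mul0mx.
have := torsion_div_eta0 Wp; rewrite e !linear0 mul0mx => /eqP.
by rewrite scaler_eq0 invr_eq0 pnatr_eq0 /= => /eqP.
Qed.

(** J is constant in the frame u, so the i-th summand of div S is lambda times
    [w(f_i), J] f_i. Here wG commutes with J and N anticommutes with it, which
    leaves a multiple of N(f_i) J f_i. This vanishes by [torsion_action], since
    S f_i lies in the complex line of f_i. *)
Lemma W1_div_endo J p : is_Jphi phi J -> (exists lambda mu : R, forall p X,
    S p X = lambda *: J p X + mu *: X) -> W p -> div_endo D S f p = 0.
Proof.
move=> HJ [lam [mu SE]] Wp; apply: (crd_inj (onu Wp)); rewrite linear0.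
set J0 := spinJ c phi0.
have JE q X : W q -> crd g u q (J q X) = crd g u q X *m J0^T.
  move=> Wq; apply: (cl_phi_inj phi01 (c := c)); rewrite spinJ_cl //.
  have sh := ad_spin ad Wq; have := HJ al q X (ad_dom ad Wq).
  rewrite -mulmxA !(adapted_vec_act ad) // -(spin_jf _ sh) => /(congr1 (mulmx (h q)^T)).
  by rewrite !(mulmxA _ (h q)) !(spin_orthl sh) !mul1mx.
have SqE q X : W q -> crd g u q (S q X) = lam *: (crd g u q X *m J0^T) + mu *: crd g u q X.
  by move=> Wq; rewrite SE linearD !linearZ /= JE.
rewrite crd_div_endo // big1 // => i _; rewrite SqE //.
have fc := crd_smooth fu (sf i).
pose T := lam *: J0^T + mu *: 1%:M : 'M[R]_6.
have sE' q : W q -> s i q = crd g u q (f i q) *m T.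
  by move=> Wq; rewrite /s SqE // /T mulmxDr -!scalemxAr mulmx1.
rewrite (dirm_ext _ oW Wp sE').
rewrite (dirm_mul _ oW Wp fc (@smoothm_cst R M _ _ W T)) dirm_cst mulmx0 addr0 sE' //.
rewrite (crd_conn (lc_conn HD) _ fu Wp (sf i)).
set x := crd g u p (f i p); set dx := dirm _ _ _.
have [wGs k] := wG_kills (f i p) Wp; have CJ := kills_commutes phi01 wGs k.
have anti := torsion_anti phi01 (torsion_mxP (f i p) Wp) (torsion_spinor_eta0 (f i p) Wp).
have x1 : dot x x = 1.
  have [_ _ on] := ff; have := on p Wp i i; rewrite eqxx (inner_crd (onu Wp)); exact.
have xn : x *m J0^T *m (n i p)^T = 0.
  apply: (cl_phi_inj phi01 (c := c)); rewrite linear0 mul0mx.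
  have := torsion_action phi01 x (torsion_mxP (f i p) Wp) (torsion_spinor_eta0 (f i p) Wp).
  rewrite SqE // -/x scalerDr !scalerA complex_line_action // subrr => /eqP.
  by rewrite scaler_eq0 pnatr_eq0 /= => /eqP.
have wE : w p (f i p) = wG p (f i p) - n i p by rewrite /n /torsion_mx opprB addrC subrK.
have wJ : x *m J0^T *m (w p (f i p))^T = x *m (w p (f i p))^T *m J0^T.
  have a1 : x *m J0^T *m (wG p (f i p))^T = x *m (wG p (f i p))^T *m J0^T.
    by rewrite -!mulmxA -!trmx_mul CJ.
  have a2 : x *m (n i p)^T *m J0^T = 0.
    have trN (X Y : 'M[R]_6) : (- (X *m Y))^T = - (Y^T *m X^T) by rewrite linearN /= trmx_mul.
    by rewrite -mulmxA -trmx_mul anti trN mulmxN mulmxA xn oppr0.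
  by rewrite wE [(_ - _)^T]linearB /= !mulmxBr mulmxBl a1 a2 xn.
rewrite /T !mulmxDr !mulmxDl -!scalemxAr -!scalemxAl !mulmx1 wJ !scalerDr; mxring.
Qed.

End NoPhase.

End Fixed.

(** The divergence of xi is tensorial in Z and local, and adapted frames exist
    around every point; so harmonicity can be tested on their frame fields. *)
Lemma harmonicP (P : Q -> ('I_6 -> M -> vec6 R) -> M -> Prop) :
  (forall al W u h A f p, adapted phi0 phi al W u h A -> orthonormal_frame g W f -> W p ->
    rho c (torsion_div_mx u f p) *m phi0 = 0 <-> P al f p) ->
  harmonic_structure g D xi <->
  (forall al W f p, spin_dom al p -> orthonormal_frame g W f -> W p -> P al f p).
Proof.
move=> HP; split=> [harm al W f p alp ff Wp|hP W f Z p ff sZ Wp].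
  have [oW _ _] := ff.
  have [W' [u [h [A [ad W'p sub]]]]] := adapted_exists phi01 Hphi oW Wp alp.
  have ff' := frame_sub (ad_open ad) sub ff.
  apply/(HP _ _ _ _ _ _ _ ad ff' W'p).
  suff -> : torsion_div_mx u f p = 0 by rewrite linear0 mul0mx.
  apply: trmx_inj; rewrite trmx0; apply/row_matrixP => b; rewrite rowE row0.
  have [_ su on] := adapted_frame ad.
  rewrite -(crd_frame (on p W'p)) -(crd_torsion_div ad ff' W'p (su b)).
  by rewrite (harm W' f (u b) p ff' (su b) W'p) linear0.
have [al alp] := spin_dom_cover Q p; have [oW _ _] := ff.
have [W' [u [h [A [ad W'p sub]]]]] := adapted_exists phi01 Hphi oW Wp alp.
have ff' := frame_sub (ad_open ad) sub ff.
have L0 : torsion_div_mx u f p = 0.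
  apply: (torsion_div_mx_eq0 ad ff' W'p); apply/(HP _ _ _ _ _ _ _ ad ff' W'p).
  exact: hP alp ff Wp.
have [_ _ on] := adapted_frame ad; apply: (crd_inj (on p W'p)).
rewrite (crd_torsion_div ad ff' W'p (smooth_vf_sub sub sZ)) L0 trmx0 mulmx0 linear0.
by [].
Qed.

End Harmonic.

(** * Curvature of the Levi-Civita connection *)

(** Combine the four cyclic identities that each fix one of the four indices. *)
Lemma bianchi_pairs (R : realFieldType) (I : Type) (r : I -> I -> I -> I -> R) i k a b :
  (forall x y z t, r y x z t = - r x y z t) -> (forall x y z t, r x y t z = - r x y z t) ->
  (forall x y z t, r x y t z + r y z t x + r z x t y = 0) -> r i k a b = r a b i k.
Proof.
move=> an sk B.
have := B i k b a; have := B i k a b; have := B k a b i; have := B i a b k.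
rewrite (sk i k a b) (an a k b i) (sk a i k b) (an a k i b) (sk a k b i) (an k b i a).
rewrite (sk k b a i) (an a i k b) (sk a b i k) (sk b i a k).
by move=> *; lra.
Qed.

Section Curvature.
Context {R : realType} {M : oriented_manifold6 R} {g : riemannian_metric M}.
Variables (D : M -> 'rV[R]_6 -> (M -> 'rV[R]_6) -> 'rV[R]_6) (HD : levi_civita g D).
Variables (W : set M) (u : 'I_6 -> M -> vec6 R) (fu : orthonormal_frame g W u).
Local Notation basis a := (delta_mx 0 a : 'rV[R]_6).
Implicit Types (p q : M) (v : vec6 R).
Let oW : open W. Proof. by case: fu. Qed.
Let su a : smooth_vf W (u a). Proof. by case: fu => _ su _; apply: su. Qed.
Let onu q (Wq : W q) : Defs.orthonormal g q (u ^~ q).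
Proof. by case: fu => _ _ on; apply: on. Qed.
Let HC : is_connection D := lc_conn HD.

Definition conn_mx (i : 'I_6) q : 'M[R]_6 := conn_form g D u q (u i q).

Lemma crd_conn_frame k q v : W q -> crd g u q (D q v (u k)) = basis k *m (conn_form g D u q v)^T.
Proof.
move=> Wq; rewrite (crd_conn HC v fu Wq (su k)) (crd_frame (onu Wq)).
rewrite (dirm_ext v oW Wq (G := fun=> basis k)) ?dirm_cst ?add0r //.
by move=> r Wr; rewrite (crd_frame (onu Wr)).
Qed.

Lemma conn_form_crd q v : W q -> conn_form g D u q v = \sum_a crd g u q v 0 a *: conn_mx a q.
Proof.
move=> Wq; apply/matrixP => a b; rewrite summxE mxE -{1}(crdK (onu Wq) v).
rewrite (conn_suml HC _ _ oW Wq (su b)) inner_suml; apply: eq_bigr => k _.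
by rewrite innerZl !mxE.
Qed.

Lemma conn_mx_smooth i : smoothm W (conn_mx i).
Proof.
move=> a b; apply: (smooth_fun_ext oW (f := fun q => inner g q (D q (u i q) (u b)) (u a q))).
  by move=> q _; rewrite !mxE.
by apply: (gram_smooth g oW _ (su a)); apply: (conn_smooth HC).
Qed.

(** The Lie bracket of two frame fields, D being torsion-free. *)
Definition bracket (i k : 'I_6) q : vec6 R := D q (u i q) (u k) - D q (u k q) (u i).

Lemma crd_bracket i k q : W q ->
  crd g u q (bracket i k q) = basis k *m (conn_mx i q)^T - basis i *m (conn_mx k q)^T.
Proof. by move=> Wq; rewrite linearB /= !crd_conn_frame. Qed.

Lemma bracket_smooth i k : smooth_vf W (bracket i k).
Proof.
have sD a b : smooth_vf W (fun q => D q (u a q) (u b)) by apply: (conn_smooth HC).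
have s1 := smooth_vfZ (@smooth_fun_cst R M W (-1)) (sD k i).
apply: (smooth_vf_ext _ (smooth_vfD (sD i k) s1)) => q _.
by rewrite scaleN1r.
Qed.

Definition curvature_mx (i k : 'I_6) p : 'M[R]_6 :=
  dirm p (u i p) (conn_mx k) - dirm p (u k p) (conn_mx i)
  + (conn_mx i p *m conn_mx k p - conn_mx k p *m conn_mx i p)
  - conn_form g D u p (bracket i k p).

(** The iterated bracket of three frame fields. *)
Let triple i k l p := D p (u i p) (bracket k l) - D p (bracket k l p) (u i).

Let crd_triple i k l p : W p -> crd g u p (triple i k l p) =
  basis l *m (dirm p (u i p) (conn_mx k))^T - basis k *m (dirm p (u i p) (conn_mx l))^T
  + (basis l *m (conn_mx k p)^T - basis k *m (conn_mx l p)^T) *m (conn_mx i p)^T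
  - basis i *m (conn_form g D u p (bracket k l p))^T.
Proof.
move=> Wp; rewrite linearB /= crd_conn_frame //; congr (_ - _).
rewrite (crd_conn HC _ fu Wp (bracket_smooth k l)) crd_bracket //; congr (_ + _).
rewrite (dirm_ext _ oW Wp (G := fun q => basis l *m (conn_mx k q)^T - basis k *m (conn_mx l q)^T));
  last by move=> q Wq; rewrite crd_bracket.
have sB a b : smoothm W (fun q => basis a *m (conn_mx b q)^T).
  apply: smoothm_mul => //; first exact: smoothm_cst.
  by apply: smoothm_tr => //; apply: conn_mx_smooth.
have dB v a b : dirm p v (fun q => basis a *m (conn_mx b q)^T) = basis a *m (dirm p v (conn_mx b))^T.
  rewrite (dirm_mul v oW Wp (@smoothm_cst R M _ _ W (basis a)) (smoothm_tr oW (conn_mx_smooth b))).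
  by rewrite dirm_cst mul0mx add0r dirm_tr.
have s1 : smoothm W (fun q => -1 *: (basis k *m (conn_mx l q)^T)).
  exact: (smoothm_lin (GRing.scale (-1)) oW (sB k l)).
rewrite (dirm_ext _ oW Wp (G := fun q => basis l *m (conn_mx k q)^T
    + -1 *: (basis k *m (conn_mx l q)^T))); last by move=> q Wq; rewrite scaleN1r.
rewrite (dirmD _ Wp (sB l k) s1) dB; congr (_ + _).
by rewrite (dirm_lin (GRing.scale (-1)) _ oW Wp (sB k l)) dB /= scaleN1r.
Qed.

(** Jacobi identity: iterated brackets act on functions as iterated
    commutators of derivations. *)
Let jacobi i k l p : W p -> triple i k l p + triple k l i p + triple l i k p = 0.
Proof.
move=> Wp; apply: (dir_inj oW Wp) => W' f oW' W'p sub sf.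
have [_ _ tf] := HD.
have su' a : smooth_vf W' (u a) by apply: smooth_vf_sub (su a).
have sb' a b : smooth_vf W' (bracket a b) by apply: smooth_vf_sub (bracket_smooth a b).
have sd X : smooth_vf W' X -> forall f', smooth_fun W' f' -> smooth_fun W' (fun q => dir q (X q) f').
  by move=> sX f' sf'; apply: sX.
have dbr a b q : W' q -> dir q (bracket a b q) f =
    dir q (u a q) (fun r => dir r (u b r) f) - dir q (u b q) (fun r => dir r (u a r) f).
  by move=> W'q; apply: (tf W' (u a) (u b) f q oW' W'q).
have E a b d : dir p (triple a b d p) f =
    dir p (u a p) (fun q => dir q (u b q) (fun r => dir r (u d r) f))
    - dir p (u a p) (fun q => dir q (u d q) (fun r => dir r (u b r) f))
    - (dir p (u b p) (fun q => dir q (u d q) (fun r => dir r (u a r) f))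
    - dir p (u d p) (fun q => dir q (u b q) (fun r => dir r (u a r) f))).
  rewrite /triple (tf W' (u a) (bracket b d) f p oW' W'p (su' a) (sb' b d) sf).
  congr (_ - _).
    rewrite (dir_ext _ oW' W'p (g := fun q => dir q (u b q) (fun r => dir r (u d r) f)
      + -1 * dir q (u d q) (fun r => dir r (u b r) f))); last first.
      by move=> q W'q; rewrite dbr // mulN1r.
    have s1 : smooth_fun W' (fun q => dir q (u b q) (fun r => dir r (u d r) f)).
      exact: (sd _ (su' b) _ (sd _ (su' d) _ sf)).
    have s2 : smooth_fun W' (fun q => dir q (u d q) (fun r => dir r (u b r) f)).
      exact: (sd _ (su' d) _ (sd _ (su' b) _ sf)).
    by rewrite (dirD _ W'p s1 (smooth_funZ (-1) oW' s2)) (dirZ _ _ W'p s2) mulN1r.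
  exact: (tf W' (u b) (u d) _ p oW' W'p (su' b) (su' d) (sd _ (su' a) _ sf)).
have [X XE] : exists X : 'I_6 -> 'I_6 -> 'I_6 -> R, forall a b d,
    dir p (triple a b d p) f = X a b d - X a d b - (X b d a - X d b a).
  exists (fun a b d => dir p (u a p) (fun q => dir q (u b q) (fun r => dir r (u d r) f))).
  exact: E.
rewrite [dir p (_ + triple l i k p) f]dirDv [dir p (triple i k l p + _) f]dirDv !XE dir0v.
by ring.
Qed.

(** The Jacobi identity in components. *)
Lemma curvature_bianchi i k l p : W p ->
  basis l *m (curvature_mx i k p)^T + basis i *m (curvature_mx k l p)^T
  + basis k *m (curvature_mx l i p)^T = 0.
Proof.
move=> Wp; have := congr1 (crd g u p) (jacobi i k l Wp).
have cE X Y Z : crd g u p (X + Y + Z) = crd g u p X + crd g u p Y + crd g u p Z.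
  by rewrite !linearD.
rewrite linear0 cE !crd_triple // /curvature_mx => <-.
have E (b : 'rV[R]_6) (X Y Z T U : 'M[R]_6) : b *m (X - Y + (Z *m T - T *m Z) - U)^T =
    b *m X^T - b *m Y^T + (b *m T^T *m Z^T - b *m Z^T *m T^T) - b *m U^T.
  rewrite [(_ - U)^T]linearB /= [(_ + _)^T]linearD /= [(X - Y)^T]linearB /= [(_ - _)^T]linearB /=.
  by rewrite !trmx_mul mulmxBr mulmxDr !mulmxBr !mulmxA.
rewrite !E !mulmxBl.
move: (conn_form g D u p _) (conn_form g D u p _) (conn_form g D u p _) => B1 B2 B3.
move: (conn_mx i p) (conn_mx k p) (conn_mx l p) => wi wk wl.
by do 6![move: (dirm _ _ _) => ?]; mxring.
Qed.

Let conn_form_crd_skew p v : W p -> (conn_form g D u p v)^T = - conn_form g D u p v.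
Proof. by move=> Wp; apply: conn_form_skew fu Wp. Qed.

Lemma curvature_skew i k p : W p -> (curvature_mx i k p)^T = - curvature_mx i k p.
Proof.
move=> Wp; have ws a q : W q -> (conn_mx a q)^T = - conn_mx a q by apply: conn_form_crd_skew.
have ds a v : (dirm p v (conn_mx a))^T = - dirm p v (conn_mx a).
  rewrite -dirm_tr -[RHS]scaleN1r -(dirm_lin (GRing.scale (-1)) v oW Wp (conn_mx_smooth a)).
  by apply: (dirm_ext _ oW Wp) => q Wq; rewrite ws //= scaleN1r.
have E (X Y Z T U : 'M[R]_6) : X^T = - X -> Y^T = - Y -> Z^T = - Z -> T^T = - T -> U^T = - U ->
    (X - Y + (Z *m T - T *m Z) - U)^T = - (X - Y + (Z *m T - T *m Z) - U).
  move=> hX hY hZ hT hU.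
  rewrite [(_ - U)^T]linearB /= [(_ + _)^T]linearD /= [(X - Y)^T]linearB /= [(_ - _)^T]linearB /=.
  by rewrite !trmx_mul hX hY hZ hT hU !mulmxN !mulNmx; mxring.
by apply: E; rewrite ?ds ?ws ?conn_form_crd_skew.
Qed.

Lemma curvature_anti i k p : W p -> curvature_mx k i p = - curvature_mx i k p.
Proof.
move=> Wp; rewrite /curvature_mx.
have -> : conn_form g D u p (bracket k i p) = - conn_form g D u p (bracket i k p).
  rewrite !(conn_form_crd _ Wp) -sumrN; apply: eq_bigr => a _.
  by rewrite !crd_bracket // -scaleNr; congr (_ *: _); rewrite !mxE opprB.
by move: (dirm _ _ (conn_mx k)) (dirm _ _ (conn_mx i)) => d1 d2; mxring.
Qed.

Lemma curvature_pairs i k a b p : W p -> curvature_mx i k p a b = curvature_mx a b p i k.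
Proof.
move=> Wp.
have an x y z t : curvature_mx y x p z t = - curvature_mx x y p z t.
  by rewrite curvature_anti // mxE.
have sk x y z t : curvature_mx x y p t z = - curvature_mx x y p z t.
  by have /matrixP/(_ z t) := curvature_skew x y Wp; rewrite !mxE.
have B x y z t : curvature_mx x y p t z + curvature_mx y z p t x + curvature_mx z x p t y = 0.
  by have /rowP/(_ t) := curvature_bianchi x y z Wp; rewrite -!rowE !mxE.
exact: (@bianchi_pairs R _ (fun x y z t => curvature_mx x y p z t) i k a b an sk B).
Qed.

End Curvature.

(** * The divergence of a symmetric traceless S *)

Section ThreeForm.
Context {R : realType} (c : spin_module R) (phi : 'cV[R]_8).
Local Notation basis a := (delta_mx 0 a : 'rV[R]_6).

Let T (a b d : 'I_6) : R := sprod phi (c (basis a) *m (c (basis b) *m (c (basis d) *m phi))).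

Let T12 a b d : T b a d = - T a b d.
Proof.
by rewrite /T cl_swapf sprodDr !sprodNr sprodZr sprod_cl mulr0 subr0.
Qed.

Let T23 a b d : T a d b = - T a b d.
Proof.
rewrite /T (cl_swapf c (basis d)) mulmxDr !mulmxN -scalemxAr sprodDr !sprodNr sprodZr.
by rewrite sprod_cl mulr0 subr0.
Qed.

(** T is totally antisymmetric because g(x . phi, phi) = 0, so only the cyclic
    sums of F contribute. *)
Lemma clifford_bianchi (F : 'I_6 -> 'M[R]_6) : (forall k, (F k)^T = - F k) ->
  (forall k a b, F k a b + F a b k + F b k a = 0) ->
  \sum_k sprod phi (c (basis k) *m (rho c (F k) *m phi)) = 0.
Proof.
move=> Fs Fc; pose X := \sum_k \sum_a \sum_b F k a b * T k a b.
have -> : \sum_k sprod phi (c (basis k) *m (rho c (F k) *m phi)) = 2^-1 * X.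
  rewrite mulr_sumr; apply: eq_bigr => k _.
  rewrite rhoE // -scalemxAl -scalemxAr sprodZr; congr (_ * _).
  rewrite mulmx_suml mulmx_sumr exchange_big sprodC sprod_suml; apply: eq_bigr => b _ /=.
  rewrite [c (_ *m (F k)^T)]cl_sum mulmx_suml mulmx_suml mulmx_sumr sprod_suml.
  apply: eq_bigr => a _; rewrite -!scalemxAl -scalemxAr sprodZl sprodC -rowE !mxE.
  by rewrite -mulmxA.
have cyc k a b : T a b k = T k a b by rewrite T23 T12 opprK.
have rot (G : 'I_6 -> 'I_6 -> 'I_6 -> R) :
    \sum_k \sum_a \sum_b G k a b = \sum_k \sum_a \sum_b G a b k.
  by rewrite [RHS]exchange_big; apply: eq_bigr => k _ /=; rewrite exchange_big.
have X1 : X = \sum_k \sum_a \sum_b F a b k * T k a b.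
  by rewrite /X rot; do 3!apply: eq_bigr => ? _; rewrite cyc.
have X2 : X = \sum_k \sum_a \sum_b F b k a * T k a b.
  by rewrite X1 rot; do 3!apply: eq_bigr => ? _; rewrite cyc.
suff : X + X + X = 0 by move=> e; lra.
rewrite {2}X1 {2}X2 /X -!big_split big1 // => k _ /=; rewrite -!big_split big1 // => a _ /=.
by rewrite -!big_split big1 // => b _ /=; rewrite -!mulrDl Fc mul0r.
Qed.
End ThreeForm.

Section SymmetricEndomorphism.
Context {R : realType} (c : spin_module R) {M : oriented_manifold6 R} {g : riemannian_metric M}.
Variable Q : spin_structure c g.
Variables (D : M -> 'rV[R]_6 -> (M -> 'rV[R]_6) -> 'rV[R]_6) (HD : levi_civita g D).
Variables (phi : Q -> M -> 'cV[R]_8) (Hphi : unit_spinor_field phi).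
Variables (S : M -> {linear 'rV[R]_6 -> 'rV[R]_6}) (eta : M -> {scalar 'rV[R]_6}).
Hypothesis HS : spinor_derivative D phi S eta.
Variables (phi0 : 'cV[R]_8) (phi01 : unit_spinor phi0).
Variables (DG : M -> 'rV[R]_6 -> (M -> 'rV[R]_6) -> 'rV[R]_6).
Hypothesis HDG : SU3_connection phi0 phi D DG.
Hypothesis eta0 : forall p X, eta p X = 0.
Hypothesis Ssym : forall p X Y, inner g p (S p X) Y = inner g p X (S p Y).
Hypothesis Str : forall p, \tr (lin1_mx (S p)) = 0.
Variables (al : Q) (W : set M).
Variables (u : 'I_6 -> M -> vec6 R) (h : M -> 'M[R]_8) (A : M -> 'M[R]_6).
Hypothesis ad : adapted phi0 phi al W u h A.
Local Notation basis a := (delta_mx 0 a : 'rV[R]_6).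
Local Notation j := (jmx c).
Implicit Types (p q : M) (v : vec6 R).
Let oW : open W := ad_open ad.
Let fu : orthonormal_frame g W u := adapted_frame ad.
Let onu q (Wq : W q) : Defs.orthonormal g q (u ^~ q).
Proof. by have [_ _] := fu; apply. Qed.
Let su b : smooth_vf W (u b).
Proof. by have [_ su _] := fu; apply: su. Qed.
Local Notation w := (conn_mx (g := g) D u).

(** The matrix of S in the frame u, rows being images of frame vectors. *)
Definition frame_mx q : 'M[R]_6 := \matrix_a crd g u q (S q (u a q)).

Lemma frame_mx_smooth : smoothm W frame_mx.
Proof.
move=> a b; have h1 := S_smooth HD Hphi HS phi01 HDG ad fu a 0 b.
by apply: (smooth_fun_ext oW _ h1) => q _; rewrite /frame_mx [in RHS]mxE.
Qed.

Lemma crd_S q X : W q -> crd g u q (S q X) = crd g u q X *m frame_mx q.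
Proof.
move=> Wq; rewrite -{1}(crdK (onu Wq) X) !linear_sum [crd g u q X in RHS]row_sum_delta mulmx_suml.
apply: eq_bigr => a _; rewrite !linearZ /= -scalemxAl -rowE; congr (_ *: _).
by apply/rowP => b; rewrite !mxE.
Qed.

Lemma frame_mx_sym q : W q -> (frame_mx q)^T = frame_mx q.
Proof. by move=> Wq; apply/matrixP => a b; rewrite !mxE Ssym innerC. Qed.

Lemma frame_mx_tr q : W q -> \tr (frame_mx q) = 0.
Proof.
move=> Wq; pose E : 'M[R]_6 := \matrix_a u a q; pose C := lin1_mx (crd g u q).
have EC : E *m C = 1%:M.
  by apply/row_matrixP => a; rewrite row_mul rowK mul_rV_lin1 /= (crd_frame (onu Wq)) row1.
have -> : frame_mx q = E *m lin1_mx (S q) *m C.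
  apply/row_matrixP => a; rewrite !row_mul !rowK mul_rV_lin1 mul_rV_lin1 /=.
  by [].
by rewrite -mulmxA mxtrace_mulC -mulmxA (mulmx1C EC) mulmx1 Str.
Qed.

(** The matrix of the covariant derivative of S along v. *)
Definition nabla_mx p v : 'M[R]_6 := dirm p v frame_mx
  + frame_mx p *m (conn_form g D u p v)^T - (conn_form g D u p v)^T *m frame_mx p.

Let wskew p v : W p -> (conn_form g D u p v)^T = - conn_form g D u p v.
Proof. by move=> Wp; apply: (conn_form_skew HD v fu Wp). Qed.

Lemma nabla_mx_sym p v : W p -> (nabla_mx p v)^T = nabla_mx p v.
Proof.
move=> Wp; rewrite /nabla_mx wskew //; set B := conn_form g D u p v.
have ds : (dirm p v frame_mx)^T = dirm p v frame_mx.
  by rewrite -dirm_tr; apply: (dirm_ext v oW Wp) => q Wq; rewrite frame_mx_sym.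
have Bs : B^T = - B by apply: wskew.
rewrite [(_ - _)^T]linearB /= [(_ + _)^T]linearD /= !trmx_mul ds frame_mx_sym //.
by rewrite linearN /= Bs opprK !mulmxN !mulNmx; mxring.
Qed.

Lemma nabla_mx_tr p v : W p -> \tr (nabla_mx p v) = 0.
Proof.
move=> Wp; rewrite /nabla_mx [\tr (_ - _)]linearB /= [\tr (_ + _)]linearD /=.
rewrite (mxtrace_mulC (frame_mx p)) addrK.
transitivity (dir p v (fun q => \sum_a frame_mx q a a)).
  rewrite (dir_sum _ _ _ oW Wp) => [|a]; last exact: frame_mx_smooth.
  by apply: eq_bigr => a _; rewrite mxE.
by rewrite (dir_ext v oW Wp (g := fun=> 0)) ?dir_cst // => q Wq; apply: frame_mx_tr.
Qed.

(** This linearity makes the divergence independent of the orthonormal frame. *)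
Lemma nabla_mx_lin p v : W p ->
  nabla_mx p v = \sum_a crd g u p v 0 a *: nabla_mx p (u a p).
Proof.
move=> Wp; rewrite {1}/nabla_mx (conn_form_crd HD fu v Wp) linear_sum mulmx_sumr mulmx_suml.
rewrite -{1}(crdK (onu Wp) v) dirm_sumv -big_split -sumrB; apply: eq_bigr => a _ /=.
by rewrite linearZ /= -scalemxAr -scalemxAl -scalerDr -scalerBr.
Qed.

Lemma crd_div_endo_nabla f p : orthonormal_frame g W f -> W p ->
  crd g u p (div_endo D S f p) = \sum_a basis a *m nabla_mx p (u a p).
Proof.
move=> ff Wp; have [_ sf onf] := ff.
rewrite (crd_div_endo HD Hphi HS phi01 HDG ad ff Wp).
transitivity (\sum_i crd g u p (f i p) *m nabla_mx p (f i p)).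
  apply: eq_bigr => i _; rewrite crd_S // (crd_S _ Wp).
  have fc := crd_smooth fu (sf i).
  rewrite (dirm_ext _ oW Wp (G := fun q => crd g u q (f i q) *m frame_mx q)); last first.
    by move=> q Wq; rewrite crd_S.
  rewrite (dirm_mul _ oW Wp fc frame_mx_smooth) (crd_conn (lc_conn HD) _ fu Wp (sf i)).
  by rewrite /nabla_mx mulmxBr mulmxDr mulmxDl !mulmxA; mxring.
transitivity (\sum_i \sum_a crd g u p (f i p) 0 a *: (crd g u p (f i p) *m nabla_mx p (u a p))).
  apply: eq_bigr => i _; rewrite [in LHS]nabla_mx_lin // mulmx_sumr.
  by apply: eq_bigr => a _; rewrite -scalemxAr.
rewrite exchange_big; apply: eq_bigr => a _ /=.
under eq_bigr do rewrite scalemxAl; rewrite -mulmx_suml; congr (_ *m _).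
pose X : 'M[R]_6 := \matrix_i crd g u p (f i p).
have XX : X *m X^T = 1%:M.
  apply/matrixP => i k; rewrite [RHS]mxE -(onf p Wp) (inner_crd (onu Wp)) dotE mxE.
  by apply: eq_bigr => b _; rewrite !mxE.
apply/rowP => b; have /matrixP/(_ a b) := mulmx1C XX; rewrite summxE !mxE eqxx eq_sym => <-.
by apply: eq_bigr => i _; rewrite !mxE.
Qed.

(** The representation of so(6) on spinors; on connection forms it gives the
    covariant derivative of phi, which is represented by phi0. *)
Let sigma (B : 'M[R]_6) : 'M[R]_8 := - 2^-1 *: rho c B.

Let sigma_cl B (x : 'rV[R]_6) (f : 'cV[R]_8) : B^T = - B ->
  sigma B *m (c x *m f) = c x *m (sigma B *m f) + c (x *m B^T) *m f.
Proof.
move=> Bs; rewrite /sigma -!scalemxAl rho_clf // scalerBr -scalemxAr; congr (_ + _).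
by rewrite scaleNr opprK scalerA mulVf ?pnatr_eq0 // scale1r.
Qed.

Let sigma_bracket A' B (f : 'cV[R]_8) : A'^T = - A' -> B^T = - B ->
  sigma (A' *m B - B *m A') *m f = sigma A' *m (sigma B *m f) - sigma B *m (sigma A' *m f).
Proof.
move=> As Bs; rewrite /sigma -!scalemxAl -!scalemxAr !scalerA -scalerBr !mulmxA -mulmxBl.
by rewrite rho_bracket // -scalemxAl scalerA; congr (_ *: _); field.
Qed.

Let sigma_conn p v : W p ->
  sigma (conn_form g D u p v) *m phi0 = c (crd g u p v *m frame_mx p) *m phi0.
Proof.
move=> Wp; have := torsion_spinor HD Hphi HS phi01 HDG ad v Wp.
rewrite eta0 scale0r addr0 crd_S // => <-.
have [_ k] := wG_kills phi01 HDG ad v Wp.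
by rewrite /torsion_mx linearB mulmxBl k sub0r scalerN -scaleNr /sigma -scalemxAl.
Qed.

Let sigma_dirm i p v : W p -> sigma (dirm p v (w i)) *m phi0 = c (basis i *m dirm p v frame_mx) *m phi0.
Proof.
move=> Wp.
have tE q : W q -> - 2^-1 *: (rho c (w i q) *m phi0) = c (basis i *m frame_mx q) *m phi0.
  by move=> Wq; rewrite scalemxAl -/(sigma _) sigma_conn // (crd_frame (onu Wq)).
have st : smoothm W (fun q => basis i *m frame_mx q).
  by apply: smoothm_mul => //; [apply: smoothm_cst|apply: frame_mx_smooth].
have h1 := dirm_lin (GRing.scale (- 2^-1) \o (mulmxr phi0 \o rho c) : {linear _ -> _})
  v oW Wp (conn_mx_smooth HD fu i).
have h2 := dirm_lin (mulmxr phi0 \o c : {linear _ -> _}) v oW Wp st.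
move: h2; rewrite (dirm_mul v oW Wp (@smoothm_cst R M _ _ W (basis i)) frame_mx_smooth).
rewrite dirm_cst mul0mx add0r /= => <-; rewrite /sigma -scalemxAl.
move: h1; rewrite /= => <-.
exact: (dirm_ext v oW Wp tE).
Qed.

(** The alternating part (nabla_i S)(u_k) - (nabla_k S)(u_i). *)
Let curl (i k : 'I_6) p : 'rV[R]_6 := basis k *m nabla_mx p (u i p) - basis i *m nabla_mx p (u k p).

Let spinor_curvature i k p : W p -> sigma (curvature_mx (g := g) D u i k p) *m phi0 =
  c (curl i k p) *m phi0 + (c (row k (frame_mx p)) *m (c (row i (frame_mx p)) *m phi0)
    - c (row i (frame_mx p)) *m (c (row k (frame_mx p)) *m phi0)).
Proof.
move=> Wp; have ws a : (w a p)^T = - w a p by apply: wskew.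
have sl (X Y Z T : 'M[R]_6) : sigma (X - Y + Z - T) *m phi0 =
    sigma X *m phi0 - sigma Y *m phi0 + sigma Z *m phi0 - sigma T *m phi0.
  have rl : rho c (X - Y + Z - T) = rho c X - rho c Y + rho c Z - rho c T.
    by rewrite [LHS]linearB /= [X in X - _ = _]linearD /= [X in X + _ - _ = _]linearB.
  by rewrite /sigma -!scalemxAl rl !mulmxDl !mulNmx; mxring.
have sw a : sigma (w a p) *m phi0 = c (row a (frame_mx p)) *m phi0.
  by rewrite (sigma_conn (u a p) Wp) (crd_frame (onu Wp)) -rowE.
rewrite /curvature_mx sl.
rewrite [X in X - _ + _ - _ = _](sigma_dirm k (u i p) Wp).
rewrite [X in _ - X + _ - _ = _](sigma_dirm i (u k p) Wp).
rewrite (sigma_bracket phi0 (ws i) (ws k)).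
rewrite (sigma_conn (bracket D u i k p) Wp) (crd_bracket HD fu i k Wp) -!rowE !sw.
rewrite (sigma_cl _ _ (ws i)) (sigma_cl _ _ (ws k)) !sw.
have tE : curl i k p = row k (dirm p (u i p) frame_mx) - row i (dirm p (u k p) frame_mx)
    + (row k (frame_mx p) *m (w i p)^T - row i (frame_mx p) *m (w k p)^T)
    - (row k (w i p)^T - row i (w k p)^T) *m frame_mx p.
  rewrite /curl /nabla_mx !rowE mulmxBl.
  rewrite !(mulmxBr (basis _)) !(mulmxDr (basis _)) !mulmxA.
  by mxring.
have cl5 (X Y Z T U : 'rV[R]_6) : c (X - Y + (Z - T) - U) *m phi0 = c X *m phi0 - c Y *m phi0
    + (c Z *m phi0 - c T *m phi0) - c U *m phi0.
  have cl5 : c (X - Y + (Z - T) - U) = c X - c Y + (c Z - c T) - c U.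
    rewrite [LHS]linearB /= [X in X - _ = _]linearD /= [X in X + _ - _ = _]linearB /=.
    by rewrite [X in _ + X - _ = _]linearB.
  by rewrite cl5 !mulmxDl !mulNmx; mxring.
by rewrite tE cl5 !rowE; mxring.
Qed.

(** Contract [spinor_curvature] with Clifford multiplication by u_k and take the
    component along phi0. The left side vanishes by [clifford_bianchi] and the
    pair symmetry of the curvature. On the right the quadratic terms vanish
    because the sum of u_k . S(u_k), for S symmetric, is - tr S = 0. What remains
    is tr(nabla_i S) - (div S)_i, and the trace is 0 too. *)
Lemma div_endo_symmetric f p : orthonormal_frame g W f -> W p -> div_endo D S f p = 0.
Proof.
move=> ff Wp; apply: (crd_inj (onu Wp)); rewrite linear0 crd_div_endo_nabla //.
apply/rowP => i; rewrite mxE.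
set G := frame_mx p.
have bb a b : dot (basis a) (basis b) = (b == a)%:R by rewrite dot_basisr mxE eqxx.
have GG : \sum_k c (basis k) *m c (row k G) = 0.
  have Gs a b : G a b = G b a.
    by have /matrixP/(_ a b) := frame_mx_sym Wp; rewrite mxE => ->.
  have E : \sum_k c (basis k) *m c (row k G) = \sum_k \sum_b G k b *: (c (basis k) *m c (basis b)).
    apply: eq_bigr => k _; rewrite [c (row k G)]cl_sum mulmx_sumr; apply: eq_bigr => b _.
    by rewrite -scalemxAr mxE.
  have E2 : \sum_k \sum_b G k b *: (c (basis k) *m c (basis b))
     + \sum_k \sum_b G k b *: (c (basis k) *m c (basis b)) = 0.
    rewrite {2}exchange_big /= -big_split /=.
    transitivity (\sum_k (- (2 * G k k))%:M : 'M[R]_8).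
      apply: eq_bigr => k _; rewrite -big_split /= (bigD1 k) //= big1 ?addr0.
        by rewrite -scalerDr cl_anticomm bb eqxx mulr1 scale_scalar_mx mulrN mulrC.
      move=> b bk; rewrite (Gs b k) -scalerDr cl_anticomm bb (negPf bk).
      by rewrite mulr0 oppr0 raddf0 scaler0.
    rewrite -raddf_sum sumrN -mulr_sumr; have := frame_mx_tr Wp; rewrite /mxtrace => ->.
    by rewrite mulr0 oppr0 raddf0.
  by rewrite E; apply/matrixP => a b; have /matrixP/(_ a b) := E2; rewrite !mxE => e; lra.
have GGf f' : \sum_k c (basis k) *m (c (row k G) *m f') = 0.
  by under eq_bigr do rewrite mulmxA; rewrite -mulmx_suml GG mul0mx.
have B : \sum_k sprod phi0 (c (basis k) *m (sigma (curvature_mx (g := g) D u i k p) *m phi0)) = 0.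
  under eq_bigr do rewrite /sigma -scalemxAl -scalemxAr sprodZr.
  rewrite -mulr_sumr (clifford_bianchi c phi0 (F := fun k => curvature_mx (g := g) D u i k p)) ?mulr0 //.
    by move=> k; apply: (curvature_skew HD fu).
  move=> k a b; rewrite (curvature_pairs HD fu i k a b Wp) (curvature_pairs HD fu i a b k Wp).
  rewrite (curvature_pairs HD fu i b k a Wp).
  have := curvature_bianchi HD fu a b k Wp.
  move: (curvature_mx D u a b p) (curvature_mx D u b k p) (curvature_mx D u k a p) => X Y Z.
  by move=> /rowP/(_ i); rewrite -!rowE !mxE.
have Bk k : sprod phi0 (c (basis k) *m (sigma (curvature_mx (g := g) D u i k p) *m phi0)) =
    - curl i k p 0 k + sprod phi0 (c (basis k) *m (c (row k G) *m (c (row i G) *m phi0)))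
    + (sprod phi0 (c (row i G) *m (c (basis k) *m (c (row k G) *m phi0))))
    + sprod phi0 (c (2 * G i k *: row k G) *m phi0).
  rewrite spinor_curvature // -/G !mulmxDr mulmxN !sprodDr sprodNr.
  rewrite (cl_swapf c (basis k) (row i G)) sprodDr !sprodNr sprodZr !sprod_cl mulr0 subr0 opprK.
  rewrite addr0; rewrite -!addrA; congr (_ + _).
  have := cl_adj c (basis k) phi0 (c (curl i k p) *m phi0).
  rewrite cl_norm [sprod phi0 phi0]phi01 mulr1 dotC dot_basisr => e.
  by rewrite -[LHS]opprK -e.
have X0 : \sum_k sprod phi0 (c (basis k) *m (c (row k G) *m (c (row i G) *m phi0))) = 0.
  under eq_bigr do rewrite sprodC.
  by rewrite -sprod_suml GGf sprod0l.
have Y0 : \sum_k sprod phi0 (c (row i G) *m (c (basis k) *m (c (row k G) *m phi0))) = 0.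
  under eq_bigr do rewrite sprodC.
  by rewrite -sprod_suml -mulmx_sumr GGf mulmx0 sprod0l.
have t0 : \sum_k curl i k p 0 k = 0.
  move: B; under eq_bigr do rewrite Bk sprod_cl addr0.
  by rewrite !big_split /= X0 Y0 !addr0 sumrN => /eqP; rewrite oppr_eq0 => /eqP.
have tE k : curl i k p 0 k = nabla_mx p (u i p) k k - nabla_mx p (u k p) k i.
  have E3 (X Y : 'M[R]_6) : (basis k *m X - basis i *m Y) 0 k = X k k - Y i k.
    by rewrite -!rowE !mxE.
  rewrite /curl E3.
  by have /matrixP/(_ k i) := nabla_mx_sym (u k p) Wp; rewrite mxE => ->.
have tr0 := nabla_mx_tr (u i p) Wp; rewrite /mxtrace in tr0.
move: t0; under eq_bigr do rewrite tE.
rewrite sumrB tr0 sub0r => /eqP; rewrite oppr_eq0 => /eqP t0.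
by rewrite summxE -[RHS]t0; apply: eq_bigr => a _; rewrite -rowE mxE.
Qed.

End SymmetricEndomorphism.

(** * The characterization of harmonicity *)

Theorem theorem3p3 (R : realType) (c : spin_module R)
    (M : oriented_manifold6 R) (g : riemannian_metric M)
    (D : M -> 'rV[R]_6 -> (M -> 'rV[R]_6) -> 'rV[R]_6) (HD : levi_civita g D)
    (Q : spin_structure c g)
    (phi : Q -> M -> 'cV[R]_8) (Hphi : unit_spinor_field phi)
    (S : M -> {linear 'rV[R]_6 -> 'rV[R]_6}) (eta : M -> {scalar 'rV[R]_6})
    (HS : spinor_derivative D phi S eta)
    (etas : M -> 'rV[R]_6) (Hetas : dual_field g eta etas)
    (J : M -> 'rV[R]_6 -> 'rV[R]_6) (HJ : is_Jphi phi J)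
    (phi0 : 'cV[R]_8) (Hphi0 : unit_spinor phi0)
    (DG : M -> 'rV[R]_6 -> (M -> 'rV[R]_6) -> 'rV[R]_6)
    (HDG : SU3_connection phi0 phi D DG)
    (xi : M -> 'rV[R]_6 -> 'rV[R]_6 -> 'rV[R]_6)
    (Hxi : intrinsic_torsion D DG xi) :
  [/\ harmonic_structure g D xi <->
      (forall (al : Q) (W : set M) (e : 'I_6 -> M -> 'rV[R]_6) (p : M),
         spin_dom al p -> orthonormal_frame g W e -> W p ->
         vec_act al p (chiS xi S e p) *m phi al p
         - 2^-1 *: (skew_act al p (xi p (etas p)) *m (jmx c *m phi al p))
         + vec_act al p (div_endo D S e p) *m phi al p
         + div_form D eta e p *: (jmx c *m phi al p)
         + jmx c *m vec_act al p (S p (etas p)) *m phi al p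
         - inner g p (etas p) (etas p) *: phi al p = 0),
      (forall p X, eta p X = 0) ->
        (harmonic_structure g D xi <->
         (forall (W : set M) (e : 'I_6 -> M -> 'rV[R]_6) (p : M),
            orthonormal_frame g W e -> W p -> div_endo D S e p = 0))
    & class_W1 J S eta \/ class_W3 g J S eta -> harmonic_structure g D xi].
Proof.
have eta_part : (forall p X, eta p X = 0) -> harmonic_structure g D xi <->
    (forall (W : set M) (e : 'I_6 -> M -> 'rV[R]_6) (p : M),
       orthonormal_frame g W e -> W p -> div_endo D S e p = 0).
  move=> eta0; have HP := harmonicP HD Hphi Hphi0 HDG Hxi (P := fun _ f p => div_endo D S f p = 0).
  apply: iff_trans (HP _) _.
    move=> al W u h A f p ad ff Wp.
    exact: (rho_div_eta0 HD Hphi HS Hphi0 HDG Hxi ad ff eta0 Wp).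
  split=> [H W e p fe Wp|H al W e p _ fe Wp]; last exact: H fe Wp.
  by have [al alp] := spin_dom_cover Q p; apply: H alp fe Wp.
split=> //.
- apply: (harmonicP HD Hphi Hphi0 HDG Hxi (P := fun al e p =>
    vec_act al p (chiS xi S e p) *m phi al p
    - 2^-1 *: (skew_act al p (xi p (etas p)) *m (jmx c *m phi al p))
    + vec_act al p (div_endo D S e p) *m phi al p
    + div_form D eta e p *: (jmx c *m phi al p)
    + jmx c *m vec_act al p (S p (etas p)) *m phi al p
    - inner g p (etas p) (etas p) *: phi al p = 0)).
  move=> al W u h A f p ad ff Wp.
  rewrite (harmonic_expression HD Hphi HS Hphi0 HDG Hxi ad ff Wp (Hetas p)).
  split=> [->|e]; first by rewrite scaler0 mulmx0.
  have := congr1 (mulmx (h p)^T) e.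
  rewrite mulmxA (spin_orthl (ad_spin ad Wp)) mul1mx mulmx0 => /eqP.
  by rewrite scaler_eq0 invr_eq0 pnatr_eq0 /= => /eqP.
- have divP : (forall p X, eta p X = 0) ->
      (forall al W u h A f p, adapted phi0 phi al W u h A -> orthonormal_frame g W f ->
        W p -> div_endo D S f p = 0) -> harmonic_structure g D xi.
    move=> eta0 H; apply/(eta_part eta0) => W f p ff Wp; have [oW _ _] := ff.
    have [al alp] := spin_dom_cover Q p.
    have [W' [u [h [A [ad W'p sub]]]]] := adapted_exists Hphi0 Hphi oW Wp alp.
    exact: H ad (frame_sub (ad_open ad) sub ff) W'p.
  case=> [[eta0 SE]|[eta0 Ssym Str _]]; apply: divP => // al W u h A f p ad ff Wp.
    exact: (W1_div_endo HD Hphi HS Hphi0 HDG ad ff eta0 HJ SE Wp).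
  exact: (div_endo_symmetric HD Hphi HS Hphi0 HDG eta0 Ssym Str ad ff Wp).
Qed.
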